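(* Assume the Riemann hypothesis. Let $\sigma_1$ and $\sigma_2$ be fixed with $1/2<\sigma_1<\sigma_2<1$. Then there is a positive constant $A$ depending only on $\sigma_1$ and $\sigma_2$ such that for every critical point $\rho'=\beta'+i\gamma'$ of the Riemann zeta function (i.e. $\zeta'(\rho')=0$) with $\sigma_1<\beta'<\sigma_2$ (and $\gamma'$ sufficiently large), $$\log|\zeta(\rho')|\le A\,\frac{(\log\gamma')^{2-2\beta'}}{\log\log\gamma'}.$$
   Context: $\zeta$ denotes the Riemann zeta function; a critical point of $\zeta$ is a point $\rho'$ with $\zeta'(\rho')=0$, written $\rho'=\beta'+i\gamma'$ with $\beta',\gamma'$ real. *)

(* Defs.v *)
(* Stdlib reals, with Coquelicot's complex numbers [C = R * R]. *)
From Stdlib Require Import Reals.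
From Coquelicot Require Import Coquelicot.
Open Scope R_scope.

Definition cexp (z : C) : C :=
  (exp (Re z) * cos (Im z), exp (Re z) * sin (Im z)).

(* [(n+1)^(-s)], with the real logarithm: series are indexed from [0]. *)
Definition dirichlet_term (s : C) (n : nat) : C :=
  cexp (Copp (Cmult s (RtoC (ln (INR (S n)))))).

(* [zeta] is the analytic continuation to [C \ {1}] of the Dirichlet series
   [sum_(n >= 1) n^(-s)]. This determines [zeta] everywhere except at [s = 1],
   the pole, where the value of the total function is irrelevant.
   Over [C_AbsRing], [ex_derive] is complex differentiability. *)
Definition is_riemann_zeta (zeta : C -> C) : Prop :=
  (forall s : C, s <> RtoC 1 ->
     @ex_derive C_AbsRing C_NormedModule zeta s) /\
  (forall s : C, 1 < Re s ->
     @is_series C_AbsRing C_NormedModule (dirichlet_term s) (zeta s)).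

Definition riemann_hypothesis (zeta : C -> C) : Prop :=
  forall s : C, 0 < Re s < 1 -> zeta s = RtoC 0 -> Re s = 1 / 2.

Definition critical_point (f : C -> C) (z : C) : Prop :=
  @is_derive C_AbsRing C_NormedModule f z (RtoC 0).

(* Main.v *)
(* Littlewood's argument, with a subharmonicity step in place of the explicit formula.
   Put [h = zeta'/zeta], [l = log t], [X = l^2]. Removing from [zeta] its zeros in a disc around
   [2 + it] by Blaschke factors (there are [O(log t)] of them, all with real part at most [1/2])
   gives [Re h >= - K log t] for [Re s > 1/2] and [|h| <= K log t (1 + 1/(Re s - 1/2))].
   Hence [H = h + K' log t] has positive real part and [|H|^(1/2) <= 2^(1/2) Re (H^(1/2))], a harmonic
   function. Let [G = h + sum_(n <= X) Lambda(n) n^(-s)]. The maximum principle for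
   [|G X^s e^((s-s0)^2)|^(1/2) - C l^(1/2) Re (H^(1/2))] on the rectangle
   [1/2 + 1/log X <= Re s <= 3], [|Im s - t| <= l] yields [|G| <= C X^(1 - Re s)] for
   [Re s >= sigma1]. Integrating [Re G] in [Re s] from [sigma] to [2] and using Chebyshev's bound
   gives [log |zeta| <= A X^(1-sigma) / log X]. *)
Require Import Defs.
From Stdlib Require Import Reals.
From Coquelicot Require Import Coquelicot.
From Stdlib Require Import ZArith Lra Lia Psatz Classical ClassicalEpsilon.
From mathcomp Require ssreflect ssrfun ssrbool eqtype ssrnat seq div prime.
Open Scope R_scope.

(** * Complex differentiability *)

(** The choice [X = l^2] balances the edges of the rectangle. On the left edge [X^(Re s)] is [e l],
    so a part of [G] of size [l] contributes [X]; on the right edge the tail of the series is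
    [O(X^(-2))] and meets [X^3]; on the horizontal edges the Gaussian [e^(-l^2)] beats every power
    of [l]. The value at [s0] is then [O(X)], and division by [X^sigma] gives the claim. The
    obstacle is the left edge, where [h] is only known to be [O(l log X)]. Inserted as a constant,
    this bound would lose a factor [log X], that is, the whole denominator of the theorem. The
    harmonic majorant varies instead: it is as large as needed on the edge and [O(l^(1/2))] at [s0].
    A power of [H] with exponent below 1 is needed for its modulus to be controlled by its real
    part, and 1/2 is the simplest one. The complex analysis rests on rectangles: Cauchy's formula
    makes derivatives differentiable, and second-order expansions then yield the maximum principle,
    Schwarz's lemma and termwise differentiation without power series or residues. *)

Definition ccont (f : C -> C) (z : C) : Prop :=
  forall eps, 0 < eps -> exists d, 0 < d /\
    forall w, Cmod (w - z) < d -> Cmod (f w - f z) < eps.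

Definition slope (f : C -> C) (z l w : C) : C :=
  if Ceq_dec w z then l else ((f w - f z) / (w - z))%C.

(* Caratheodory's form of complex differentiability. *)
Definition cder (f : C -> C) (z l : C) : Prop := ccont (slope f z l) z.

Lemma Csub_neq (a b : C) : a <> b -> (a - b)%C <> 0%C.
Proof.
  intros H E; apply H.
  replace a with ((a - b) + b)%C by ring; rewrite E; ring.
Qed.

Lemma RtoC_neq (a : R) : a <> 0 -> RtoC a <> 0%C.
Proof. intros N E; apply N, RtoC_inj, E. Qed.

Lemma Cmod_sub_gt0 (a b : C) : a <> b -> 0 < Cmod (a - b).
Proof. intros H; apply Cmod_gt_0, Csub_neq, H. Qed.

Lemma Cmod_sub_sym (a b : C) : Cmod (a - b) = Cmod (b - a).
Proof. rewrite <- Cmod_opp; f_equal; ring. Qed.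

Lemma Cmod_triangle_sub (a b : C) : Cmod (a - b) <= Cmod a + Cmod b.
Proof. unfold Cminus; rewrite <- (Cmod_opp b); apply Cmod_triangle. Qed.

Lemma Cmod_triangle_rev (a b : C) : Cmod a - Cmod b <= Cmod (a - b).
Proof.
  assert (H := Cmod_triangle (a - b) b).
  replace (a - b + b)%C with a in H by ring; lra.
Qed.

Lemma Cmod_triangle3 (a b c : C) : Cmod (a - c) <= Cmod (a - b) + Cmod (b - c).
Proof. replace (a - c)%C with ((a - b) + (b - c))%C by ring; apply Cmod_triangle. Qed.

Lemma im_le_Cmod (c : C) : Rabs (Im c) <= Cmod c.
Proof. apply Rle_trans with (2 := Rmax_Cmod c); apply Rmax_r. Qed.

Lemma Cmod_le_re_im (c : C) : Cmod c <= Rabs (Re c) + Rabs (Im c).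
Proof.
  destruct c as [x y]; unfold Cmod; simpl fst; simpl snd; unfold Re, Im; simpl.
  assert (Hx := Rabs_pos x); assert (Hy := Rabs_pos y).
  rewrite <- (sqrt_Rsqr (Rabs x + Rabs y)) by lra.
  apply sqrt_le_1_alt.
  assert (Ex : x * (x * 1) = Rabs x * Rabs x)
    by (rewrite <- Rabs_mult, Rabs_pos_eq by nra; ring).
  assert (Ey : y * (y * 1) = Rabs y * Rabs y)
    by (rewrite <- Rabs_mult, Rabs_pos_eq by nra; ring).
  unfold Rsqr; nra.
Qed.

Lemma ccont_ext_loc (f g : C -> C) (z : C) (r : R) :
  0 < r -> (forall w, Cmod (w - z) < r -> f w = g w) -> ccont f z -> ccont g z.
Proof.
  intros Hr E H eps He; destruct (H eps He) as [d [Hd K]].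
  exists (Rmin d r); split; [apply Rmin_glb_lt; auto |].
  intros w Hw.
  rewrite <- (E w), <- (E z).
  - apply K; apply Rlt_le_trans with (1 := Hw), Rmin_l.
  - replace (z - z)%C with (RtoC 0) by ring; rewrite Cmod_0; auto.
  - apply Rlt_le_trans with (1 := Hw), Rmin_r.
Qed.

Lemma ccont_const (c z : C) : ccont (fun _ => c) z.
Proof.
  intros eps He; exists 1; split; [lra | intros w _].
  replace (c - c)%C with (RtoC 0) by ring; rewrite Cmod_0; auto.
Qed.

Lemma ccont_id (z : C) : ccont (fun w => w) z.
Proof. intros eps He; exists eps; auto. Qed.

Lemma ccont_plus (f g : C -> C) (z : C) :
  ccont f z -> ccont g z -> ccont (fun w => f w + g w)%C z.
Proof.
  intros Hf Hg eps He.
  destruct (Hf (eps / 2)) as [d [Hd K]]; [lra |].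
  destruct (Hg (eps / 2)) as [d' [Hd' K']]; [lra |].
  exists (Rmin d d'); split; [apply Rmin_glb_lt; auto |].
  intros w Hw.
  replace (f w + g w - (f z + g z))%C with ((f w - f z) + (g w - g z))%C by ring.
  apply Rle_lt_trans with (1 := Cmod_triangle _ _).
  assert (H1 := K w (Rlt_le_trans _ _ _ Hw (Rmin_l _ _))).
  assert (H2 := K' w (Rlt_le_trans _ _ _ Hw (Rmin_r _ _))); lra.
Qed.

Lemma ccont_bounded (f : C -> C) (z : C) : ccont f z ->
  exists d, 0 < d /\ forall w, Cmod (w - z) < d -> Cmod (f w) < Cmod (f z) + 1.
Proof.
  intros H; destruct (H 1) as [d [Hd K]]; [lra |].
  exists d; split; auto; intros w Hw.
  assert (H1 := K w Hw); assert (H2 := Cmod_triangle_rev (f w) (f z)); lra.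
Qed.

Lemma ccont_mult (f g : C -> C) (z : C) :
  ccont f z -> ccont g z -> ccont (fun w => f w * g w)%C z.
Proof.
  intros Hf Hg eps He.
  assert (Pg := Cmod_ge_0 (g z)).
  destruct (ccont_bounded f z Hf) as [d0 [Hd0 B]].
  assert (Pf : 0 < Cmod (f z) + 1) by (assert (H := Cmod_ge_0 (f z)); lra).
  destruct (Hf (eps / 2 / (Cmod (g z) + 1))) as [d [Hd K]].
  { apply Rdiv_lt_0_compat; lra. }
  destruct (Hg (eps / 2 / (Cmod (f z) + 1))) as [d' [Hd' K']].
  { apply Rdiv_lt_0_compat; lra. }
  exists (Rmin d0 (Rmin d d')); split; [repeat apply Rmin_glb_lt; auto |].
  intros w Hw.
  assert (W0 := Rlt_le_trans _ _ _ Hw (Rmin_l _ _)).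
  assert (W1 := Rlt_le_trans _ _ _ (Rlt_le_trans _ _ _ Hw (Rmin_r _ _)) (Rmin_l _ _)).
  assert (W2 := Rlt_le_trans _ _ _ (Rlt_le_trans _ _ _ Hw (Rmin_r _ _)) (Rmin_r _ _)).
  replace (f w * g w - f z * g z)%C with (f w * (g w - g z) + (f w - f z) * g z)%C by ring.
  apply Rle_lt_trans with (1 := Cmod_triangle _ _); rewrite 2!Cmod_mult.
  specialize (B w W0); specialize (K w W1); specialize (K' w W2).
  apply Rlt_div_r in K; [| lra]; apply Rlt_div_r in K'; [| lra].
  assert (H1 := Cmod_ge_0 (f w - f z)); assert (H2 := Cmod_ge_0 (g w - g z)).
  assert (H3 := Cmod_ge_0 (f w)); nra.
Qed.

Lemma ccont_opp (f : C -> C) (z : C) : ccont f z -> ccont (fun w => - f w)%C z.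
Proof.
  intros H; apply (ccont_ext_loc (fun w => (- (1)) * f w)%C _ z 1); [lra | |].
  - intros; ring.
  - apply ccont_mult; auto; apply ccont_const.
Qed.

Lemma ccont_minus (f g : C -> C) (z : C) :
  ccont f z -> ccont g z -> ccont (fun w => f w - g w)%C z.
Proof. intros Hf Hg; apply ccont_plus; auto; apply ccont_opp; auto. Qed.

Lemma ccont_comp (f g : C -> C) (z : C) :
  ccont f z -> ccont g (f z) -> ccont (fun w => g (f w)) z.
Proof.
  intros Hf Hg eps He; destruct (Hg eps He) as [d [Hd K]].
  destruct (Hf d Hd) as [d' [Hd' K']].
  exists d'; split; auto.
Qed.

Lemma ccont_nonzero (f : C -> C) (z : C) : ccont f z -> f z <> 0%C ->
  exists d, 0 < d /\ forall w, Cmod (w - z) < d -> Cmod (f z) / 2 < Cmod (f w).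
Proof.
  intros H N; apply Cmod_gt_0 in N.
  destruct (H (Cmod (f z) / 2)) as [d [Hd K]]; [lra |].
  exists d; split; auto; intros w Hw; specialize (K w Hw).
  rewrite Cmod_sub_sym in K; assert (H2 := Cmod_triangle_rev (f z) (f w)); lra.
Qed.

Lemma ccont_inv (f : C -> C) (z : C) : ccont f z -> f z <> 0%C -> ccont (fun w => / f w)%C z.
Proof.
  intros H N eps He.
  assert (N' := N); apply Cmod_gt_0 in N'.
  destruct (ccont_nonzero f z H N) as [d0 [Hd0 B]].
  destruct (H (eps * Cmod (f z) * (Cmod (f z) / 2))) as [d [Hd K]].
  { apply Rmult_lt_0_compat; [apply Rmult_lt_0_compat|]; lra. }
  exists (Rmin d0 d); split; [apply Rmin_glb_lt; auto |]; intros w Hw.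
  assert (W0 := Rlt_le_trans _ _ _ Hw (Rmin_l _ _)).
  assert (W1 := Rlt_le_trans _ _ _ Hw (Rmin_r _ _)).
  specialize (B w W0); specialize (K w W1).
  assert (Nw : f w <> 0%C) by (apply Cmod_gt_0; lra).
  replace (/ f w - / f z)%C with (- ((f w - f z) / (f w * f z)))%C by (field; auto).
  rewrite Cmod_opp, Cmod_div, Cmod_mult by (apply Cmult_neq_0; auto).
  apply Rlt_div_l; [nra |].
  assert (0 < eps * Cmod (f z)) by (apply Rmult_lt_0_compat; auto).
  nra.
Qed.

Lemma ccont_div (f g : C -> C) (z : C) :
  ccont f z -> ccont g z -> g z <> 0%C -> ccont (fun w => f w / g w)%C z.
Proof. intros Hf Hg N; apply ccont_mult; auto; apply ccont_inv; auto. Qed.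

Lemma slope_eq (f : C -> C) (z l w : C) : (f w - f z = slope f z l w * (w - z))%C.
Proof.
  unfold slope; destruct (Ceq_dec w z) as [-> | N]; [ring |].
  field; apply Csub_neq, N.
Qed.

Lemma slope_self (f : C -> C) (z l : C) : slope f z l z = l.
Proof. unfold slope; destruct (Ceq_dec z z); congruence. Qed.

(** Turns each differentiation rule below into an algebraic identity for a factor [q] and the
    continuity of that factor. *)
Lemma cder_intro (f q : C -> C) (z : C) (r : R) : 0 < r ->
  (forall w, Cmod (w - z) < r -> (f w - f z = q w * (w - z))%C) ->
  ccont q z -> cder f z (q z).
Proof.
  intros Hr E H; apply (ccont_ext_loc q _ z r Hr); auto.
  intros w Hw; unfold slope; destruct (Ceq_dec w z) as [-> | N]; auto.
  rewrite (E w Hw); field; apply Csub_neq, N.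
Qed.

Lemma cder_eps (f : C -> C) (z l : C) : cder f z l -> forall eps, 0 < eps ->
  exists d, 0 < d /\ forall w, Cmod (w - z) < d ->
    Cmod (f w - f z - l * (w - z)) <= eps * Cmod (w - z).
Proof.
  intros H eps He; destruct (H eps He) as [d [Hd K]].
  exists d; split; auto; intros w Hw; specialize (K w Hw).
  rewrite slope_self in K.
  rewrite (slope_eq f z l w).
  replace (slope f z l w * (w - z) - l * (w - z))%C
    with ((slope f z l w - l) * (w - z))%C by ring.
  rewrite Cmod_mult; apply Rmult_le_compat_r; [apply Cmod_ge_0 | lra].
Qed.

Lemma cder_of_eps (f : C -> C) (z l : C) : (forall eps, 0 < eps ->
  exists d, 0 < d /\ forall w, Cmod (w - z) < d ->
    Cmod (f w - f z - l * (w - z)) <= eps * Cmod (w - z)) -> cder f z l.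
Proof.
  intros H eps He; destruct (H (eps / 2)) as [d [Hd K]]; [lra |].
  exists d; split; auto; intros w Hw; specialize (K w Hw).
  rewrite slope_self; unfold slope; destruct (Ceq_dec w z) as [-> | N].
  - replace (l - l)%C with (RtoC 0) by ring; rewrite Cmod_0; auto.
  - replace ((f w - f z) / (w - z) - l)%C with ((f w - f z - l * (w - z)) / (w - z))%C
      by (field; apply Csub_neq, N).
    rewrite Cmod_div by (apply Csub_neq, N).
    apply Cmod_sub_gt0 in N.
    apply Rle_lt_trans with (eps / 2); [apply Rle_div_l; lra | lra].
Qed.

(** The form in which derivatives come out of estimates: the exponential, Cauchy integrals and
    series of holomorphic functions all have a quadratic remainder. *)
Lemma cder_of_quadratic (f : C -> C) (z l : C) (r K : R) : 0 < r ->
  (forall w, Cmod (w - z) < r ->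
    Cmod (f w - f z - l * (w - z)) <= K * Cmod (w - z) ^ 2) -> cder f z l.
Proof.
  intros Hr H; apply cder_of_eps; intros eps He.
  assert (PK : 0 < Rabs K + 1) by (assert (H1 := Rabs_pos K); lra).
  exists (Rmin r (eps / (Rabs K + 1))); split.
  { apply Rmin_glb_lt; auto; apply Rdiv_lt_0_compat; auto. }
  intros w Hw.
  apply Rle_trans with (1 := H w (Rlt_le_trans _ _ _ Hw (Rmin_l _ _))).
  assert (W1 := Rlt_le_trans _ _ _ Hw (Rmin_r _ _)).
  apply Rlt_div_r in W1; auto.
  assert (P := Cmod_ge_0 (w - z)); assert (H1 := Rle_abs K).
  replace (K * Cmod (w - z) ^ 2) with (K * Cmod (w - z) * Cmod (w - z)) by ring.
  apply Rmult_le_compat_r; nra.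
Qed.

Lemma cder_ccont (f : C -> C) (z l : C) : cder f z l -> ccont f z.
Proof.
  intros H; apply (ccont_ext_loc (fun w => f z + slope f z l w * (w - z))%C _ z 1); [lra | |].
  - intros w _; rewrite <- slope_eq; ring.
  - apply ccont_plus; [apply ccont_const |]; apply ccont_mult; auto.
    apply ccont_minus; [apply ccont_id | apply ccont_const].
Qed.

Lemma cder_ext_loc (f g : C -> C) (z l : C) (r : R) :
  0 < r -> (forall w, Cmod (w - z) < r -> f w = g w) -> cder f z l -> cder g z l.
Proof.
  intros Hr E H; rewrite <- (slope_self f z l).
  apply (cder_intro _ _ z r Hr); auto.
  intros w Hw; rewrite <- slope_eq, <- (E w Hw), <- (E z); auto.
  replace (z - z)%C with (RtoC 0) by ring; rewrite Cmod_0; auto.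
Qed.

Lemma cder_ext (f g : C -> C) (z l : C) : (forall w, f w = g w) -> cder f z l -> cder g z l.
Proof. intros E; apply (cder_ext_loc f g z l 1); [lra | auto]. Qed.

Lemma cder_eq (f : C -> C) (z l m : C) : l = m -> cder f z l -> cder f z m.
Proof. intros ->; auto. Qed.

Lemma cder_const (c z : C) : cder (fun _ => c) z 0.
Proof.
  apply (cder_intro _ (fun _ => RtoC 0) z 1); [lra | intros; ring | apply ccont_const].
Qed.

Lemma cder_id (z : C) : cder (fun w => w) z 1.
Proof.
  apply (cder_intro _ (fun _ => RtoC 1) z 1); [lra | intros; ring | apply ccont_const].
Qed.

Lemma cder_plus (f g : C -> C) (z l m : C) :
  cder f z l -> cder g z m -> cder (fun w => f w + g w)%C z (l + m)%C.
Proof.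
  intros Hf Hg.
  apply (cder_eq _ _ (slope f z l z + slope g z m z)); [now rewrite 2!slope_self |].
  apply (cder_intro _ (fun w => slope f z l w + slope g z m w)%C z 1); [lra | |].
  - intros w _; rewrite Cmult_plus_distr_r, <- 2!slope_eq; ring.
  - apply ccont_plus; auto.
Qed.

Lemma cder_mult (f g : C -> C) (z l m : C) :
  cder f z l -> cder g z m -> cder (fun w => f w * g w)%C z (l * g z + f z * m)%C.
Proof.
  intros Hf Hg.
  apply (cder_eq _ _ (slope f z l z * g z + f z * slope g z m z)); [now rewrite 2!slope_self |].
  apply (cder_intro _ (fun w => slope f z l w * g w + f z * slope g z m w)%C z 1); [lra | |].
  - intros w _.
    replace ((slope f z l w * g w + f z * slope g z m w) * (w - z))%C
      with ((slope f z l w * (w - z)) * g w + f z * (slope g z m w * (w - z)))%C by ring.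
    rewrite <- 2!slope_eq; ring.
  - assert (Cg := cder_ccont g z m Hg).
    apply ccont_plus; apply ccont_mult; auto; apply ccont_const.
Qed.

Lemma cder_scal (f : C -> C) (c z l : C) :
  cder f z l -> cder (fun w => c * f w)%C z (c * l)%C.
Proof.
  intros H; eapply cder_eq; [| apply cder_mult; [apply cder_const | exact H]]; cbv beta; ring.
Qed.

Lemma cder_opp (f : C -> C) (z l : C) : cder f z l -> cder (fun w => - f w)%C z (- l)%C.
Proof.
  intros H; apply (cder_ext (fun w => (- (1)) * f w)%C); [intros; ring |].
  eapply cder_eq; [| apply cder_scal; exact H]; ring.
Qed.

Lemma cder_minus (f g : C -> C) (z l m : C) :
  cder f z l -> cder g z m -> cder (fun w => f w - g w)%C z (l - m)%C.
Proof. intros Hf Hg; apply cder_plus; auto; apply cder_opp; auto. Qed.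

Lemma cder_comp (f g : C -> C) (z l m : C) :
  cder f z l -> cder g (f z) m -> cder (fun w => g (f w)) z (m * l)%C.
Proof.
  intros Hf Hg.
  apply (cder_eq _ _ (slope g (f z) m (f z) * slope f z l z)); [now rewrite 2!slope_self |].
  apply (cder_intro _ (fun w => slope g (f z) m (f w) * slope f z l w)%C z 1); [lra | |].
  - intros w _; rewrite <- Cmult_assoc, <- slope_eq; apply slope_eq.
  - apply ccont_mult; auto.
    apply (ccont_comp f (slope g (f z) m)); auto; apply (cder_ccont f z l Hf).
Qed.

Lemma cder_inv (f : C -> C) (z l : C) :
  cder f z l -> f z <> 0%C -> cder (fun w => / f w)%C z (- l / (f z * f z))%C.
Proof.
  intros Hf N; assert (Cf := cder_ccont f z l Hf).
  destruct (ccont_nonzero f z Cf N) as [d [Hd B]].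
  apply (cder_eq _ _ (- slope f z l z / (f z * f z))); [now rewrite slope_self |].
  apply (cder_intro _ (fun w => - slope f z l w / (f w * f z))%C z d Hd).
  - intros w Hw.
    assert (Nw : f w <> 0%C).
    { apply Cmod_gt_0; apply Cmod_gt_0 in N; specialize (B w Hw); lra. }
    replace (- slope f z l w / (f w * f z) * (w - z))%C
      with (- (slope f z l w * (w - z)) / (f w * f z))%C by (field; auto).
    rewrite <- slope_eq; field; auto.
  - apply ccont_div.
    + apply ccont_opp; auto.
    + apply ccont_mult; auto; apply ccont_const.
    + apply Cmult_neq_0; auto.
Qed.

Lemma cder_div (f g : C -> C) (z l m : C) :
  cder f z l -> cder g z m -> g z <> 0%C ->
  cder (fun w => f w / g w)%C z ((l * g z - f z * m) / (g z * g z))%C.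
Proof.
  intros Hf Hg N; eapply cder_eq; [| apply cder_mult; [exact Hf | apply cder_inv; eauto]].
  cbv beta; field; auto.
Qed.

Lemma cder_unique (f : C -> C) (z l m : C) : cder f z l -> cder f z m -> l = m.
Proof.
  intros Hl Hm; destruct (Ceq_dec l m) as [| N]; auto; exfalso.
  apply Cmod_sub_gt0 in N.
  destruct (Hl (Cmod (l - m) / 2)) as [d [Hd K]]; [lra |].
  destruct (Hm (Cmod (l - m) / 2)) as [d' [Hd' K']]; [lra |].
  (* A point displaced along the reals lies in both discs and differs from [z], so one difference
     quotient is close to [l] and to [m]. *)
  set (w := (z + RtoC (Rmin d d' / 2))%C).
  assert (P : 0 < Rmin d d') by (apply Rmin_glb_lt; auto).
  assert (Ew : (w - z)%C = RtoC (Rmin d d' / 2)) by (unfold w; ring).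
  assert (W : Cmod (w - z) < Rmin d d') by (rewrite Ew, Cmod_R, Rabs_pos_eq; lra).
  assert (Nw : w <> z).
  { intros E; rewrite E in Ew; replace (z - z)%C with (RtoC 0) in Ew by ring.
    apply RtoC_inj in Ew; lra. }
  specialize (K w (Rlt_le_trans _ _ _ W (Rmin_l _ _))).
  specialize (K' w (Rlt_le_trans _ _ _ W (Rmin_r _ _))).
  rewrite slope_self in K, K'.
  unfold slope in K, K'; destruct (Ceq_dec w z) as [| _]; [contradiction |].
  assert (T := Cmod_triangle3 l ((f w - f z) / (w - z)) m).
  rewrite Cmod_sub_sym in K; lra.
Qed.

Lemma is_derive_cder (f : C -> C) (z l : C) :
  @is_derive C_AbsRing C_NormedModule f z l -> cder f z l.
Proof.
  intros [_ H]; apply cder_of_eps; intros eps He.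
  (* Differentiability along a filter quantifies over the limits of that filter; here the limit is
     [z] itself. *)
  destruct (H z (fun P HP => HP) (mkposreal eps He)) as [d K].
  exists d; split; [apply cond_pos |]; intros w Hw.
  specialize (K w Hw).
  replace (l * (w - z))%C with ((w - z) * l)%C by ring.
  exact K.
Qed.

(** * Differentiable curves in the plane and the mean value inequality *)

Ltac reim := unfold Re, Im, Cminus, Cplus, Copp, Cmult, Cconj, RtoC; simpl fst; simpl snd; ring.

Definition rder (g : R -> C) (t : R) (l : C) : Prop :=
  forall eps, 0 < eps -> exists d, 0 < d /\ forall x, Rabs (x - t) < d ->
    Cmod (g x - g t - l * RtoC (x - t)) <= eps * Rabs (x - t).

Lemma is_derive_of_eps (f : R -> R) (t l : R) :
  (forall eps, 0 < eps -> exists d, 0 < d /\ forall x, Rabs (x - t) < d ->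
    Rabs (f x - f t - l * (x - t)) <= eps * Rabs (x - t)) -> is_derive f t l.
Proof.
  intros H; apply is_derive_Reals; intros eps He.
  destruct (H (eps / 2)) as [d [Hd K]]; [lra |].
  exists (mkposreal d Hd); intros h Nh Hh; simpl in Hh.
  specialize (K (t + h)); replace (t + h - t) with h in K by ring.
  specialize (K Hh).
  replace ((f (t + h) - f t) / h - l) with ((f (t + h) - f t - l * h) / h) by (field; auto).
  unfold Rdiv; rewrite Rabs_mult, Rabs_inv.
  assert (P := Rabs_pos_lt h Nh).
  apply Rle_lt_trans with (eps / 2); [apply Rle_div_l; lra | lra].
Qed.

Lemma is_derive_eps (f : R -> R) (t l : R) : is_derive f t l ->
  forall eps, 0 < eps -> exists d, 0 < d /\ forall x, Rabs (x - t) < d ->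
    Rabs (f x - f t - l * (x - t)) <= eps * Rabs (x - t).
Proof.
  intros [_ H] eps He.
  destruct (H t (fun P HP => HP) (mkposreal eps He)) as [d K].
  exists d; split; [apply cond_pos |]; intros x Hx.
  specialize (K x Hx).
  replace (l * (x - t)) with ((x - t) * l) by ring; exact K.
Qed.

Lemma rder_Re (g : R -> C) (t : R) (l : C) :
  rder g t l -> is_derive (fun x => Re (g x)) t (Re l).
Proof.
  intros H; apply is_derive_of_eps; intros eps He; destruct (H eps He) as [d [Hd K]].
  exists d; split; auto; intros x Hx; apply Rle_trans with (2 := K x Hx).
  apply Rle_trans with (2 := re_le_Cmod _); right; f_equal; reim.
Qed.

Lemma rder_Im (g : R -> C) (t : R) (l : C) :
  rder g t l -> is_derive (fun x => Im (g x)) t (Im l).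
Proof.
  intros H; apply is_derive_of_eps; intros eps He; destruct (H eps He) as [d [Hd K]].
  exists d; split; auto; intros x Hx; apply Rle_trans with (2 := K x Hx).
  apply Rle_trans with (2 := im_le_Cmod _); right; f_equal; reim.
Qed.

Lemma rder_of_components (g : R -> C) (t : R) (l : C) :
  is_derive (fun x => Re (g x)) t (Re l) -> is_derive (fun x => Im (g x)) t (Im l) ->
  rder g t l.
Proof.
  intros H1 H2 eps He.
  destruct (is_derive_eps _ _ _ H1 (eps / 2)) as [d [Hd K]]; [lra |].
  destruct (is_derive_eps _ _ _ H2 (eps / 2)) as [d' [Hd' K']]; [lra |].
  exists (Rmin d d'); split; [apply Rmin_glb_lt; auto |]; intros x Hx.
  specialize (K x (Rlt_le_trans _ _ _ Hx (Rmin_l _ _))).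
  specialize (K' x (Rlt_le_trans _ _ _ Hx (Rmin_r _ _))).
  apply Rle_trans with (1 := Cmod_le_re_im _).
  replace (Re (g x - g t - l * RtoC (x - t))) with (Re (g x) - Re (g t) - Re l * (x - t))
    by reim.
  replace (Im (g x - g t - l * RtoC (x - t))) with (Im (g x) - Im (g t) - Im l * (x - t))
    by reim.
  lra.
Qed.

Lemma rder_ext (f g : R -> C) (t : R) (l : C) :
  (forall x, f x = g x) -> rder f t l -> rder g t l.
Proof.
  intros E H eps He; destruct (H eps He) as [d [Hd K]]; exists d; split; auto.
  intros x Hx; rewrite <- 2!E; auto.
Qed.

Lemma rder_eq (g : R -> C) (t : R) (l m : C) : l = m -> rder g t l -> rder g t m.
Proof. intros ->; auto. Qed.

Lemma rder_affine (a b : C) (t : R) : rder (fun x => a + RtoC x * b)%C t b.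
Proof.
  intros eps He; exists 1; split; [lra |]; intros x _.
  replace (a + x * b - (a + t * b) - b * RtoC (x - t))%C with (RtoC 0)
    by (rewrite RtoC_minus; ring).
  rewrite Cmod_0; apply Rmult_le_pos; [lra | apply Rabs_pos].
Qed.

Lemma rder_lipschitz (g : R -> C) (t : R) (l : C) : rder g t l ->
  exists d, 0 < d /\ forall x, Rabs (x - t) < d ->
    Cmod (g x - g t) <= (Cmod l + 1) * Rabs (x - t).
Proof.
  intros H; destruct (H 1) as [d [Hd K]]; [lra |]; exists d; split; auto; intros x Hx.
  specialize (K x Hx).
  replace (g x - g t)%C with (g x - g t - l * RtoC (x - t) + l * RtoC (x - t))%C by ring.
  apply Rle_trans with (1 := Cmod_triangle _ _).
  rewrite (Cmod_mult l), Cmod_R; lra.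
Qed.

Lemma rder_comp (f : C -> C) (g : R -> C) (t : R) (l m : C) :
  rder g t m -> cder f (g t) l -> rder (fun x => f (g x)) t (l * m)%C.
Proof.
  intros Hg Hf eps He.
  destruct (rder_lipschitz g t m Hg) as [d0 [Hd0 L]].
  assert (Pm := Cmod_ge_0 m); assert (Pl := Cmod_ge_0 l).
  destruct (cder_eps f _ l Hf (eps / 2 / (Cmod m + 1))) as [d1 [Hd1 K]].
  { apply Rdiv_lt_0_compat; lra. }
  destruct (Hg (eps / 2 / (Cmod l + 1))) as [d2 [Hd2 K2]].
  { apply Rdiv_lt_0_compat; lra. }
  exists (Rmin d0 (Rmin d2 (d1 / (Cmod m + 1)))); split.
  { repeat apply Rmin_glb_lt; auto; apply Rdiv_lt_0_compat; lra. }
  intros x Hx.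
  assert (W0 := Rlt_le_trans _ _ _ Hx (Rmin_l _ _)).
  assert (W1 := Rlt_le_trans _ _ _ (Rlt_le_trans _ _ _ Hx (Rmin_r _ _)) (Rmin_l _ _)).
  assert (W2 := Rlt_le_trans _ _ _ (Rlt_le_trans _ _ _ Hx (Rmin_r _ _)) (Rmin_r _ _)).
  specialize (L x W0); specialize (K2 x W1).
  apply Rlt_div_r in W2; [| lra].
  specialize (K (g x)).
  assert (X := Rabs_pos (x - t)).
  assert (Kx : Cmod (g x - g t) < d1) by lra.
  specialize (K Kx).
  replace (f (g x) - f (g t) - l * m * RtoC (x - t))%C with
    ((f (g x) - f (g t) - l * (g x - g t)) + l * (g x - g t - m * RtoC (x - t)))%C by ring.
  apply Rle_trans with (1 := Cmod_triangle _ _).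
  rewrite (Cmod_mult l).
  assert (A1 : eps / 2 / (Cmod m + 1) * Cmod (g x - g t) <= eps / 2 * Rabs (x - t)).
  { replace (eps / 2 * Rabs (x - t)) with
      (eps / 2 / (Cmod m + 1) * ((Cmod m + 1) * Rabs (x - t))) by (field; lra).
    apply Rmult_le_compat_l; auto; apply Rlt_le, Rdiv_lt_0_compat; lra. }
  assert (A2 : Cmod l * Cmod (g x - g t - m * RtoC (x - t)) <= eps / 2 * Rabs (x - t)).
  { replace (eps / 2 * Rabs (x - t)) with
      ((Cmod l + 1) * (eps / 2 / (Cmod l + 1) * Rabs (x - t))) by (field; lra).
    apply Rmult_le_compat; auto; [apply Cmod_ge_0 | lra]. }
  lra.
Qed.

Lemma rder_plus (f g : R -> C) (t : R) (l m : C) :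
  rder f t l -> rder g t m -> rder (fun x => f x + g x)%C t (l + m)%C.
Proof.
  intros Hf Hg eps He.
  destruct (Hf (eps / 2)) as [d [Hd K]]; [lra |].
  destruct (Hg (eps / 2)) as [d' [Hd' K']]; [lra |].
  exists (Rmin d d'); split; [apply Rmin_glb_lt; auto |]; intros x Hx.
  specialize (K x (Rlt_le_trans _ _ _ Hx (Rmin_l _ _))).
  specialize (K' x (Rlt_le_trans _ _ _ Hx (Rmin_r _ _))).
  replace (f x + g x - (f t + g t) - (l + m) * RtoC (x - t))%C with
    ((f x - f t - l * RtoC (x - t)) + (g x - g t - m * RtoC (x - t)))%C by ring.
  apply Rle_trans with (1 := Cmod_triangle _ _); lra.
Qed.

Lemma rder_minus (f g : R -> C) (t : R) (l m : C) :
  rder f t l -> rder g t m -> rder (fun x => f x - g x)%C t (l - m)%C.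
Proof.
  intros Hf Hg; apply rder_plus; auto.
  apply (rder_eq _ _ (- (1) * m)); [ring |].
  apply (rder_comp (fun w => - w)%C g); auto.
  apply cder_opp, cder_id.
Qed.

Lemma incr_of_derive (f f' : R -> R) (a b : R) : a <= b ->
  (forall x, a <= x <= b -> is_derive f x (f' x)) ->
  (forall x, a <= x <= b -> 0 <= f' x) -> f a <= f b.
Proof.
  intros Hab D P.
  destruct (MVT_gen f a b f') as [c [Hc E]].
  - rewrite Rmin_left, Rmax_right by auto; intros x Hx; apply D; lra.
  - rewrite Rmin_left, Rmax_right by auto; intros x Hx.
    apply continuity_pt_filterlim, (ex_derive_continuous f x).
    exists (f' x); apply D; auto.
  - rewrite Rmin_left, Rmax_right in Hc by auto.
    specialize (P c Hc); assert (0 <= f' c * (b - a)) by (apply Rmult_le_pos; lra); lra.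
Qed.

(** Projection on the increment [D = g b - g a] reduces this to a monotone real function: by
    Cauchy-Schwarz [|D| m - <D, g>] does not decrease, and its variation is
    [|D| (m b - m a) - |D|^2]. Treating the components separately would lose a constant factor. *)
Lemma mean_value_ineq (g g' : R -> C) (m m' : R -> R) (a b : R) : a <= b ->
  (forall x, a <= x <= b -> rder g x (g' x)) ->
  (forall x, a <= x <= b -> is_derive m x (m' x)) ->
  (forall x, a <= x <= b -> Cmod (g' x) <= m' x) ->
  Cmod (g b - g a) <= m b - m a.
Proof.
  intros Hab Dg Dm B.
  assert (M : m a <= m b).
  { apply (incr_of_derive m m' a b Hab Dm).
    intros x Hx; apply Rle_trans with (2 := B x Hx), Cmod_ge_0. }
  set (D := (g b - g a)%C).
  destruct (Rle_lt_or_eq_dec 0 (Cmod D) (Cmod_ge_0 D)) as [P | <-]; [| lra].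
  assert (H := incr_of_derive
    (fun x => m x * Cmod D - (Re D * Re (g x) + Im D * Im (g x)))
    (fun x => m' x * Cmod D - (Re D * Re (g' x) + Im D * Im (g' x))) a b Hab).
  assert (S : forall w, Re D * Re w + Im D * Im w <= Cmod D * Cmod w).
  { intros w; rewrite <- (Cmod_conj D), <- Cmod_mult.
    apply Rle_trans with (2 := re_le_Cmod _), Rle_trans with (2 := Rle_abs _).
    right; reim. }
  assert (E : Re D * (Re (g b) - Re (g a)) + Im D * (Im (g b) - Im (g a)) = Cmod D ^ 2)
    by (rewrite Cmod2_alt; unfold D; reim).
  cut (m a * Cmod D - (Re D * Re (g a) + Im D * Im (g a)) <=
       m b * Cmod D - (Re D * Re (g b) + Im D * Im (g b))); [nra |].
  apply H.
  - intros x Hx; assert (G1 := rder_Re _ _ _ (Dg x Hx)); assert (G2 := rder_Im _ _ _ (Dg x Hx)).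
    assert (G3 := Dm x Hx).
    apply (is_derive_minus (fun x => m x * Cmod D)
      (fun x => Re D * Re (g x) + Im D * Im (g x))).
    + apply (is_derive_ext (fun x => scal (Cmod D) (m x))).
      { intros; unfold scal; simpl; unfold mult; simpl; ring. }
      replace (m' x * Cmod D) with (scal (Cmod D) (m' x))
        by (unfold scal; simpl; unfold mult; simpl; ring).
      apply is_derive_scal; auto.
    + apply (is_derive_plus (fun x => Re D * Re (g x)) (fun x => Im D * Im (g x)));
        apply is_derive_scal; auto.
  - intros x Hx; specialize (B x Hx); specialize (S (g' x)); nra.
Qed.

Lemma mean_value_segment (f f' : C -> C) (p w : C) (K : R) :
  (forall t, 0 <= t <= 1 -> cder f (p + RtoC t * (w - p)) (f' (p + RtoC t * (w - p))%C)) ->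
  (forall t, 0 <= t <= 1 -> Cmod (f' (p + RtoC t * (w - p))%C) <= K) ->
  Cmod (f w - f p) <= K * Cmod (w - p).
Proof.
  intros D B.
  assert (H := mean_value_ineq (fun t => f (p + RtoC t * (w - p))%C)
    (fun t => f' (p + RtoC t * (w - p)) * (w - p))%C
    (fun t => K * Cmod (w - p) * t) (fun _ => K * Cmod (w - p)) 0 1).
  replace (f w - f p)%C with (f (p + 1 * (w - p)) - f (p + 0 * (w - p)))%C
    by (f_equal; [f_equal | f_equal; f_equal]; ring).
  replace (K * Cmod (w - p)) with (K * Cmod (w - p) * 1 - K * Cmod (w - p) * 0) by ring.
  apply H; [lra | | |].
  - intros t Ht.
    apply (rder_comp f (fun t => p + RtoC t * (w - p))%C); [apply rder_affine | auto].
  - intros t Ht; auto_derive; [auto | ring].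
  - intros t Ht; rewrite Cmod_mult; apply Rmult_le_compat_r; [apply Cmod_ge_0 | auto].
Qed.

(** * The complex exponential *)

Lemma Ceq (a b : C) : Re a = Re b -> Im a = Im b -> a = b.
Proof. destruct a, b; simpl; intros; f_equal; auto. Qed.

Lemma cexp_0 : cexp 0 = 1%C.
Proof.
  apply Ceq; unfold cexp; simpl; rewrite exp_0; [rewrite cos_0 | rewrite sin_0]; ring.
Qed.

Lemma cexp_plus (z w : C) : cexp (z + w) = (cexp z * cexp w)%C.
Proof.
  apply Ceq; unfold cexp; simpl; rewrite exp_plus; [rewrite cos_plus | rewrite sin_plus];
    unfold Re, Im; ring.
Qed.

Lemma Cmod_cexp (z : C) : Cmod (cexp z) = exp (Re z).
Proof.
  unfold Cmod, cexp; simpl fst; simpl snd.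
  replace ((exp (Re z) * cos (Im z)) ^ 2 + (exp (Re z) * sin (Im z)) ^ 2)
    with ((exp (Re z))² * ((sin (Im z))² + (cos (Im z))²)) by (unfold Rsqr; ring).
  rewrite sin2_cos2, Rmult_1_r; apply sqrt_Rsqr, Rlt_le, exp_pos.
Qed.

Lemma cexp_neq_0 (z : C) : cexp z <> 0%C.
Proof. apply Cmod_gt_0; rewrite Cmod_cexp; apply exp_pos. Qed.

Lemma cexp_opp (z : C) : cexp (- z) = (/ cexp z)%C.
Proof.
  assert (N := cexp_neq_0 z).
  assert (E : (cexp (- z) * cexp z)%C = 1%C)
    by (rewrite <- cexp_plus, <- cexp_0; f_equal; ring).
  replace (cexp (- z)) with (cexp (- z) * cexp z * / cexp z)%C by (field; auto).
  rewrite E; ring.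
Qed.

Lemma rder_cexp_line (h : C) (t : R) :
  rder (fun x => cexp (RtoC x * h)) t (cexp (RtoC t * h) * h)%C.
Proof.
  destruct h as [a b].
  apply rder_of_components; unfold cexp; simpl; auto_derive; auto; unfold Rminus; ring.
Qed.

Lemma cexp_sub_one (h : C) : Cmod (cexp h - 1) <= Cmod h * exp (Cmod h).
Proof.
  assert (P := Cmod_ge_0 h).
  assert (H := mean_value_ineq (fun x => cexp (RtoC x * h)) (fun t => cexp (RtoC t * h) * h)%C
    (fun t => t * (Cmod h * exp (Cmod h))) (fun _ => Cmod h * exp (Cmod h)) 0 1).
  cbv beta in H.
  replace (1 * h)%C with h in H by ring; replace (0 * h)%C with (RtoC 0) in H by ring.
  rewrite cexp_0 in H.
  replace (Cmod h * exp (Cmod h))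
    with (1 * (Cmod h * exp (Cmod h)) - 0 * (Cmod h * exp (Cmod h))) by ring.
  apply H; [lra | intros; apply rder_cexp_line | |].
  - intros; auto_derive; [auto | ring].
  - intros x Hx; rewrite Cmod_mult, Cmod_cexp, Rmult_comm.
    apply Rmult_le_compat_l; auto.
    assert (Q : Re (RtoC x * h) <= Cmod h).
    { apply Rle_trans with (1 := Rle_abs _), Rle_trans with (1 := re_le_Cmod _).
      rewrite Cmod_mult, Cmod_R, Rabs_pos_eq; nra. }
    destruct Q as [Q | ->]; [left; apply exp_increasing; auto | lra].
Qed.

Lemma exp_le_compat (a b : R) : a <= b -> exp a <= exp b.
Proof. intros [H | ->]; [left; apply exp_increasing; auto | lra]. Qed.

Lemma cexp_sub_linear (h : C) : Cmod (cexp h - 1 - h) <= Cmod h ^ 2 * exp (Cmod h).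
Proof.
  assert (P := Cmod_ge_0 h).
  assert (H := mean_value_ineq (fun x => cexp (RtoC x * h) - RtoC x * h)%C
    (fun t => cexp (RtoC t * h) * h - h)%C
    (fun t => t * (Cmod h ^ 2 * exp (Cmod h))) (fun _ => Cmod h ^ 2 * exp (Cmod h)) 0 1).
  cbv beta in H.
  replace (1 * h)%C with h in H by ring; replace (0 * h)%C with (RtoC 0) in H by ring.
  rewrite cexp_0 in H.
  replace (cexp h - 1 - h)%C with (cexp h - h - (1 - 0))%C by ring.
  replace (Cmod h ^ 2 * exp (Cmod h))
    with (1 * (Cmod h ^ 2 * exp (Cmod h)) - 0 * (Cmod h ^ 2 * exp (Cmod h))) by ring.
  apply H; [lra | | |].
  - intros x _; apply (rder_minus (fun x => cexp (RtoC x * h))); [apply rder_cexp_line |].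
    apply (rder_ext (fun x => 0 + RtoC x * h)%C); [intros; ring | apply rder_affine].
  - intros; auto_derive; [auto | ring].
  - intros x Hx.
    replace (cexp (x * h) * h - h)%C with ((cexp (x * h) - 1) * h)%C by ring.
    rewrite Cmod_mult.
    assert (L : Cmod (RtoC x * h) <= Cmod h)
      by (rewrite Cmod_mult, Cmod_R, Rabs_pos_eq; nra).
    assert (Q := cexp_sub_one (RtoC x * h)).
    assert (Q' := Cmod_ge_0 (RtoC x * h)).
    replace (Cmod h ^ 2 * exp (Cmod h)) with (Cmod h * exp (Cmod h) * Cmod h) by ring.
    apply Rmult_le_compat_r; auto; apply Rle_trans with (1 := Q).
    apply Rmult_le_compat; auto; [apply Rlt_le, exp_pos | apply exp_le_compat; auto].
Qed.

Lemma cder_cexp (z : C) : cder cexp z (cexp z).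
Proof.
  apply (cder_of_quadratic _ _ _ 1 (exp (Re z) * exp 1)); [lra |].
  intros w Hw.
  replace w with (z + (w - z))%C at 1 by ring.
  rewrite cexp_plus.
  replace (cexp z * cexp (w - z) - cexp z - cexp z * (w - z))%C
    with (cexp z * (cexp (w - z) - 1 - (w - z)))%C by ring.
  rewrite Cmod_mult, Cmod_cexp, Rmult_assoc.
  apply Rmult_le_compat_l; [apply Rlt_le, exp_pos |].
  apply Rle_trans with (1 := cexp_sub_linear _); rewrite Rmult_comm.
  apply Rmult_le_compat_r; [apply pow2_ge_0 | apply exp_le_compat; lra].
Qed.

(** * Bisection of rectangles and compactness *)

Lemma nested_intervals (u v : nat -> R) :
  (forall n, u n <= u (S n)) -> (forall n, v (S n) <= v n) -> (forall n, u n <= v n) ->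
  exists p, forall n, u n <= p <= v n.
Proof.
  intros Hu Hv H.
  assert (Mu : forall n m, (n <= m)%nat -> u n <= u m)
    by (intros n m L; induction L as [| m L IH]; [lra | specialize (Hu m); lra]).
  assert (Mv : forall n m, (n <= m)%nat -> v m <= v n)
    by (intros n m L; induction L as [| m L IH]; [lra | specialize (Hv m); lra]).
  assert (X : forall n m, u n <= v m).
  { intros n m; apply Rle_trans with (1 := Mu n (max n m) (Nat.le_max_l _ _)).
    apply Rle_trans with (2 := Mv m (max n m) (Nat.le_max_r _ _)), H. }
  destruct (completeness (fun x => exists n, x = u n)) as [p [Up Lp]].
  - exists (v 0%nat); intros x [n ->]; apply X.
  - exists (u 0%nat), 0%nat; reflexivity.
  - exists p; intros n; split.
    + apply Up; exists n; reflexivity.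
    + apply Lp; intros x [m ->]; apply X.
Qed.

Section Bisection.

Variable P : R -> R -> R -> R -> Prop.

Hypothesis P_quarter : forall x0 x1 y0 y1, x0 <= x1 -> y0 <= y1 -> P x0 x1 y0 y1 ->
  let xm := (x0 + x1) / 2 in let ym := (y0 + y1) / 2 in
  P x0 xm y0 ym \/ P xm x1 y0 ym \/ P x0 xm ym y1 \/ P xm x1 ym y1.

(** Rectangles are bundled with their ordering and their proof of [P], so that the choice of a
    quarter is a total function that can be iterated. *)
Let rect : Type :=
  {q : (R * R) * (R * R) |
    fst (fst q) <= snd (fst q) /\ fst (snd q) <= snd (snd q) /\
    P (fst (fst q)) (snd (fst q)) (fst (snd q)) (snd (snd q))}.

Let X0 (q : rect) := fst (fst (proj1_sig q)).
Let X1 (q : rect) := snd (fst (proj1_sig q)).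
Let Y0 (q : rect) := fst (snd (proj1_sig q)).
Let Y1 (q : rect) := snd (snd (proj1_sig q)).

(** Serves twice: for compactness, where [P] says that a rectangle holds the largest values of a
    function, and for Goursat's theorem, where it says that a boundary integral is large. *)
Lemma bisection (a b c d : R) : a <= b -> c <= d -> P a b c d ->
  exists px py, forall n, exists x0 x1 y0 y1,
    P x0 x1 y0 y1 /\ x0 <= px <= x1 /\ y0 <= py <= y1 /\
    a <= x0 /\ x1 <= b /\ c <= y0 /\ y1 <= d /\
    x1 - x0 = (b - a) / 2 ^ n /\ y1 - y0 = (d - c) / 2 ^ n.
Proof.
  intros Hab Hcd H0.
  assert (St : forall q : rect, exists q' : rect,
    X0 q <= X0 q' /\ X1 q' <= X1 q /\ Y0 q <= Y0 q' /\ Y1 q' <= Y1 q /\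
    X1 q' - X0 q' = (X1 q - X0 q) / 2 /\ Y1 q' - Y0 q' = (Y1 q - Y0 q) / 2).
  { intros [[[x0 x1] [y0 y1]] [Hx [Hy HP]]]; simpl in Hx, Hy, HP.
    unfold X0, X1, Y0, Y1; simpl.
    destruct (P_quarter x0 x1 y0 y1 Hx Hy HP) as [K | [K | [K | K]]].
    - unshelve eexists (exist _ ((x0, (x0 + x1) / 2), (y0, (y0 + y1) / 2)) _);
        simpl; repeat split; auto; lra.
    - unshelve eexists (exist _ (((x0 + x1) / 2, x1), (y0, (y0 + y1) / 2)) _);
        simpl; repeat split; auto; lra.
    - unshelve eexists (exist _ ((x0, (x0 + x1) / 2), ((y0 + y1) / 2, y1)) _);
        simpl; repeat split; auto; lra.
    - unshelve eexists (exist _ (((x0 + x1) / 2, x1), ((y0 + y1) / 2, y1)) _);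
        simpl; repeat split; auto; lra. }
  assert (Nx : exists next : rect -> rect, forall q,
    X0 q <= X0 (next q) /\ X1 (next q) <= X1 q /\ Y0 q <= Y0 (next q) /\ Y1 (next q) <= Y1 q /\
    X1 (next q) - X0 (next q) = (X1 q - X0 q) / 2 /\
    Y1 (next q) - Y0 (next q) = (Y1 q - Y0 q) / 2).
  { exists (fun q => proj1_sig (constructive_indefinite_description _ (St q))).
    intros q; exact (proj2_sig (constructive_indefinite_description _ (St q))). }
  destruct Nx as [next N].
  set (q0 := exist _ ((a, b), (c, d)) (conj Hab (conj Hcd H0)) : rect).
  set (q := fun n => Nat.iter n next q0).
  assert (Q : forall n, a <= X0 (q n) /\ X1 (q n) <= b /\ c <= Y0 (q n) /\ Y1 (q n) <= d /\
    X1 (q n) - X0 (q n) = (b - a) / 2 ^ n /\ Y1 (q n) - Y0 (q n) = (d - c) / 2 ^ n).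
  { induction n as [| n IH].
    - unfold q, q0, X0, X1, Y0, Y1; simpl; repeat split; lra.
    - assert (Nn := N (q n)).
      change (next (q n)) with (q (S n)) in Nn.
      assert (P2 : 2 ^ n <> 0) by (apply pow_nonzero; lra).
      destruct IH as [I1 [I2 [I3 [I4 [I5 I6]]]]], Nn as [J1 [J2 [J3 [J4 [J5 J6]]]]].
      repeat split; try lra.
      + rewrite J5, I5; simpl; field; auto.
      + rewrite J6, I6; simpl; field; auto. }
  destruct (nested_intervals (fun n => X0 (q n)) (fun n => X1 (q n))) as [px Hpx].
  { intros n; apply (N (q n)). }
  { intros n; apply (N (q n)). }
  { intros n; apply (proj2_sig (q n)). }
  destruct (nested_intervals (fun n => Y0 (q n)) (fun n => Y1 (q n))) as [py Hpy].
  { intros n; apply (N (q n)). }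
  { intros n; apply (N (q n)). }
  { intros n; apply (proj2_sig (q n)). }
  exists px, py; intros n; exists (X0 (q n)), (X1 (q n)), (Y0 (q n)), (Y1 (q n)).
  split; [apply (proj2_sig (q n)) |].
  split; [apply Hpx |]; split; [apply Hpy |]; apply Q.
Qed.

End Bisection.

Lemma pow2_small (B eps : R) : 0 < eps -> exists n, B / 2 ^ n < eps.
Proof.
  intros He.
  assert (PB : 0 < Rabs B + 1) by (assert (H := Rabs_pos B); lra).
  destruct (pow_lt_1_zero (1 / 2) ltac:(rewrite Rabs_pos_eq; lra) (eps / (Rabs B + 1)))
    as [n Hn].
  { apply Rdiv_lt_0_compat; lra. }
  exists n; specialize (Hn n (le_n n)).
  assert (P2 : 0 < 2 ^ n) by (apply pow_lt; lra).
  assert (E : (1 / 2) ^ n = / 2 ^ n)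
    by (unfold Rdiv; rewrite Rmult_1_l; apply pow_inv).
  rewrite E, Rabs_pos_eq in Hn by (apply Rlt_le, Rinv_0_lt_compat; auto).
  apply Rlt_div_r in Hn; auto.
  assert (B <= Rabs B) by apply Rle_abs.
  assert (0 < / 2 ^ n) by (apply Rinv_0_lt_compat; auto).
  unfold Rdiv; nra.
Qed.

Definition cclosed (K : C -> Prop) : Prop :=
  forall z, ~ K z -> exists d, 0 < d /\ forall w, Cmod (w - z) < d -> ~ K w.

(** The bisected property is that every value of [u] on [K] is matched or exceeded on [K] within the
    rectangle. If it failed in all four quarters, the largest of the four unmatched values would be
    unmatched in the whole rectangle. Upper semicontinuity at the limit point then concludes. *)
Lemma compact_max (K : C -> Prop) (u : C -> R) (B : R) (z0 : C) :
  K z0 -> cclosed K -> (forall z, K z -> Cmod z <= B) ->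
  (forall z m, K z -> u z < m ->
    exists d, 0 < d /\ forall w, K w -> Cmod (w - z) < d -> u w < m) ->
  exists p, K p /\ forall z, K z -> u z <= u p.
Proof.
  intros H0 Kc Kb Hu.
  set (In := fun x0 x1 y0 y1 w => x0 <= Re w <= x1 /\ y0 <= Im w <= y1).
  set (P := fun x0 x1 y0 y1 =>
    forall z, K z -> exists w, K w /\ In x0 x1 y0 y1 w /\ u z <= u w).
  assert (PB : 0 <= B) by (apply Rle_trans with (1 := Cmod_ge_0 z0); auto).
  destruct (bisection P) with (a := - B) (b := B) (c := - B) (d := B)
    as [px [py Hp]]; try lra.
  - intros x0 x1 y0 y1 Hx Hy HP xm ym; apply NNPP; intros N.
    apply not_or_and in N; destruct N as [N1 N].
    apply not_or_and in N; destruct N as [N2 N].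
    apply not_or_and in N; destruct N as [N3 N4].
    apply not_all_ex_not in N1; destruct N1 as [z1 N1].
    apply not_all_ex_not in N2; destruct N2 as [z2 N2].
    apply not_all_ex_not in N3; destruct N3 as [z3 N3].
    apply not_all_ex_not in N4; destruct N4 as [z4 N4].
    apply imply_to_and in N1; apply imply_to_and in N2.
    apply imply_to_and in N3; apply imply_to_and in N4.
    destruct N1 as [K1 N1], N2 as [K2 N2], N3 as [K3 N3], N4 as [K4 N4].
    assert (M : forall a b, K a -> K b -> exists c, K c /\ u a <= u c /\ u b <= u c).
    { intros a b Ha Hb; destruct (Rle_dec (u a) (u b)).
      - exists b; repeat split; auto; lra.
      - exists a; repeat split; auto; lra. }
    destruct (M z1 z2 K1 K2) as [a [Ka [A1 A2]]].
    destruct (M z3 z4 K3 K4) as [b [Kb' [B1 B2]]].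
    destruct (M a b Ka Kb') as [c [Kcc [C1 C2]]].
    destruct (HP c Kcc) as [w [Kw [[Wx Wy] Uw]]].
    destruct (Rle_dec (Re w) xm); destruct (Rle_dec (Im w) ym).
    + apply N1; exists w; unfold In; repeat split; auto; lra.
    + apply N3; exists w; unfold In; repeat split; auto; lra.
    + apply N2; exists w; unfold In; repeat split; auto; lra.
    + apply N4; exists w; unfold In; repeat split; auto; lra.
  - intros z Kz; exists z; split; auto; split; [| lra].
    specialize (Kb z Kz).
    assert (H1 := Rle_trans _ _ _ (re_le_Cmod z) Kb); apply Rabs_le_between in H1.
    assert (H2 := Rle_trans _ _ _ (im_le_Cmod z) Kb); apply Rabs_le_between in H2.
    split; auto.
  - set (p := (px, py) : C).
    assert (Near : forall d, 0 < d -> forall z, K z ->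
      exists w, K w /\ Cmod (w - p) < d /\ u z <= u w).
    { intros d Hd z Kz.
      destruct (pow2_small (4 * B) d Hd) as [n Hn].
      destruct (Hp n) as (x0 & x1 & y0 & y1 & HP & Hx & Hy & _ & _ & _ & _ & Wx & Wy).
      destruct (HP z Kz) as [w [Kw [[Ix Iy] Uw]]].
      exists w; repeat split; auto.
      apply Rle_lt_trans with (2 := Hn), Rle_trans with (1 := Cmod_le_re_im _).
      assert (A1 : Rabs (Re (w - p)) <= 2 * B / 2 ^ n).
      { apply Rabs_le; unfold p, Re, Im in *; simpl in *.
        replace (B - - B) with (2 * B) in Wx by ring; lra. }
      assert (A2 : Rabs (Im (w - p)) <= 2 * B / 2 ^ n).
      { apply Rabs_le; unfold p, Re, Im in *; simpl in *.
        replace (B - - B) with (2 * B) in Wy by ring; lra. }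
      replace (4 * B / 2 ^ n) with (2 * B / 2 ^ n + 2 * B / 2 ^ n)
        by (field; apply pow_nonzero; lra).
      lra. }
    assert (Kp : K p).
    { apply NNPP; intros Np; destruct (Kc p Np) as [d [Hd N]].
      destruct (Near d Hd z0 H0) as [w [Kw [Dw _]]]; exact (N w Dw Kw). }
    exists p; split; auto; intros z Kz; apply Rnot_lt_le; intros L.
    destruct (Hu p _ Kp L) as [d [Hd N]].
    destruct (Near d Hd z Kz) as [w [Kw [Dw Uw]]].
    specialize (N w Kw Dw); lra.
Qed.

(** * Goursat's theorem and Cauchy's formula on rectangles *)

(** The components are integrated separately, so that additivity and the fundamental theorem are
    inherited from real integrals. *)
Definition is_cint (g : R -> C) (a b : R) (l : C) : Prop :=
  is_RInt (fun t => Re (g t)) a b (Re l) /\ is_RInt (fun t => Im (g t)) a b (Im l).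

Definition cint (g : R -> C) (a b : R) : C :=
  (RInt (fun t => Re (g t)) a b, RInt (fun t => Im (g t)) a b).

Definition rcont (g : R -> C) (t : R) : Prop :=
  forall eps, 0 < eps -> exists d, 0 < d /\
    forall x, Rabs (x - t) < d -> Cmod (g x - g t) < eps.

Lemma continuous_of_eps (f : R -> R) (t : R) :
  (forall eps, 0 < eps -> exists d, 0 < d /\
    forall x, Rabs (x - t) < d -> Rabs (f x - f t) < eps) -> continuous f t.
Proof.
  intros H; apply filterlim_locally; intros eps.
  destruct (H eps (cond_pos eps)) as [d [Hd K]].
  exists (mkposreal d Hd); intros x Hx; exact (K x Hx).
Qed.

Lemma is_cint_cint (g : R -> C) (a b : R) :
  (forall t, Rmin a b <= t <= Rmax a b -> rcont g t) -> is_cint g a b (cint g a b).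
Proof.
  intros H; split; apply (@RInt_correct R_CompleteNormedModule);
    apply (@ex_RInt_continuous R_CompleteNormedModule); intros z Hz;
    apply continuous_of_eps; intros eps He;
    destruct (H z Hz eps He) as [d [Hd K]]; exists d; split; auto;
    intros x Hx; apply Rle_lt_trans with (2 := K x Hx).
  - apply Rle_trans with (2 := re_le_Cmod _); right; f_equal.
  - apply Rle_trans with (2 := im_le_Cmod _); right; f_equal.
Qed.

Lemma cint_of_is_cint (g : R -> C) (a b : R) (l : C) : is_cint g a b l -> cint g a b = l.
Proof.
  intros [H1 H2]; apply Ceq; [exact (is_RInt_unique _ _ _ _ H1) | exact (is_RInt_unique _ _ _ _ H2)].
Qed.

Lemma is_cint_plus (f g : R -> C) (a b : R) (l m : C) :
  is_cint f a b l -> is_cint g a b m -> is_cint (fun t => f t + g t)%C a b (l + m)%C.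
Proof.
  intros [H1 H2] [K1 K2]; split; [exact (is_RInt_plus _ _ _ _ _ _ H1 K1) | exact (is_RInt_plus _ _ _ _ _ _ H2 K2)].
Qed.

Lemma is_cint_scal (f : R -> C) (a b : R) (c l : C) :
  is_cint f a b l -> is_cint (fun t => c * f t)%C a b (c * l)%C.
Proof.
  intros [H1 H2]; split.
  - exact (is_RInt_minus _ _ _ _ _ _ (is_RInt_scal _ _ _ (Re c) _ H1) (is_RInt_scal _ _ _ (Im c) _ H2)).
  - exact (is_RInt_plus _ _ _ _ _ _ (is_RInt_scal _ _ _ (Re c) _ H2) (is_RInt_scal _ _ _ (Im c) _ H1)).
Qed.

Lemma is_cint_Chasles (f : R -> C) (a b c : R) (l m : C) :
  is_cint f a b l -> is_cint f b c m -> is_cint f a c (l + m)%C.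
Proof.
  intros [H1 H2] [K1 K2]; split; [exact (is_RInt_Chasles _ _ _ _ _ _ H1 K1) | exact (is_RInt_Chasles _ _ _ _ _ _ H2 K2)].
Qed.

Lemma is_cint_swap (f : R -> C) (a b : R) (l : C) : is_cint f a b l -> is_cint f b a (- l)%C.
Proof.
  intros [H1 H2]; split; [exact (is_RInt_swap _ _ _ _ H1) | exact (is_RInt_swap _ _ _ _ H2)].
Qed.

Lemma is_cint_point (f : R -> C) (a : R) : is_cint f a a 0.
Proof. split; apply (@is_RInt_point R_NormedModule). Qed.

Lemma is_cint_const (c : C) (a b : R) : is_cint (fun _ => c) a b (RtoC (b - a) * c)%C.
Proof.
  split.
  - replace (Re (RtoC (b - a) * c)) with (scal (b - a) (Re c))
      by (unfold scal; simpl; unfold mult; simpl; reim).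
    apply (@is_RInt_const R_NormedModule).
  - replace (Im (RtoC (b - a) * c)) with (scal (b - a) (Im c))
      by (unfold scal; simpl; unfold mult; simpl; reim).
    apply (@is_RInt_const R_NormedModule).
Qed.

(** The factor 2 comes from bounding the two components one by one; it is harmless, since the bound
    only serves to make integrals small or remainders quadratic. *)
Lemma is_cint_bound_le (f : R -> C) (a b : R) (l : C) (M : R) : a <= b ->
  is_cint f a b l -> (forall t, a <= t <= b -> Cmod (f t) <= M) ->
  Cmod l <= 2 * M * (b - a).
Proof.
  intros Hab [H1 H2] B.
  apply Rle_trans with (1 := Cmod_le_re_im l).
  rewrite <- (is_RInt_unique _ _ _ _ H1), <- (is_RInt_unique _ _ _ _ H2).
  assert (A1 : Rabs (RInt (fun t => Re (f t)) a b) <= (b - a) * M).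
  { apply abs_RInt_le_const; auto; [exists (Re l); exact H1 |].
    intros t Ht; apply Rle_trans with (1 := re_le_Cmod _); auto. }
  assert (A2 : Rabs (RInt (fun t => Im (f t)) a b) <= (b - a) * M).
  { apply abs_RInt_le_const; auto; [exists (Im l); exact H2 |].
    intros t Ht; apply Rle_trans with (1 := im_le_Cmod _); auto. }
  lra.
Qed.

Lemma is_cint_bound (f : R -> C) (a b : R) (l : C) (M : R) :
  is_cint f a b l -> (forall t, Rmin a b <= t <= Rmax a b -> Cmod (f t) <= M) ->
  Cmod l <= 2 * M * Rabs (b - a).
Proof.
  intros H B; destruct (Rle_dec a b) as [L | L].
  - rewrite Rmin_left, Rmax_right in B by auto; rewrite Rabs_pos_eq by lra.
    apply (is_cint_bound_le f a b); auto.
  - rewrite Rmin_right, Rmax_left in B by lra.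
    rewrite Rabs_minus_sym, Rabs_pos_eq, <- Cmod_opp by lra.
    apply (is_cint_bound_le f b a); auto; [lra | apply is_cint_swap; auto].
Qed.

Lemma is_cint_FTC (F f : R -> C) (a b : R) :
  (forall t, Rmin a b <= t <= Rmax a b -> rder F t (f t)) ->
  (forall t, Rmin a b <= t <= Rmax a b -> rcont f t) ->
  is_cint f a b (F b - F a)%C.
Proof.
  intros D H; split.
  - apply (@is_RInt_derive R_CompleteNormedModule (fun t => Re (F t)) (fun t => Re (f t))).
    + intros x Hx; apply rder_Re; auto.
    + intros z Hz; apply continuous_of_eps; intros eps He.
      destruct (H z Hz eps He) as [d [Hd K]]; exists d; split; auto.
      intros x Hx; apply Rle_lt_trans with (2 := K x Hx), (re_le_Cmod (f x - f z)).
  - apply (@is_RInt_derive R_CompleteNormedModule (fun t => Im (F t)) (fun t => Im (f t))).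
    + intros x Hx; apply rder_Im; auto.
    + intros z Hz; apply continuous_of_eps; intros eps He.
      destruct (H z Hz eps He) as [d [Hd K]]; exists d; split; auto.
      intros x Hx; apply Rle_lt_trans with (2 := K x Hx), (im_le_Cmod (f x - f z)).
Qed.

Lemma ccont_hline (f : C -> C) (x y : R) : ccont f (x, y) -> rcont (fun t => f (t, y)) x.
Proof.
  intros H eps He; destruct (H eps He) as [d [Hd K]]; exists d; split; auto.
  intros t Ht; apply K.
  replace ((t, y) - (x, y))%C with (RtoC (t - x)) by (apply Ceq; simpl; ring).
  rewrite Cmod_R; auto.
Qed.

Lemma ccont_vline (f : C -> C) (x y : R) : ccont f (x, y) -> rcont (fun t => f (x, t)) y.
Proof.
  intros H eps He; destruct (H eps He) as [d [Hd K]]; exists d; split; auto.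
  intros t Ht; apply K.
  replace ((x, t) - (x, y))%C with (RtoC (t - y) * Ci)%C by (apply Ceq; simpl; ring).
  rewrite Cmod_mult, Cmod_R, Cmod_Ci; lra.
Qed.

(** The corners may come in any order: later rectangles are drawn from a given corner in an
    arbitrary direction, and the integral carries the sign of the orientation. *)
Definition in_rect (x0 x1 y0 y1 : R) (z : C) : Prop :=
  Rmin x0 x1 <= Re z <= Rmax x0 x1 /\ Rmin y0 y1 <= Im z <= Rmax y0 y1.

(** The boundary integral, counterclockwise when [x0 < x1] and [y0 < y1]; the factor [Ci] is
    [dz = i dt] on vertical sides. *)
Definition rect_int (f : C -> C) (x0 x1 y0 y1 : R) : C :=
  (cint (fun t => f (t, y0)) x0 x1 - cint (fun t => f (t, y1)) x0 x1
   + Ci * (cint (fun t => f (x1, t)) y0 y1 - cint (fun t => f (x0, t)) y0 y1))%C.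

Definition rect_edges (x0 x1 y0 y1 : R) (z : C) : Prop :=
  in_rect x0 x1 y0 y1 z /\ (Re z = x0 \/ Re z = x1 \/ Im z = y0 \/ Im z = y1).

Lemma Rmin_max_l (a b : R) : Rmin a b <= a <= Rmax a b.
Proof. split; [apply Rmin_l | apply Rmax_l]. Qed.

Lemma Rmin_max_r (a b : R) : Rmin a b <= b <= Rmax a b.
Proof. split; [apply Rmin_r | apply Rmax_r]. Qed.

Lemma edge_b (x0 x1 y0 y1 t : R) : Rmin x0 x1 <= t <= Rmax x0 x1 -> rect_edges x0 x1 y0 y1 (t, y0).
Proof. intros H; split; [split; [exact H | apply Rmin_max_l] | simpl; auto]. Qed.

Lemma edge_t (x0 x1 y0 y1 t : R) : Rmin x0 x1 <= t <= Rmax x0 x1 -> rect_edges x0 x1 y0 y1 (t, y1).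
Proof. intros H; split; [split; [exact H | apply Rmin_max_r] | simpl; auto]. Qed.

Lemma edge_l (x0 x1 y0 y1 t : R) : Rmin y0 y1 <= t <= Rmax y0 y1 -> rect_edges x0 x1 y0 y1 (x0, t).
Proof. intros H; split; [split; [apply Rmin_max_l | exact H] | simpl; auto]. Qed.

Lemma edge_r (x0 x1 y0 y1 t : R) : Rmin y0 y1 <= t <= Rmax y0 y1 -> rect_edges x0 x1 y0 y1 (x1, t).
Proof. intros H; split; [split; [apply Rmin_max_r | exact H] | simpl; auto]. Qed.

Lemma is_cint_edges (f : C -> C) (x0 x1 y0 y1 : R) :
  (forall z, rect_edges x0 x1 y0 y1 z -> ccont f z) ->
  is_cint (fun t => f (t, y0)) x0 x1 (cint (fun t => f (t, y0)) x0 x1) /\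
  is_cint (fun t => f (t, y1)) x0 x1 (cint (fun t => f (t, y1)) x0 x1) /\
  is_cint (fun t => f (x0, t)) y0 y1 (cint (fun t => f (x0, t)) y0 y1) /\
  is_cint (fun t => f (x1, t)) y0 y1 (cint (fun t => f (x1, t)) y0 y1).
Proof.
  intros H; repeat match goal with |- _ /\ _ => split end; apply is_cint_cint; intros t Ht.
  - apply ccont_hline, H, edge_b; auto.
  - apply ccont_hline, H, edge_t; auto.
  - apply ccont_vline, H, edge_l; auto.
  - apply ccont_vline, H, edge_r; auto.
Qed.

Lemma rect_int_ext (f g : C -> C) (x0 x1 y0 y1 : R) :
  (forall z, rect_edges x0 x1 y0 y1 z -> f z = g z) ->
  rect_int f x0 x1 y0 y1 = rect_int g x0 x1 y0 y1.
Proof.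
  intros E; unfold rect_int, cint.
  assert (X : forall (u v : R -> C) a b, (forall t, Rmin a b <= t <= Rmax a b -> u t = v t) ->
    RInt (fun t => Re (u t)) a b = RInt (fun t => Re (v t)) a b /\
    RInt (fun t => Im (u t)) a b = RInt (fun t => Im (v t)) a b).
  { intros u v a b H; split; apply RInt_ext; intros x Hx; rewrite H; auto; lra. }
  destruct (X (fun t => f (t, y0)) (fun t => g (t, y0)) x0 x1) as [-> ->].
  { intros t Ht; apply E, edge_b; auto. }
  destruct (X (fun t => f (t, y1)) (fun t => g (t, y1)) x0 x1) as [-> ->].
  { intros t Ht; apply E, edge_t; auto. }
  destruct (X (fun t => f (x0, t)) (fun t => g (x0, t)) y0 y1) as [-> ->].
  { intros t Ht; apply E, edge_l; auto. }
  destruct (X (fun t => f (x1, t)) (fun t => g (x1, t)) y0 y1) as [-> ->].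
  { intros t Ht; apply E, edge_r; auto. }
  reflexivity.
Qed.

Lemma rect_int_plus (f g : C -> C) (x0 x1 y0 y1 : R) :
  (forall z, rect_edges x0 x1 y0 y1 z -> ccont f z) ->
  (forall z, rect_edges x0 x1 y0 y1 z -> ccont g z) ->
  rect_int (fun z => f z + g z)%C x0 x1 y0 y1 =
  (rect_int f x0 x1 y0 y1 + rect_int g x0 x1 y0 y1)%C.
Proof.
  intros Hf Hg.
  destruct (is_cint_edges f _ _ _ _ Hf) as [F1 [F2 [F3 F4]]].
  destruct (is_cint_edges g _ _ _ _ Hg) as [G1 [G2 [G3 G4]]].
  unfold rect_int at 1.
  rewrite (cint_of_is_cint _ _ _ _ (is_cint_plus _ _ _ _ _ _ F1 G1)).
  rewrite (cint_of_is_cint _ _ _ _ (is_cint_plus _ _ _ _ _ _ F2 G2)).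
  rewrite (cint_of_is_cint _ _ _ _ (is_cint_plus _ _ _ _ _ _ F3 G3)).
  rewrite (cint_of_is_cint _ _ _ _ (is_cint_plus _ _ _ _ _ _ F4 G4)).
  unfold rect_int; ring.
Qed.

Lemma rect_int_scal (f : C -> C) (c : C) (x0 x1 y0 y1 : R) :
  (forall z, rect_edges x0 x1 y0 y1 z -> ccont f z) ->
  rect_int (fun z => c * f z)%C x0 x1 y0 y1 = (c * rect_int f x0 x1 y0 y1)%C.
Proof.
  intros Hf; destruct (is_cint_edges f _ _ _ _ Hf) as [F1 [F2 [F3 F4]]].
  unfold rect_int at 1.
  rewrite (cint_of_is_cint _ _ _ _ (is_cint_scal _ _ _ c _ F1)).
  rewrite (cint_of_is_cint _ _ _ _ (is_cint_scal _ _ _ c _ F2)).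
  rewrite (cint_of_is_cint _ _ _ _ (is_cint_scal _ _ _ c _ F3)).
  rewrite (cint_of_is_cint _ _ _ _ (is_cint_scal _ _ _ c _ F4)).
  unfold rect_int; ring.
Qed.

Lemma rect_int_bound (f : C -> C) (x0 x1 y0 y1 M : R) :
  (forall z, rect_edges x0 x1 y0 y1 z -> ccont f z) ->
  (forall z, rect_edges x0 x1 y0 y1 z -> Cmod (f z) <= M) ->
  Cmod (rect_int f x0 x1 y0 y1) <= 4 * M * (Rabs (x1 - x0) + Rabs (y1 - y0)).
Proof.
  intros Hf B; destruct (is_cint_edges f _ _ _ _ Hf) as [F1 [F2 [F3 F4]]].
  apply is_cint_bound with (M := M) in F1; [| intros; apply B, edge_b; auto].
  apply is_cint_bound with (M := M) in F2; [| intros; apply B, edge_t; auto].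
  apply is_cint_bound with (M := M) in F3; [| intros; apply B, edge_l; auto].
  apply is_cint_bound with (M := M) in F4; [| intros; apply B, edge_r; auto].
  unfold rect_int.
  apply Rle_trans with (1 := Cmod_triangle _ _).
  rewrite Cmod_mult, Cmod_Ci.
  apply Rle_trans with (1 := Rplus_le_compat _ _ _ _ (Cmod_triangle_sub _ _)
    (Rmult_le_compat_l _ _ _ Rle_0_1 (Cmod_triangle_sub _ _))).
  lra.
Qed.

Lemma rect_int_split_x (f : C -> C) (x0 x1 x2 y0 y1 : R) :
  (forall z, rect_edges x0 x1 y0 y1 z -> ccont f z) ->
  (forall z, rect_edges x1 x2 y0 y1 z -> ccont f z) ->
  rect_int f x0 x2 y0 y1 = (rect_int f x0 x1 y0 y1 + rect_int f x1 x2 y0 y1)%C.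
Proof.
  intros Hf Hg.
  destruct (is_cint_edges f _ _ _ _ Hf) as [F1 [F2 [F3 F4]]].
  destruct (is_cint_edges f _ _ _ _ Hg) as [G1 [G2 [G3 G4]]].
  unfold rect_int at 1.
  rewrite (cint_of_is_cint _ _ _ _ (is_cint_Chasles _ _ _ _ _ _ F1 G1)).
  rewrite (cint_of_is_cint _ _ _ _ (is_cint_Chasles _ _ _ _ _ _ F2 G2)).
  unfold rect_int; ring.
Qed.

Lemma rect_int_split_y (f : C -> C) (x0 x1 y0 y1 y2 : R) :
  (forall z, rect_edges x0 x1 y0 y1 z -> ccont f z) ->
  (forall z, rect_edges x0 x1 y1 y2 z -> ccont f z) ->
  rect_int f x0 x1 y0 y2 = (rect_int f x0 x1 y0 y1 + rect_int f x0 x1 y1 y2)%C.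
Proof.
  intros Hf Hg.
  destruct (is_cint_edges f _ _ _ _ Hf) as [F1 [F2 [F3 F4]]].
  destruct (is_cint_edges f _ _ _ _ Hg) as [G1 [G2 [G3 G4]]].
  unfold rect_int at 1.
  rewrite (cint_of_is_cint _ _ _ _ (is_cint_Chasles _ _ _ _ _ _ F3 G3)).
  rewrite (cint_of_is_cint _ _ _ _ (is_cint_Chasles _ _ _ _ _ _ F4 G4)).
  unfold rect_int; ring.
Qed.

Lemma rect_int_swap_x (f : C -> C) (x0 x1 y0 y1 : R) :
  (forall z, rect_edges x0 x1 y0 y1 z -> ccont f z) ->
  rect_int f x1 x0 y0 y1 = (- rect_int f x0 x1 y0 y1)%C.
Proof.
  intros Hf; destruct (is_cint_edges f _ _ _ _ Hf) as [F1 [F2 [F3 F4]]].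
  unfold rect_int at 1.
  rewrite (cint_of_is_cint _ _ _ _ (is_cint_swap _ _ _ _ F1)).
  rewrite (cint_of_is_cint _ _ _ _ (is_cint_swap _ _ _ _ F2)).
  unfold rect_int; ring.
Qed.

Lemma rect_int_swap_y (f : C -> C) (x0 x1 y0 y1 : R) :
  (forall z, rect_edges x0 x1 y0 y1 z -> ccont f z) ->
  rect_int f x0 x1 y1 y0 = (- rect_int f x0 x1 y0 y1)%C.
Proof.
  intros Hf; destruct (is_cint_edges f _ _ _ _ Hf) as [F1 [F2 [F3 F4]]].
  unfold rect_int at 1.
  rewrite (cint_of_is_cint _ _ _ _ (is_cint_swap _ _ _ _ F3)).
  rewrite (cint_of_is_cint _ _ _ _ (is_cint_swap _ _ _ _ F4)).
  unfold rect_int; ring.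
Qed.

Lemma rder_hline (F : C -> C) (x y : R) (l : C) : cder F (x, y) l -> rder (fun t => F (t, y)) x l.
Proof.
  intros H.
  apply (rder_ext (fun t => F ((0, y) + RtoC t * 1)%C)).
  { intros t; f_equal; apply Ceq; simpl; ring. }
  apply (rder_eq _ _ (l * 1)); [ring |].
  apply (rder_comp F (fun t => ((0, y) + RtoC t * 1)%C)); [apply rder_affine |].
  replace ((0, y) + RtoC x * 1)%C with ((x, y) : C) by (apply Ceq; simpl; ring); auto.
Qed.

Lemma rder_vline (F : C -> C) (x y : R) (l : C) :
  cder F (x, y) l -> rder (fun t => F (x, t)) y (l * Ci)%C.
Proof.
  intros H.
  apply (rder_ext (fun t => F ((x, 0) + RtoC t * Ci)%C)).
  { intros t; f_equal; apply Ceq; simpl; ring. }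
  apply (rder_comp F (fun t => ((x, 0) + RtoC t * Ci)%C)); [apply rder_affine |].
  replace ((x, 0) + RtoC y * Ci)%C with ((x, y) : C) by (apply Ceq; simpl; ring); auto.
Qed.

(** Each side contributes the difference of [F] between two corners, and these cancel around the
    boundary. *)
Lemma rect_int_primitive (F f : C -> C) (x0 x1 y0 y1 : R) :
  (forall z, cder F z (f z)) -> (forall z, ccont f z) -> rect_int f x0 x1 y0 y1 = 0%C.
Proof.
  intros D H.
  assert (Hz : forall y, cint (fun t => f (t, y)) x0 x1 = (F (x1, y) - F (x0, y))%C).
  { intros y; apply cint_of_is_cint, (is_cint_FTC (fun t => F (t, y))); intros t _.
    - apply rder_hline; auto.
    - apply ccont_hline; auto. }
  assert (V : forall x, (Ci * cint (fun t => f (x, t)) y0 y1)%C = (F (x, y1) - F (x, y0))%C).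
  { intros x.
    rewrite <- (cint_of_is_cint (fun t => Ci * f (x, t))%C y0 y1 (F (x, y1) - F (x, y0))%C).
    - symmetry; apply cint_of_is_cint, is_cint_scal, is_cint_cint.
      intros t _; apply ccont_vline; auto.
    - apply (is_cint_FTC (fun t => F (x, t))); intros t _.
      + apply (rder_eq _ _ (f (x, t) * Ci)); [ring | apply rder_vline; auto].
      + apply (ccont_vline (fun z => Ci * f z)%C), ccont_mult; [apply ccont_const | auto]. }
  unfold rect_int.
  replace (Ci * (cint (fun t => f (x1, t)) y0 y1 - cint (fun t => f (x0, t)) y0 y1))%C
    with (Ci * cint (fun t => f (x1, t)) y0 y1 - Ci * cint (fun t => f (x0, t)) y0 y1)%C by ring.
  rewrite 2!Hz, 2!V; ring.
Qed.

Lemma rect_int_affine (a b p : C) (x0 x1 y0 y1 : R) :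
  rect_int (fun z => a + b * (z - p))%C x0 x1 y0 y1 = 0%C.
Proof.
  assert (D : forall z, cder (fun z => z - p)%C z (1 - 0)%C)
    by (intros; apply cder_minus; [apply cder_id | apply cder_const]).
  apply (rect_int_primitive (fun z => a * z + b / 2 * ((z - p) * (z - p)))%C).
  - intros z; eapply cder_eq.
    2: { apply cder_plus; [apply cder_scal, cder_id | apply cder_scal, cder_mult; apply D]. }
    cbv beta; field.
  - intros z; apply ccont_plus; [apply ccont_const |].
    apply ccont_mult; [apply ccont_const |].
    apply ccont_minus; [apply ccont_id | apply ccont_const].
Qed.

Lemma in_rect_ordered (x0 x1 y0 y1 : R) (z : C) : x0 <= x1 -> y0 <= y1 ->
  in_rect x0 x1 y0 y1 z <-> (x0 <= Re z <= x1 /\ y0 <= Im z <= y1).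
Proof. intros Hx Hy; unfold in_rect; rewrite 2!Rmin_left, 2!Rmax_right; tauto. Qed.

(** Let [k] be the ratio of the integral to the area. Both are additive, so an integral of modulus
    at least [k] times the area is inherited by some quarter. At the limit point the affine part of
    [f] integrates to 0 and the remainder gives only [eps] times the squared size. *)
Lemma goursat_ordered (f : C -> C) (a b c d : R) : a < b -> c < d ->
  (forall z, in_rect a b c d z -> exists l, cder f z l) -> rect_int f a b c d = 0%C.
Proof.
  intros Hab Hcd D.
  assert (Cf : forall x0 x1 y0 y1, x0 <= x1 -> y0 <= y1 -> a <= x0 -> x1 <= b -> c <= y0 -> y1 <= d ->
    forall z, rect_edges x0 x1 y0 y1 z -> ccont f z).
  { intros x0 x1 y0 y1 Hx Hy A1 A2 A3 A4 z [Hz _].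
    apply (proj1 (in_rect_ordered _ _ _ _ _ Hx Hy)) in Hz.
    destruct (D z) as [l Hl]; [apply in_rect_ordered; lra | apply (cder_ccont f z l Hl)]. }
  apply Cmod_eq_0; apply NNPP; intros N.
  assert (P0 : 0 < Cmod (rect_int f a b c d)) by (assert (H := Cmod_ge_0 (rect_int f a b c d)); lra).
  set (k := Cmod (rect_int f a b c d) / ((b - a) * (d - c))).
  assert (Pk : 0 < k) by (apply Rdiv_lt_0_compat; auto; apply Rmult_lt_0_compat; lra).
  destruct (bisection (fun x0 x1 y0 y1 => (a <= x0 /\ x1 <= b /\ c <= y0 /\ y1 <= d) /\
    k * ((x1 - x0) * (y1 - y0)) <= Cmod (rect_int f x0 x1 y0 y1))) with a b c d
    as [px [py Hp]]; try lra.
  - intros x0 x1 y0 y1 Hx Hy [[A1 [A2 [A3 A4]]] HP] xm ym.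
    assert (Hxm : x0 <= xm <= x1) by (unfold xm; lra).
    assert (Hym : y0 <= ym <= y1) by (unfold ym; lra).
    assert (E : rect_int f x0 x1 y0 y1 =
      ((rect_int f x0 xm y0 ym + rect_int f xm x1 y0 ym) +
       (rect_int f x0 xm ym y1 + rect_int f xm x1 ym y1))%C).
    { rewrite (rect_int_split_y f x0 x1 y0 ym y1);
        [rewrite 2!(rect_int_split_x f x0 xm x1); auto |..]; apply Cf; lra. }
    assert (T : Cmod (rect_int f x0 x1 y0 y1) <=
      Cmod (rect_int f x0 xm y0 ym) + Cmod (rect_int f xm x1 y0 ym) +
      (Cmod (rect_int f x0 xm ym y1) + Cmod (rect_int f xm x1 ym y1))).
    { rewrite E; apply Rle_trans with (1 := Cmod_triangle _ _).
      apply Rplus_le_compat; apply Cmod_triangle. }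
    assert (Q : k * ((x1 - x0) * (y1 - y0)) =
      k * ((xm - x0) * (ym - y0)) + k * ((x1 - xm) * (ym - y0)) +
      (k * ((xm - x0) * (y1 - ym)) + k * ((x1 - xm) * (y1 - ym)))) by ring.
    destruct (Rle_dec (k * ((xm - x0) * (ym - y0))) (Cmod (rect_int f x0 xm y0 ym)));
      [left; repeat split; auto; lra |].
    destruct (Rle_dec (k * ((x1 - xm) * (ym - y0))) (Cmod (rect_int f xm x1 y0 ym)));
      [right; left; repeat split; auto; lra |].
    destruct (Rle_dec (k * ((xm - x0) * (y1 - ym))) (Cmod (rect_int f x0 xm ym y1)));
      [right; right; left; repeat split; auto; lra |].
    right; right; right; repeat split; auto; lra.
  - repeat split; try lra.
    unfold k; right; field; split; lra.
  - assert (Hin : in_rect a b c d (px, py)).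
    { destruct (Hp 0%nat) as (x0 & x1 & y0 & y1 & _ & Hx & Hy & A).
      apply in_rect_ordered; simpl; lra. }
    destruct (D _ Hin) as [l Hl].
    set (L := (b - a) + (d - c)).
    assert (PL : 0 < L) by (unfold L; lra).
    (* Chosen so that the resulting bound [4 eps L^2] is half of the modulus of the original
       integral. *)
    set (eps := k * ((b - a) * (d - c)) / (8 * L ^ 2)).
    assert (PA : 0 < k * ((b - a) * (d - c)))
      by (apply Rmult_lt_0_compat; [exact Pk | apply Rmult_lt_0_compat; lra]).
    assert (Pe : 0 < eps) by (apply Rdiv_lt_0_compat; auto; nra).
    destruct (cder_eps f _ l Hl eps Pe) as [r [Hr K]].
    destruct (pow2_small L r Hr) as [n Hn].
    destruct (Hp n) as (x0 & x1 & y0 & y1 & [_ HP] & Hx & Hy & B1 & B2 & B3 & B4 & Wx & Wy).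
    assert (P2 : 0 < 2 ^ n) by (apply pow_lt; lra).
    assert (WL : (x1 - x0) + (y1 - y0) = L / 2 ^ n)
      by (rewrite Wx, Wy; unfold L; field; lra).
    set (p := (px, py) : C) in *.
    set (e := fun z => (f z - f p - l * (z - p))%C).
    assert (Ce : forall z, rect_edges x0 x1 y0 y1 z -> ccont e z).
    { intros z Hz; apply ccont_minus; [apply ccont_minus; [| apply ccont_const] |].
      - apply (Cf x0 x1 y0 y1); auto; lra.
      - apply ccont_mult; [apply ccont_const |].
        apply ccont_minus; [apply ccont_id | apply ccont_const]. }
    assert (Be : forall z, rect_edges x0 x1 y0 y1 z -> Cmod (e z) <= eps * (L / 2 ^ n)).
    { intros z [Hz _]; apply (proj1 (in_rect_ordered x0 x1 y0 y1 z ltac:(lra) ltac:(lra))) in Hz.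
      assert (Z : Cmod (z - p) <= L / 2 ^ n).
      { apply Rle_trans with (1 := Cmod_le_re_im _); rewrite <- WL.
        apply Rplus_le_compat; apply Rabs_le; unfold p, Re, Im in *; simpl in *; lra. }
      apply Rle_trans with (1 := K z (Rle_lt_trans _ _ _ Z Hn)).
      apply Rmult_le_compat_l; auto; lra. }
    assert (I : rect_int f x0 x1 y0 y1 = rect_int e x0 x1 y0 y1).
    { rewrite (rect_int_ext f (fun z => (f p + l * (z - p)) + e z)%C)
        by (intros; unfold e; ring).
      rewrite (rect_int_plus (fun z => f p + l * (z - p))%C e); auto.
      - rewrite rect_int_affine; ring.
      - intros z _; apply ccont_plus; [apply ccont_const |].
        apply ccont_mult; [apply ccont_const |].
        apply ccont_minus; [apply ccont_id | apply ccont_const]. }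
    assert (U := rect_int_bound e _ _ _ _ _ Ce Be).
    rewrite <- I, 2!Rabs_pos_eq, WL in U by lra.
    assert (F := Rle_trans _ _ _ HP U).
    rewrite Wx, Wy in F.
    assert (G : k * ((b - a) * (d - c)) <= 4 * eps * L ^ 2).
    { apply Rmult_le_reg_r with (/ (2 ^ n * 2 ^ n)).
      - apply Rinv_0_lt_compat; nra.
      - replace (k * ((b - a) * (d - c)) * / (2 ^ n * 2 ^ n))
          with (k * ((b - a) / 2 ^ n * ((d - c) / 2 ^ n))) by (field; lra).
        replace (4 * eps * L ^ 2 * / (2 ^ n * 2 ^ n))
          with (4 * (eps * (L / 2 ^ n)) * (L / 2 ^ n)) by (field; lra).
        exact F. }
    replace (4 * eps * L ^ 2) with (k * ((b - a) * (d - c)) / 2) in G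
      by (unfold eps; field; lra).
    lra.
Qed.

Lemma in_rect_swap_x (x0 x1 y0 y1 : R) (z : C) : in_rect x0 x1 y0 y1 z -> in_rect x1 x0 y0 y1 z.
Proof. unfold in_rect; rewrite (Rmin_comm x1), (Rmax_comm x1); auto. Qed.

Lemma in_rect_swap_y (x0 x1 y0 y1 : R) (z : C) : in_rect x0 x1 y0 y1 z -> in_rect x0 x1 y1 y0 z.
Proof. unfold in_rect; rewrite (Rmin_comm y1), (Rmax_comm y1); auto. Qed.

Lemma rect_int_degenerate_x (f : C -> C) (x y0 y1 : R) : rect_int f x x y0 y1 = 0%C.
Proof.
  unfold rect_int; rewrite 2!(cint_of_is_cint _ _ _ _ (is_cint_point _ x)); ring.
Qed.

Lemma rect_int_degenerate_y (f : C -> C) (x0 x1 y : R) : rect_int f x0 x1 y y = 0%C.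
Proof.
  unfold rect_int; rewrite 2!(cint_of_is_cint _ _ _ _ (is_cint_point _ y)); ring.
Qed.

Lemma goursat (f : C -> C) (x0 x1 y0 y1 : R) :
  (forall z, in_rect x0 x1 y0 y1 z -> exists l, cder f z l) -> rect_int f x0 x1 y0 y1 = 0%C.
Proof.
  intros D.
  assert (Cf : forall z, in_rect x0 x1 y0 y1 z -> ccont f z)
    by (intros z Hz; destruct (D z Hz) as [l Hl]; exact (cder_ccont f z l Hl)).
  destruct (Rtotal_order x0 x1) as [Hx | [<- | Hx]]; [| apply rect_int_degenerate_x |].
  - destruct (Rtotal_order y0 y1) as [Hy | [<- | Hy]]; [| apply rect_int_degenerate_y |].
    + apply goursat_ordered; auto.
    + rewrite rect_int_swap_y by (intros z [Hz _]; apply Cf, in_rect_swap_y; auto).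
      rewrite goursat_ordered; auto; [ring | intros z Hz; apply D, in_rect_swap_y; auto].
  - rewrite rect_int_swap_x by (intros z [Hz _]; apply Cf, in_rect_swap_x; auto).
    destruct (Rtotal_order y0 y1) as [Hy | [<- | Hy]].
    + rewrite goursat_ordered; auto; [ring | intros z Hz; apply D, in_rect_swap_x; auto].
    + rewrite rect_int_degenerate_y; ring.
    + rewrite rect_int_swap_y
        by (intros z [Hz _]; apply Cf, in_rect_swap_x, in_rect_swap_y; auto).
      rewrite goursat_ordered; auto;
        [ring | intros z Hz; apply D, in_rect_swap_x, in_rect_swap_y; auto].
Qed.

Lemma betw_sub (a b c d t : R) :
  Rmin a b <= c <= Rmax a b -> Rmin a b <= d <= Rmax a b ->
  Rmin c d <= t <= Rmax c d -> Rmin a b <= t <= Rmax a b.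
Proof.
  intros Hc Hd [H1 H2]; split.
  - apply Rle_trans with (2 := H1), Rmin_glb; tauto.
  - apply Rle_trans with (1 := H2), Rmax_lub; tauto.
Qed.

Lemma betw_scale (a b e : R) : 0 <= e <= 1 -> Rmin a b <= a + e * (b - a) <= Rmax a b.
Proof.
  intros He; unfold Rmin, Rmax; destruct (Rle_dec a b); nra.
Qed.

Lemma not_betw_scale (a b e : R) : 0 < e -> e <= 1 -> b <> a ->
  ~ (Rmin (a + e * (b - a)) b <= a <= Rmax (a + e * (b - a)) b).
Proof.
  intros H0 H1 N [K1 K2]; destruct (Rtotal_order a b) as [H | [H | H]]; [| lra |].
  - apply Rlt_not_le in K1; auto; apply Rmin_glb_lt; nra.
  - apply Rlt_not_le in K2; auto; apply Rmax_lub_lt; nra.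
Qed.

Lemma betw_dist (a b t : R) : Rmin a b <= t <= Rmax a b -> Rabs (t - a) <= Rabs (b - a).
Proof.
  unfold Rmin, Rmax; destruct (Rle_dec a b); intros H.
  - rewrite 2!Rabs_pos_eq; lra.
  - rewrite (Rabs_minus_sym t), (Rabs_minus_sym b), 2!Rabs_pos_eq; lra.
Qed.

(** All but an arbitrarily small rectangle at the corner [p] can be cut off by Goursat's theorem,
    and continuity keeps [q] bounded on what remains. *)
Lemma goursat_corner (q : C -> C) (p : C) (x y : R) :
  (forall z, in_rect (Re p) x (Im p) y z -> ccont q z) ->
  (forall z, in_rect (Re p) x (Im p) y z -> z <> p -> exists l, cder q z l) ->
  rect_int q (Re p) x (Im p) y = 0%C.
Proof.
  intros Hc Hd.
  destruct (Req_dec x (Re p)) as [-> | Nx]; [apply rect_int_degenerate_x |].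
  destruct (Req_dec y (Im p)) as [-> | Ny]; [apply rect_int_degenerate_y |].
  assert (Small : forall e, 0 < e -> e <= 1 -> rect_int q (Re p) x (Im p) y =
    rect_int q (Re p) (Re p + e * (x - Re p)) (Im p) (Im p + e * (y - Im p))).
  { intros e E0 E1.
    assert (Bx := betw_scale (Re p) x e ltac:(lra)).
    assert (By := betw_scale (Im p) y e ltac:(lra)).
    assert (Ax := Rmin_max_l (Re p) x); assert (Ay := Rmin_max_l (Im p) y).
    assert (Cx := Rmin_max_r (Re p) x); assert (Cy := Rmin_max_r (Im p) y).
    set (xe := Re p + e * (x - Re p)) in *; set (ye := Im p + e * (y - Im p)) in *.
    assert (Sub : forall a b c d, Rmin (Re p) x <= a <= Rmax (Re p) x ->
      Rmin (Re p) x <= b <= Rmax (Re p) x -> Rmin (Im p) y <= c <= Rmax (Im p) y ->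
      Rmin (Im p) y <= d <= Rmax (Im p) y -> forall z, in_rect a b c d z -> in_rect (Re p) x (Im p) y z).
    { intros a b c d Ha Hb Hcc Hdd z [Z1 Z2]; split;
        [apply (betw_sub _ _ a b) | apply (betw_sub _ _ c d)]; auto. }
    rewrite (rect_int_split_x q (Re p) xe x), (rect_int_split_y q (Re p) xe (Im p) ye y).
    - rewrite (goursat q xe x), (goursat q (Re p) xe ye y); [ring | |].
      + intros z Hz; apply Hd; [apply (Sub (Re p) xe ye y); auto |].
        intros ->; apply (not_betw_scale (Im p) y e E0 E1 Ny), Hz.
      + intros z Hz; apply Hd; [apply (Sub xe x (Im p) y); auto |].
        intros ->; apply (not_betw_scale (Re p) x e E0 E1 Nx), Hz.
    - intros z [Hz _]; apply Hc, (Sub (Re p) xe (Im p) ye); auto.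
    - intros z [Hz _]; apply Hc, (Sub (Re p) xe ye y); auto.
    - intros z [Hz _]; apply Hc, (Sub (Re p) xe (Im p) y); auto.
    - intros z [Hz _]; apply Hc, (Sub xe x (Im p) y); auto. }
  assert (Hp : in_rect (Re p) x (Im p) y p) by (split; apply Rmin_max_l).
  destruct (ccont_bounded q p (Hc p Hp)) as [r [Hr B]].
  set (M := Cmod (q p) + 1) in *.
  assert (PM : 0 < M) by (assert (H := Cmod_ge_0 (q p)); unfold M; lra).
  set (S := Rabs (x - Re p) + Rabs (y - Im p)).
  assert (PS : 0 < S).
  { assert (H1 := Rabs_pos_lt (x - Re p) ltac:(lra)); assert (H2 := Rabs_pos (y - Im p)).
    unfold S; lra. }
  apply Cmod_eq_0; apply NNPP; intros N.
  assert (PA : 0 < Cmod (rect_int q (Re p) x (Im p) y))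
    by (assert (H := Cmod_ge_0 (rect_int q (Re p) x (Im p) y)); lra).
  set (A := Cmod (rect_int q (Re p) x (Im p) y)) in *.
  (* The second term keeps the small rectangle in the disc where [|q| < M]; the third makes its
     integral at most [A / 2], against the assumption that it equals [A > 0]. *)
  set (e := Rmin 1 (Rmin (r / (2 * S)) (A / (8 * M * S)))).
  assert (E0 : 0 < e).
  { repeat apply Rmin_glb_lt; [lra | apply Rdiv_lt_0_compat; lra |].
    apply Rdiv_lt_0_compat; [auto | repeat apply Rmult_lt_0_compat; lra]. }
  assert (E1 : e <= 1) by apply Rmin_l.
  assert (E2 : e * S <= r / 2).
  { apply Rle_trans with (r / (2 * S) * S); [| right; field; lra].
    apply Rmult_le_compat_r; [lra |].
    apply Rle_trans with (1 := Rmin_r _ _), Rmin_l. }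
  assert (E3 : 4 * M * (e * S) <= A / 2).
  { apply Rle_trans with (4 * M * (A / (8 * M * S) * S)); [| right; field; lra].
    apply Rmult_le_compat_l; [lra |]; apply Rmult_le_compat_r; [lra |].
    apply Rle_trans with (1 := Rmin_r _ _), Rmin_r. }
  assert (Dx : Rabs (Re p + e * (x - Re p) - Re p) = e * Rabs (x - Re p)).
  { replace (Re p + e * (x - Re p) - Re p) with (e * (x - Re p)) by ring.
    rewrite Rabs_mult, (Rabs_pos_eq e); lra. }
  assert (Dy : Rabs (Im p + e * (y - Im p) - Im p) = e * Rabs (y - Im p)).
  { replace (Im p + e * (y - Im p) - Im p) with (e * (y - Im p)) by ring.
    rewrite Rabs_mult, (Rabs_pos_eq e); lra. }
  assert (U := rect_int_bound q (Re p) (Re p + e * (x - Re p)) (Im p) (Im p + e * (y - Im p)) M).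
  rewrite Dx, Dy, <- (Small e E0 E1), <- Rmult_plus_distr_l in U; fold A in U; fold S in U.
  cut (A <= 4 * M * (e * S)); [lra |]; apply U.
  - intros z [[Z1 Z2] _]; apply Hc; split.
    + apply (betw_sub _ _ _ _ _ (Rmin_max_l _ _) (betw_scale (Re p) x e ltac:(lra)) Z1).
    + apply (betw_sub _ _ _ _ _ (Rmin_max_l _ _) (betw_scale (Im p) y e ltac:(lra)) Z2).
  - intros z [[Z1 Z2] _]; left; apply B.
    apply betw_dist in Z1; apply betw_dist in Z2.
    apply Rle_lt_trans with (1 := Cmod_le_re_im _).
    replace (Re (z - p)) with (Re z - Re p) by reim.
    replace (Im (z - p)) with (Im z - Im p) by reim.
    unfold S in E2; lra.
Qed.

(** Splitting both sides at [p] makes it a corner of each of four rectangles, up to orientation. *)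
Lemma goursat_exceptional (q : C -> C) (p : C) (x0 x1 y0 y1 : R) :
  in_rect x0 x1 y0 y1 p ->
  (forall z, in_rect x0 x1 y0 y1 z -> ccont q z) ->
  (forall z, in_rect x0 x1 y0 y1 z -> z <> p -> exists l, cder q z l) ->
  rect_int q x0 x1 y0 y1 = 0%C.
Proof.
  intros [Px Py] Hc Hd.
  assert (Sub : forall a b c d, Rmin x0 x1 <= a <= Rmax x0 x1 ->
    Rmin x0 x1 <= b <= Rmax x0 x1 -> Rmin y0 y1 <= c <= Rmax y0 y1 ->
    Rmin y0 y1 <= d <= Rmax y0 y1 -> forall z, in_rect a b c d z -> in_rect x0 x1 y0 y1 z).
  { intros a b c d Ha Hb Hcc Hdd z [Z1 Z2]; split;
      [apply (betw_sub _ _ a b) | apply (betw_sub _ _ c d)]; auto. }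
  assert (Ax := Rmin_max_l x0 x1); assert (Ay := Rmin_max_l y0 y1).
  assert (Cx := Rmin_max_r x0 x1); assert (Cy := Rmin_max_r y0 y1).
  assert (Cor : forall x y, Rmin x0 x1 <= x <= Rmax x0 x1 -> Rmin y0 y1 <= y <= Rmax y0 y1 ->
    rect_int q (Re p) x (Im p) y = 0%C).
  { intros x y Hx Hy; apply goursat_corner.
    - intros z Hz; apply Hc, (Sub (Re p) x (Im p) y); auto.
    - intros z Hz; apply Hd, (Sub (Re p) x (Im p) y); auto. }
  assert (Ce : forall a b c d, Rmin x0 x1 <= a <= Rmax x0 x1 ->
    Rmin x0 x1 <= b <= Rmax x0 x1 -> Rmin y0 y1 <= c <= Rmax y0 y1 ->
    Rmin y0 y1 <= d <= Rmax y0 y1 -> forall z, rect_edges a b c d z -> ccont q z)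
    by (intros a b c d Ha Hb Hcc Hdd z [Hz _]; apply Hc, (Sub a b c d); auto).
  rewrite (rect_int_split_x q x0 (Re p) x1) by (apply Ce; auto).
  rewrite 2!(rect_int_split_y q _ _ y0 (Im p) y1) by (apply Ce; auto).
  rewrite (rect_int_swap_x q (Re p) x0 (Im p) y1), Cor by (try apply Ce; auto).
  rewrite (rect_int_swap_x q (Re p) x0 y0 (Im p)) by (apply Ce; auto).
  rewrite (rect_int_swap_y q (Re p) x0 (Im p) y0), Cor by (try apply Ce; auto).
  rewrite (rect_int_swap_y q (Re p) x1 (Im p) y0), Cor by (try apply Ce; auto).
  rewrite Cor by auto; ring.
Qed.

(** * Cauchy integrals and the differentiability of derivatives *)

Definition cauchy_int (x0 x1 y0 y1 : R) (n : nat) (f : C -> C) (w : C) : C :=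
  rect_int (fun z => f z * (/ (z - w)) ^ n)%C x0 x1 y0 y1.

Definition inside (x0 x1 y0 y1 : R) (w : C) : Prop := x0 < Re w < x1 /\ y0 < Im w < y1.

Lemma edge_dist (x0 x1 y0 y1 : R) (w : C) : inside x0 x1 y0 y1 w ->
  exists d, 0 < d /\ forall z, rect_edges x0 x1 y0 y1 z -> d <= Cmod (z - w).
Proof.
  intros [[A1 A2] [A3 A4]].
  exists (Rmin (Rmin (Re w - x0) (x1 - Re w)) (Rmin (Im w - y0) (y1 - Im w))).
  split; [repeat apply Rmin_glb_lt; lra |].
  intros z [_ E].
  assert (R1 := re_le_Cmod (z - w)); assert (R2 := im_le_Cmod (z - w)).
  replace (Re (z - w)) with (Re z - Re w) in R1 by reim.
  replace (Im (z - w)) with (Im z - Im w) in R2 by reim.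
  assert (X1 := Rle_abs (Re z - Re w)); assert (X2 := Rle_abs (- (Re z - Re w))).
  assert (X3 := Rle_abs (Im z - Im w)); assert (X4 := Rle_abs (- (Im z - Im w))).
  rewrite Rabs_Ropp in X2, X4.
  assert (M1 := Rmin_l (Rmin (Re w - x0) (x1 - Re w)) (Rmin (Im w - y0) (y1 - Im w))).
  assert (M2 := Rmin_r (Rmin (Re w - x0) (x1 - Re w)) (Rmin (Im w - y0) (y1 - Im w))).
  assert (M3 := Rmin_l (Re w - x0) (x1 - Re w)); assert (M4 := Rmin_r (Re w - x0) (x1 - Re w)).
  assert (M5 := Rmin_l (Im w - y0) (y1 - Im w)); assert (M6 := Rmin_r (Im w - y0) (y1 - Im w)).
  destruct E as [E | [E | [E | E]]]; rewrite E in *; lra.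
Qed.

Lemma ccont_pow (f : C -> C) (z : C) (n : nat) : ccont f z -> ccont (fun w => f w ^ n)%C z.
Proof.
  intros H; induction n as [| n IH]; simpl; [apply ccont_const | apply ccont_mult; auto].
Qed.

Lemma ccont_cauchy_kernel (f : C -> C) (n : nat) (w z : C) : z <> w -> ccont f z ->
  ccont (fun z => f z * (/ (z - w)) ^ n)%C z.
Proof.
  intros N H; apply ccont_mult; auto.
  apply (ccont_pow (fun z => / (z - w))%C), (ccont_inv (fun z => z - w)%C);
    [apply ccont_minus; [apply ccont_id | apply ccont_const] | apply Csub_neq, N].
Qed.

Section CauchyIntegral.

Variables (x0 x1 y0 y1 : R) (f : C -> C) (B : R).
Hypothesis f_cont : forall z, rect_edges x0 x1 y0 y1 z -> ccont f z.
Hypothesis f_bound : forall z, rect_edges x0 x1 y0 y1 z -> Cmod (f z) <= B.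

Let J := cauchy_int x0 x1 y0 y1.

(** Differentiation under the integral sign: a second-order remainder of the kernel, uniform over
    the edges, integrates to a quadratic remainder. The instances [n = 1] and [n = 2], with [c = n],
    give one derivative for Cauchy's formula and one more for [cder_derivative]. *)
Lemma cder_cauchy_int (n : nat) (c : C) (w : C) (d E : R) : 0 < d ->
  (forall z, rect_edges x0 x1 y0 y1 z -> d <= Cmod (z - w)) ->
  (forall z v, d <= Cmod (z - w) -> Cmod (v - w) < d / 2 ->
    Cmod ((/ (z - v)) ^ n - (/ (z - w)) ^ n - c * (/ (z - w)) ^ S n * (v - w))
      <= E * Cmod (v - w) ^ 2) ->
  cder (J n f) w (c * J (S n) f w)%C.
Proof.
  intros Hd D K.
  set (S0 := Rabs (x1 - x0) + Rabs (y1 - y0)).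
  apply (cder_of_quadratic _ _ _ (d / 2) (4 * (B * E) * S0)); [lra |].
  intros v Hv; unfold J, cauchy_int.
  assert (Nw : forall z, rect_edges x0 x1 y0 y1 z -> z <> w).
  { intros z Hz ->; specialize (D w Hz).
    replace (w - w)%C with (RtoC 0) in D by ring; rewrite Cmod_0 in D; lra. }
  assert (Nv : forall z, rect_edges x0 x1 y0 y1 z -> z <> v)
    by (intros z Hz ->; specialize (D v Hz); lra).
  set (k := fun z => (f z * (/ (z - v)) ^ n + (- (1)) * (f z * (/ (z - w)) ^ n)
    + (- (c * (v - w))) * (f z * (/ (z - w)) ^ S n))%C).
  assert (C1 : forall z, rect_edges x0 x1 y0 y1 z -> ccont (fun z => f z * (/ (z - v)) ^ n)%C z)
    by (intros; apply ccont_cauchy_kernel; auto).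
  assert (C2 : forall z, rect_edges x0 x1 y0 y1 z -> ccont (fun z => f z * (/ (z - w)) ^ n)%C z)
    by (intros; apply ccont_cauchy_kernel; auto).
  assert (C3 : forall z, rect_edges x0 x1 y0 y1 z -> ccont (fun z => f z * (/ (z - w)) ^ S n)%C z)
    by (intros; apply ccont_cauchy_kernel; auto).
  assert (C2' : forall z, rect_edges x0 x1 y0 y1 z ->
    ccont (fun z => (- (1)) * (f z * (/ (z - w)) ^ n))%C z)
    by (intros; apply ccont_mult; auto; apply ccont_const).
  assert (C3' : forall z, rect_edges x0 x1 y0 y1 z ->
    ccont (fun z => (- (c * (v - w))) * (f z * (/ (z - w)) ^ S n))%C z)
    by (intros; apply ccont_mult; auto; apply ccont_const).
  assert (Ck : forall z, rect_edges x0 x1 y0 y1 z -> ccont k z)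
    by (intros; apply ccont_plus; auto; apply ccont_plus; auto).
  assert (E1 : rect_int k x0 x1 y0 y1 =
    (rect_int (fun z => f z * (/ (z - v)) ^ n) x0 x1 y0 y1 -
     rect_int (fun z => f z * (/ (z - w)) ^ n) x0 x1 y0 y1 -
     c * rect_int (fun z => f z * (/ (z - w)) ^ S n) x0 x1 y0 y1 * (v - w))%C).
  { unfold k; rewrite (rect_int_plus (fun z => f z * (/ (z - v)) ^ n +
      (- (1)) * (f z * (/ (z - w)) ^ n))%C); auto.
    2: { intros; apply ccont_plus; auto. }
    rewrite (rect_int_plus (fun z => f z * (/ (z - v)) ^ n)%C); auto.
    rewrite 2!rect_int_scal; auto; ring. }
  rewrite <- E1.
  assert (U := rect_int_bound k x0 x1 y0 y1 (B * (E * Cmod (v - w) ^ 2)) Ck).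
  fold S0 in U.
  replace (4 * (B * E) * S0 * Cmod (v - w) ^ 2) with (4 * (B * (E * Cmod (v - w) ^ 2)) * S0) by ring.
  apply U; intros z Hz; unfold k.
  replace (f z * (/ (z - v)) ^ n + (- (1)) * (f z * (/ (z - w)) ^ n)
    + (- (c * (v - w))) * (f z * (/ (z - w)) ^ S n))%C with
    (f z * ((/ (z - v)) ^ n - (/ (z - w)) ^ n - c * (/ (z - w)) ^ S n * (v - w)))%C by ring.
  rewrite Cmod_mult; apply Rmult_le_compat; try apply Cmod_ge_0; auto.
Qed.

Lemma kernel_bounds (z v w : C) (d : R) : 0 < d -> d <= Cmod (z - w) -> Cmod (v - w) < d / 2 ->
  (z - w)%C <> 0%C /\ (z - v)%C <> 0%C /\ Cmod (/ (z - w)) <= 2 / d /\ Cmod (/ (z - v)) <= 2 / d.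
Proof.
  intros Hd Hz Hv.
  assert (T : d / 2 <= Cmod (z - v)).
  { assert (H := Cmod_triangle3 z v w); lra. }
  assert (Nw : (z - w)%C <> 0%C) by (apply Cmod_gt_0; lra).
  assert (Nv : (z - v)%C <> 0%C) by (apply Cmod_gt_0; lra).
  rewrite 2!Cmod_inv by auto.
  replace (2 / d) with (/ (d / 2)) by (field; lra).
  repeat split; auto; apply Rinv_le_contravar; lra.
Qed.

Lemma cder_cauchy_int_1 (w : C) : inside x0 x1 y0 y1 w -> cder (J 1 f) w (J 2 f w).
Proof.
  intros Hw; destruct (edge_dist _ _ _ _ _ Hw) as [d [Hd D]].
  apply (cder_eq _ _ (1 * J 2 f w)); [ring |].
  apply (cder_cauchy_int 1 1 w d ((2 / d) ^ 3) Hd D).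
  intros z v Hz Hv; destruct (kernel_bounds z v w d Hd Hz Hv) as [Nw [Nv [B1 B2]]].
  replace ((/ (z - v)) ^ 1 - (/ (z - w)) ^ 1 - 1 * (/ (z - w)) ^ 2 * (v - w))%C
    with ((v - w) ^ 2 * ((/ (z - w)) ^ 2 * / (z - v)))%C by (simpl; field; auto).
  rewrite Cmod_mult, Cmod_pow, Rmult_comm.
  apply Rmult_le_compat_r; [apply pow2_ge_0 |].
  rewrite Cmod_mult, Cmod_pow; simpl.
  assert (P1 := Cmod_ge_0 (/ (z - w))); assert (P2 := Cmod_ge_0 (/ (z - v))).
  set (a := Cmod (/ (z - w))) in *; set (b := Cmod (/ (z - v))) in *; set (m := 2 / d) in *.
  assert (a * a <= m * m) by nra; assert (0 <= a * a) by nra; nra.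
Qed.

Lemma cder_cauchy_int_2 (w : C) : inside x0 x1 y0 y1 w -> cder (J 2 f) w (2 * J 3 f w)%C.
Proof.
  intros Hw; destruct (edge_dist _ _ _ _ _ Hw) as [d [Hd D]].
  apply (cder_cauchy_int 2 2 w d (3 * (2 / d) ^ 4) Hd D).
  intros z v Hz Hv; destruct (kernel_bounds z v w d Hd Hz Hv) as [Nw [Nv [B1 B2]]].
  replace ((/ (z - v)) ^ 2 - (/ (z - w)) ^ 2 - 2 * (/ (z - w)) ^ 3 * (v - w))%C
    with ((v - w) ^ 2 * ((/ (z - w)) ^ 2 * / (z - v) * (/ (z - v) + 2 * / (z - w))))%C
    by (simpl; field; auto).
  rewrite Cmod_mult, Cmod_pow, Rmult_comm.
  apply Rmult_le_compat_r; [apply pow2_ge_0 |].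
  rewrite 2!Cmod_mult, Cmod_pow.
  assert (T := Cmod_triangle (/ (z - v)) (2 * / (z - w))).
  rewrite Cmod_mult, Cmod_R, Rabs_pos_eq in T by lra.
  assert (P1 := Cmod_ge_0 (/ (z - w))); assert (P2 := Cmod_ge_0 (/ (z - v))).
  assert (P3 := Cmod_ge_0 (/ (z - v) + 2 * / (z - w))).
  set (a := Cmod (/ (z - w))) in *; set (b := Cmod (/ (z - v))) in *; set (m := 2 / d) in *.
  set (c := Cmod (/ (z - v) + 2 * / (z - w))) in *.
  simpl.
  assert (c <= 3 * m) by lra; assert (a * a <= m * m) by nra; assert (0 <= a * a) by nra.
  assert (0 <= m) by lra.
  assert (a * a * b <= m * m * m) by nra; assert (0 <= a * a * b) by nra.
  replace (3 * (m * (m * (m * (m * 1))))) with ((m * m * m) * (3 * m)) by ring.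
  replace (a * (a * 1) * b * c) with ((a * a * b) * c) by ring.
  apply Rmult_le_compat; auto.
Qed.

End CauchyIntegral.

Lemma rect_closed (x0 x1 y0 y1 : R) : cclosed (in_rect x0 x1 y0 y1).
Proof.
  intros z Hz.
  assert (X : Re z < Rmin x0 x1 \/ Rmax x0 x1 < Re z \/ Im z < Rmin y0 y1 \/ Rmax y0 y1 < Im z).
  { apply NNPP; intros N; apply Hz; unfold in_rect; split; split; apply Rnot_lt_le; tauto. }
  assert (Y : forall w, Rabs (Re w - Re z) <= Cmod (w - z) /\ Rabs (Im w - Im z) <= Cmod (w - z)).
  { intros w; replace (Re w - Re z) with (Re (w - z)) by reim.
    replace (Im w - Im z) with (Im (w - z)) by reim.
    split; [apply re_le_Cmod | apply im_le_Cmod]. }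
  destruct X as [X | [X | [X | X]]].
  - exists (Rmin x0 x1 - Re z); split; [lra |]; intros w Hw [W1 W2].
    destruct (Y w) as [Y1 Y2]; assert (H := Rle_abs (Re w - Re z)); lra.
  - exists (Re z - Rmax x0 x1); split; [lra |]; intros w Hw [W1 W2].
    destruct (Y w) as [Y1 Y2]; assert (H := Rle_abs (- (Re w - Re z))); rewrite Rabs_Ropp in H; lra.
  - exists (Rmin y0 y1 - Im z); split; [lra |]; intros w Hw [W1 W2].
    destruct (Y w) as [Y1 Y2]; assert (H := Rle_abs (Im w - Im z)); lra.
  - exists (Im z - Rmax y0 y1); split; [lra |]; intros w Hw [W1 W2].
    destruct (Y w) as [Y1 Y2]; assert (H := Rle_abs (- (Im w - Im z))); rewrite Rabs_Ropp in H; lra.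
Qed.

Lemma ccont_bounded_compact (K : C -> Prop) (f : C -> C) (B : R) :
  cclosed K -> (forall z, K z -> Cmod z <= B) -> (forall z, K z -> ccont f z) ->
  exists M, forall z, K z -> Cmod (f z) <= M.
Proof.
  intros Kc Kb Hf.
  destruct (classic (exists z, K z)) as [[z0 H0] | N].
  - destruct (compact_max K (fun z => Cmod (f z)) B z0 H0 Kc Kb) as [p [_ Hp]].
    + intros z m Kz L; destruct (Hf z Kz (m - Cmod (f z))) as [d [Hd D]]; [lra |].
      exists d; split; auto; intros w _ Hw; specialize (D w Hw).
      assert (T := Cmod_triangle_rev (f w) (f z)); lra.
    + exists (Cmod (f p)); auto.
  - exists 0; intros z Kz; exfalso; apply N; exists z; auto.
Qed.

Lemma in_rect_bounded (x0 x1 y0 y1 : R) (z : C) : in_rect x0 x1 y0 y1 z ->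
  Cmod z <= Rabs x0 + Rabs x1 + Rabs y0 + Rabs y1.
Proof.
  intros [H1 H2]; apply Rle_trans with (1 := Cmod_le_re_im z).
  assert (X : forall a b t, Rmin a b <= t <= Rmax a b -> Rabs t <= Rabs a + Rabs b).
  { intros a b t; assert (A1 := Rle_abs a); assert (A2 := Rle_abs (- a)).
    assert (A3 := Rle_abs b); assert (A4 := Rle_abs (- b)); rewrite Rabs_Ropp in A2, A4.
    unfold Rmin, Rmax; destruct (Rle_dec a b); intros Ht; apply Rabs_le; lra. }
  specialize (X _ _ _ H1) as X1; specialize (X _ _ _ H2); lra.
Qed.

Lemma is_cint_imag_pos (g : R -> C) (a b : R) (l : C) : a < b -> is_cint g a b l ->
  (forall t, a <= t <= b -> rcont g t) -> (forall t, a <= t <= b -> 0 < Im (g t)) -> 0 < Im l.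
Proof.
  intros Hab [_ H2] Hc P; rewrite <- (is_RInt_unique _ _ _ _ H2).
  apply RInt_gt_0; auto.
  - intros x Hx; apply P; lra.
  - intros x Hx; apply continuous_of_eps; intros eps He.
    destruct (Hc x ltac:(lra) eps He) as [d [Hd K]]; exists d; split; auto.
    intros t Ht; apply Rle_lt_trans with (2 := K t Ht).
    replace (Im (g t) - Im (g x)) with (Im (g t - g x)) by reim; apply im_le_Cmod.
Qed.

Lemma Re_inv (z : C) : Re (/ z) = Re z / (Re z ^ 2 + Im z ^ 2).
Proof. reflexivity. Qed.

Lemma Im_inv (z : C) : Im (/ z) = - Im z / (Re z ^ 2 + Im z ^ 2).
Proof. reflexivity. Qed.

Lemma sumsq_pos (a b : R) : a <> 0 \/ b <> 0 -> 0 < a ^ 2 + b ^ 2.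
Proof.
  intros [H | H]; assert (A := pow2_gt_0 _ H); [assert (B := pow2_ge_0 b) | assert (B := pow2_ge_0 a)];
    lra.
Qed.

(* The imaginary part of [1/(z-w) dz] is positive along the whole boundary, which replaces
   the evaluation of the integral to [2 pi i]. *)
Lemma cauchy_int_const_neq_0 (x0 x1 y0 y1 : R) (w : C) : inside x0 x1 y0 y1 w ->
  cauchy_int x0 x1 y0 y1 1 (fun _ => 1%C) w <> 0%C.
Proof.
  intros Hw.
  assert (Nw : forall z, rect_edges x0 x1 y0 y1 z -> z <> w).
  { intros z Hz ->; destruct (edge_dist _ _ _ _ _ Hw) as [d [Hd D]]; specialize (D w Hz).
    replace (w - w)%C with (RtoC 0) in D by ring; rewrite Cmod_0 in D; lra. }
  destruct Hw as [Hx Hy].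
  assert (EI : forall a b : R, Im ((a, b) - w) = b - Im w) by (intros; reim).
  assert (ER : forall a b : R, Re ((a, b) - w) = a - Re w) by (intros; reim).
  set (g := fun z => (1 * (/ (z - w)) ^ 1)%C).
  assert (Eg : forall z, g z = (/ (z - w))%C) by (intros; unfold g; simpl; ring).
  assert (Cg : forall z, rect_edges x0 x1 y0 y1 z -> ccont g z)
    by (intros z Hz; apply (ccont_cauchy_kernel (fun _ => 1%C)); [auto | apply ccont_const]).
  destruct (is_cint_edges g _ _ _ _ Cg) as [G1 [G2 [G3 G4]]].
  unfold cauchy_int; fold g; unfold rect_int.
  (* The four edges in turn, with the factors [1], [-1], [i], [-i] coming from orientation and
     [dz]. *)
  assert (P1 : 0 < Im (cint (fun t => g (t, y0)) x0 x1)).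
  { apply is_cint_imag_pos with (2 := G1); [lra | |].
    - intros t Ht; apply ccont_hline, Cg, edge_b; rewrite Rmin_left, Rmax_right; lra.
    - intros t Ht; rewrite Eg, Im_inv; apply Rdiv_lt_0_compat; [rewrite EI; lra |].
      apply sumsq_pos; right; rewrite EI; lra. }
  assert (P2 : 0 < Im (- (1) * cint (fun t => g (t, y1)) x0 x1)).
  { apply is_cint_imag_pos with (2 := is_cint_scal _ _ _ (- (1)) _ G2); [lra | |].
    - intros t Ht; apply (ccont_hline (fun z => - (1) * g z)%C), ccont_mult; [apply ccont_const |].
      apply Cg, edge_t; rewrite Rmin_left, Rmax_right; lra.
    - intros t Ht; rewrite Eg.
      replace (Im (- (1) * / ((t, y1) - w))) with (- Im (/ ((t, y1) - w))) by reim.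
      rewrite Im_inv; replace (- (- Im ((t, y1) - w) / (Re ((t, y1) - w) ^ 2 + Im ((t, y1) - w) ^ 2)))
        with (Im ((t, y1) - w) / (Re ((t, y1) - w) ^ 2 + Im ((t, y1) - w) ^ 2)) by (unfold Rdiv; ring).
      apply Rdiv_lt_0_compat; [rewrite EI; lra | apply sumsq_pos; right; rewrite EI; lra]. }
  assert (P3 : 0 < Im (Ci * cint (fun t => g (x1, t)) y0 y1)).
  { apply is_cint_imag_pos with (2 := is_cint_scal _ _ _ Ci _ G4); [lra | |].
    - intros t Ht; apply (ccont_vline (fun z => Ci * g z)%C), ccont_mult; [apply ccont_const |].
      apply Cg, edge_r; rewrite Rmin_left, Rmax_right; lra.
    - intros t Ht; rewrite Eg.
      replace (Im (Ci * / ((x1, t) - w))) with (Re (/ ((x1, t) - w))) by (unfold Ci; reim).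
      rewrite Re_inv; apply Rdiv_lt_0_compat; [rewrite ER; lra | apply sumsq_pos; left; rewrite ER; lra]. }
  assert (P4 : 0 < Im (- Ci * cint (fun t => g (x0, t)) y0 y1)).
  { apply is_cint_imag_pos with (2 := is_cint_scal _ _ _ (- Ci) _ G3); [lra | |].
    - intros t Ht; apply (ccont_vline (fun z => - Ci * g z)%C), ccont_mult; [apply ccont_const |].
      apply Cg, edge_l; rewrite Rmin_left, Rmax_right; lra.
    - intros t Ht; rewrite Eg.
      replace (Im (- Ci * / ((x0, t) - w))) with (- Re (/ ((x0, t) - w))) by (unfold Ci; reim).
      rewrite Re_inv; replace (- (Re ((x0, t) - w) / (Re ((x0, t) - w) ^ 2 + Im ((x0, t) - w) ^ 2)))
        with ((- Re ((x0, t) - w)) / (Re ((x0, t) - w) ^ 2 + Im ((x0, t) - w) ^ 2)) by (unfold Rdiv; ring).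
      apply Rdiv_lt_0_compat; [rewrite ER; lra | apply sumsq_pos; left; rewrite ER; lra]. }
  intros E; apply (f_equal Im) in E.
  set (a1 := cint _ x0 x1) in *; set (a2 := cint (fun t => g (t, y1)) x0 x1) in *.
  set (a3 := cint (fun t => g (x1, t)) y0 y1) in *; set (a4 := cint (fun t => g (x0, t)) y0 y1) in *.
  replace (a1 - a2 + Ci * (a3 - a4))%C with (a1 + - (1) * a2 + (Ci * a3 + - Ci * a4))%C in E by ring.
  rewrite 3!im_plus in E; change (Im 0%C) with 0 in E; lra.
Qed.

(** The difference quotient of [f] at [w] is continuous there and holomorphic elsewhere, so its
    boundary integral vanishes. The integral of the constant 1 stays unevaluated: that it is nonzero
    is enough to divide by it. *)
Lemma cauchy_formula (f : C -> C) (x0 x1 y0 y1 : R) (w : C) : inside x0 x1 y0 y1 w ->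
  (forall z, in_rect x0 x1 y0 y1 z -> exists l, cder f z l) ->
  cauchy_int x0 x1 y0 y1 1 f w = (f w * cauchy_int x0 x1 y0 y1 1 (fun _ => 1) w)%C.
Proof.
  intros Hw Hf.
  assert (Nw : forall z, rect_edges x0 x1 y0 y1 z -> z <> w).
  { intros z Hz ->; destruct (edge_dist _ _ _ _ _ Hw) as [d [Hd D]]; specialize (D w Hz).
    replace (w - w)%C with (RtoC 0) in D by ring; rewrite Cmod_0 in D; lra. }
  assert (Iw : in_rect x0 x1 y0 y1 w).
  { destruct Hw; unfold in_rect; rewrite 2!Rmin_left, 2!Rmax_right; lra. }
  assert (Cf : forall z, in_rect x0 x1 y0 y1 z -> ccont f z)
    by (intros z Hz; destruct (Hf z Hz) as [l Hl]; exact (cder_ccont f z l Hl)).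
  destruct (Hf w Iw) as [l Hl].
  assert (Dq : forall z, in_rect x0 x1 y0 y1 z -> z <> w -> exists m, cder (slope f w l) z m).
  { intros z Hz N; destruct (Hf z Hz) as [m Hm].
    eexists; apply (cder_ext_loc (fun v => (f v - f w) / (v - w))%C _ z _ (Cmod (z - w))).
    - apply Cmod_sub_gt0; auto.
    - intros v Hv; unfold slope; destruct (Ceq_dec v w) as [-> |]; auto.
      rewrite Cmod_sub_sym in Hv; lra.
    - apply cder_div.
      + apply cder_minus; [exact Hm | apply cder_const].
      + apply cder_minus; [apply cder_id | apply cder_const].
      + apply Csub_neq; auto. }
  assert (G := goursat_exceptional (slope f w l) w x0 x1 y0 y1 Iw).
  assert (G0 : rect_int (slope f w l) x0 x1 y0 y1 = 0%C).
  { apply G; auto; intros z Hz; destruct (Ceq_dec z w) as [-> | N]; auto.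
    destruct (Dq z Hz N) as [m Hm]; exact (cder_ccont _ _ _ Hm). }
  assert (C1 : forall z, rect_edges x0 x1 y0 y1 z -> ccont (fun z => f z * (/ (z - w)) ^ 1)%C z)
    by (intros z Hz; apply ccont_cauchy_kernel; auto; apply Cf, Hz).
  assert (C2 : forall z, rect_edges x0 x1 y0 y1 z -> ccont (fun z => 1 * (/ (z - w)) ^ 1)%C z)
    by (intros z Hz; apply (ccont_cauchy_kernel (fun _ => 1%C)); auto; apply ccont_const).
  rewrite (rect_int_ext _ (fun z => f z * (/ (z - w)) ^ 1 + (- f w) * (1 * (/ (z - w)) ^ 1))%C) in G0.
  2: { intros z Hz; unfold slope; destruct (Ceq_dec z w) as [E | _]; [exfalso; apply (Nw z Hz E) |].
       simpl; field; apply Csub_neq; auto. }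
  rewrite rect_int_plus, rect_int_scal in G0; auto.
  2: { intros; apply ccont_mult; auto; apply ccont_const. }
  unfold cauchy_int.
  set (I1 := rect_int (fun z => f z * _)%C x0 x1 y0 y1) in *.
  set (I2 := rect_int (fun z => 1 * _)%C x0 x1 y0 y1) in *.
  replace I1 with (I1 + - f w * I2 + f w * I2)%C by ring; rewrite G0; ring.
Qed.

(** Near [z0], [f] is the quotient of its Cauchy integral by that of 1, both twice differentiable.
    The derivative of the quotient equals [f'] by uniqueness, and the formula for it can be
    differentiated once more. *)
Lemma cder_derivative (f f' : C -> C) (z0 : C) (r : R) : 0 < r ->
  (forall z, Cmod (z - z0) < r -> cder f z (f' z)) -> exists l, cder f' z0 l.
Proof.
  intros Hr D.
  (* A square of half side [r / 3] lies in the disc, since the modulus is at most the sum of the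
     components. *)
  set (a := r / 3).
  set (x0 := Re z0 - a); set (x1 := Re z0 + a); set (y0 := Im z0 - a); set (y1 := Im z0 + a).
  assert (Rect : forall z, in_rect x0 x1 y0 y1 z -> Cmod (z - z0) < r).
  { intros z [H1 H2]; unfold x0, x1, y0, y1, a in *.
    rewrite Rmin_left, Rmax_right in H1, H2 by lra.
    apply Rle_lt_trans with (1 := Cmod_le_re_im _).
    replace (Re (z - z0)) with (Re z - Re z0) by reim.
    replace (Im (z - z0)) with (Im z - Im z0) by reim.
    apply Rle_lt_trans with (r / 3 + r / 3); [apply Rplus_le_compat; apply Rabs_le; lra | lra]. }
  assert (Ins : forall w, Cmod (w - z0) < a -> inside x0 x1 y0 y1 w).
  { intros w Hw.
    assert (R1 := Rle_lt_trans _ _ _ (re_le_Cmod (w - z0)) Hw).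
    assert (R2 := Rle_lt_trans _ _ _ (im_le_Cmod (w - z0)) Hw).
    replace (Re (w - z0)) with (Re w - Re z0) in R1 by reim.
    replace (Im (w - z0)) with (Im w - Im z0) in R2 by reim.
    apply Rabs_lt_between in R1; apply Rabs_lt_between in R2.
    unfold inside, x0, x1, y0, y1; lra. }
  assert (Hf : forall z, in_rect x0 x1 y0 y1 z -> exists l, cder f z l)
    by (intros z Hz; exists (f' z); apply D, Rect, Hz).
  assert (Cf : forall z, in_rect x0 x1 y0 y1 z -> ccont f z)
    by (intros z Hz; apply (cder_ccont f z (f' z)), D, Rect, Hz).
  destruct (ccont_bounded_compact (in_rect x0 x1 y0 y1) f _ (rect_closed _ _ _ _)
    (in_rect_bounded x0 x1 y0 y1) Cf) as [B HB].
  set (J := cauchy_int x0 x1 y0 y1); set (one := fun _ : C => RtoC 1).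
  assert (Ce : forall z, rect_edges x0 x1 y0 y1 z -> ccont f z) by (intros z Hz; apply Cf, Hz).
  assert (Be : forall z, rect_edges x0 x1 y0 y1 z -> Cmod (f z) <= B) by (intros z Hz; apply HB, Hz).
  assert (C1 : forall z, rect_edges x0 x1 y0 y1 z -> ccont one z) by (intros; apply ccont_const).
  assert (B1 : forall z, rect_edges x0 x1 y0 y1 z -> Cmod (one z) <= 1)
    by (intros; unfold one; rewrite Cmod_1; lra).
  assert (N : forall w, Cmod (w - z0) < a -> J 1%nat one w <> 0%C)
    by (intros w Hw; apply cauchy_int_const_neq_0; auto).
  assert (Q : forall w, Cmod (w - z0) < a -> cder (fun w => J 1%nat f w / J 1%nat one w)%C w
    ((J 2%nat f w * J 1%nat one w - J 1%nat f w * J 2%nat one w) / (J 1%nat one w * J 1%nat one w))%C).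
  { intros w Hw; apply cder_div; auto.
    - apply (cder_cauchy_int_1 _ _ _ _ f B Ce Be w); auto.
    - apply (cder_cauchy_int_1 _ _ _ _ one 1 C1 B1 w); auto. }
  assert (Pa : 0 < a) by (unfold a; lra).
  assert (E : forall w, Cmod (w - z0) < a ->
    ((J 2%nat f w * J 1%nat one w - J 1%nat f w * J 2%nat one w) / (J 1%nat one w * J 1%nat one w))%C
    = f' w).
  { intros w Hw; apply (cder_unique f w); [| apply D; unfold a in Hw; lra].
    apply (cder_ext_loc (fun w => J 1%nat f w / J 1%nat one w)%C f w _ (a - Cmod (w - z0))); [lra | | auto].
    intros v Hv.
    assert (Hv' : Cmod (v - z0) < a) by (assert (T := Cmod_triangle3 v w z0); lra).
    unfold J; rewrite (cauchy_formula f x0 x1 y0 y1 v (Ins v Hv') Hf); fold J; fold one.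
    field; apply N; auto. }
  assert (Z : Cmod (z0 - z0) < a) by (replace (z0 - z0)%C with (RtoC 0) by ring; rewrite Cmod_0; auto).
  eexists; apply (cder_ext_loc _ f' z0 _ a Pa E).
  apply cder_div; [apply cder_minus; apply cder_mult | apply cder_mult | apply Cmult_neq_0; auto].
  - apply (cder_cauchy_int_2 _ _ _ _ f B Ce Be z0); auto.
  - apply (cder_cauchy_int_1 _ _ _ _ one 1 C1 B1 z0); auto.
  - apply (cder_cauchy_int_1 _ _ _ _ f B Ce Be z0); auto.
  - apply (cder_cauchy_int_2 _ _ _ _ one 1 C1 B1 z0); auto.
  - apply (cder_cauchy_int_1 _ _ _ _ one 1 C1 B1 z0); auto.
  - apply (cder_cauchy_int_1 _ _ _ _ one 1 C1 B1 z0); auto.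
Qed.

(** * Maximum principle and its consequences *)

Lemma Cmod_sub_self (z : C) : Cmod (z - z) = 0.
Proof. replace (z - z)%C with (RtoC 0) by ring; apply Cmod_0. Qed.

(** A total function, so that it can appear in formulas for the logarithmic derivative; its value is
    arbitrary where [f] has no derivative. *)
Definition Cder (f : C -> C) (z : C) : C := epsilon (inhabits (RtoC 0)) (fun l => cder f z l).

Lemma Cder_correct (f : C -> C) (z : C) : (exists l, cder f z l) -> cder f z (Cder f z).
Proof. intros H; exact (epsilon_spec (inhabits (RtoC 0)) (fun l => cder f z l) H). Qed.

Lemma Cder_unique (f : C -> C) (z l : C) : cder f z l -> Cder f z = l.
Proof. intros H; apply (cder_unique f z); auto; apply Cder_correct; exists l; auto. Qed.

Definition holo_on (D : C -> Prop) (f : C -> C) : Prop := forall z, D z -> exists l, cder f z l.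

(** Mean value inequality for [k] minus its quadratic polynomial, whose derivative is the
    first-order remainder of [k'], at most [eps |w - p|]. *)
Lemma taylor2 (k k' : C -> C) (p k2 : C) (r : R) : 0 < r ->
  (forall z, Cmod (z - p) < r -> cder k z (k' z)) -> cder k' p k2 ->
  forall eps, 0 < eps -> exists d, 0 < d /\ forall w, Cmod (w - p) < d ->
    Cmod (k w - k p - k' p * (w - p) - k2 / 2 * (w - p) ^ 2) <= eps * Cmod (w - p) ^ 2.
Proof.
  intros Hr D D2 eps He.
  destruct (cder_eps k' p k2 D2 eps He) as [d [Hd K]].
  exists (Rmin r d); split; [apply Rmin_glb_lt; auto |]; intros w Hw.
  set (E := fun z => (k z - k' p * (z - p) - k2 / 2 * ((z - p) * (z - p)))%C).
  replace (k w - k p - k' p * (w - p) - k2 / 2 * (w - p) ^ 2)%C with (E w - E p)%C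
    by (unfold E; simpl; ring).
  replace (eps * Cmod (w - p) ^ 2) with (eps * Cmod (w - p) * Cmod (w - p)) by ring.
  assert (Seg : forall t, 0 <= t <= 1 -> Cmod (p + RtoC t * (w - p) - p) <= Cmod (w - p)).
  { intros t Ht; replace (p + RtoC t * (w - p) - p)%C with (RtoC t * (w - p))%C by ring.
    rewrite Cmod_mult, Cmod_R, Rabs_pos_eq by lra.
    assert (H := Cmod_ge_0 (w - p)); nra. }
  apply (mean_value_segment E (fun z => k' z - k' p - k2 * (z - p))%C).
  - intros t Ht; specialize (Seg t Ht).
    assert (W := Rle_lt_trans _ _ _ Seg (Rlt_le_trans _ _ _ Hw (Rmin_l _ _))).
    set (z := (p + RtoC t * (w - p))%C) in *.
    assert (Di : cder (fun z => z - p)%C z (1 - 0)%C)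
      by (apply cder_minus; [apply cder_id | apply cder_const]).
    eapply cder_eq.
    2: { apply cder_minus; [apply cder_minus; [apply D, W | apply cder_scal, Di] |
         apply cder_scal, cder_mult; exact Di]. }
    cbv beta; field.
  - intros t Ht; specialize (Seg t Ht).
    assert (W := Rle_lt_trans _ _ _ Seg (Rlt_le_trans _ _ _ Hw (Rmin_r _ _))).
    apply Rle_trans with (1 := K _ W); apply Rmult_le_compat_l; lra.
Qed.

(** Subharmonicity at [p] without integral means: the real part of a holomorphic function touches
    [u] from below at [p]. For [|f|] and for [|f|^(1/2)] such a function is obtained by a
    rotation. *)
Definition holo_support (u : C -> R) (p : C) : Prop :=
  exists k r, 0 < r /\ holo_on (fun z => Cmod (z - p) < r) k /\ Re (k p) = u p /\
    forall z, Cmod (z - p) < r -> Re (k z) <= u z.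

Lemma Cmod_sq (z : C) : Cmod z ^ 2 = Re z ^ 2 + Im z ^ 2.
Proof. apply Cmod2_alt. Qed.

(* At a maximum of [u + e |z|^2] the four-point average of the supporting holomorphic function
   is [o(t^2)], whereas the one of [e |z|^2] grows by [e t^2]. *)
Lemma max_principle (K : C -> Prop) (u : C -> R) (B m : R) :
  cclosed K -> (forall z, K z -> Cmod z <= B) ->
  (forall z eps, K z -> 0 < eps -> exists d, 0 < d /\
    forall w, K w -> Cmod (w - z) < d -> u w < u z + eps) ->
  (forall z, K z -> m < u z ->
    (exists r, 0 < r /\ forall w, Cmod (w - z) < r -> K w) /\ holo_support u z) ->
  forall z, K z -> u z <= m.
Proof.
  intros Kc Kb Hu Sup z1 K1; apply Rnot_lt_le; intros L.
  (* Small enough that adding [e |z|^2], at most [e B^2 < u z1 - m], still forces [u > m] at the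
     maximum. *)
  set (e := (u z1 - m) / (2 * (B ^ 2 + 1))).
  assert (PB := pow2_ge_0 B).
  assert (Pe : 0 < e) by (apply Rdiv_lt_0_compat; lra).
  assert (EB : e * B ^ 2 < u z1 - m).
  { apply Rlt_le_trans with (e * (2 * (B ^ 2 + 1))); [nra | right; unfold e; field; lra]. }
  destruct (compact_max K (fun z => u z + e * Cmod z ^ 2) B z1 K1 Kc Kb) as [p [Kp Hp]].
  { intros z c Kz Hz.
    set (g := c - (u z + e * Cmod z ^ 2)).
    destruct (Hu z (g / 2) Kz) as [d [Hd D]]; [unfold g; lra |].
    assert (PZ := Cmod_ge_0 z).
    set (b := g / 2 / (e * (2 * Cmod z + 1))).
    assert (Pq : 0 < e * (2 * Cmod z + 1)) by (apply Rmult_lt_0_compat; lra).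
    assert (Pb : 0 < b) by (apply Rdiv_lt_0_compat; [unfold g; lra | auto]).
    exists (Rmin d (Rmin 1 b)); split; [repeat apply Rmin_glb_lt; lra |].
    intros w Kw Hw.
    assert (W0 := Rlt_le_trans _ _ _ Hw (Rmin_l _ _)).
    assert (W1 := Rlt_le_trans _ _ _ (Rlt_le_trans _ _ _ Hw (Rmin_r _ _)) (Rmin_l _ _)).
    assert (W2 := Rlt_le_trans _ _ _ (Rlt_le_trans _ _ _ Hw (Rmin_r _ _)) (Rmin_r _ _)).
    specialize (D w Kw W0).
    assert (T := Cmod_triangle_rev w z); assert (PW := Cmod_ge_0 (w - z)); assert (PW' := Cmod_ge_0 w).
    assert (Q : Cmod w ^ 2 <= Cmod z ^ 2 + (2 * Cmod z + 1) * Cmod (w - z)).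
    { assert (Cmod w <= Cmod z + Cmod (w - z)) by lra.
      assert (Cmod w ^ 2 <= (Cmod z + Cmod (w - z)) ^ 2) by (apply pow_incr; lra).
      nra. }
    assert (Q2 : e * (2 * Cmod z + 1) * Cmod (w - z) < g / 2).
    { apply Rlt_le_trans with (e * (2 * Cmod z + 1) * b).
      - apply Rmult_lt_compat_l; auto.
      - right; unfold b; field; lra. }
    assert (Q3 := Rmult_le_compat_l e _ _ (Rlt_le _ _ Pe) Q).
    unfold g in *; lra. }
  assert (Up : m < u p).
  { assert (H := Hp z1 K1); assert (Bp := Kb p Kp); assert (P0 := Cmod_ge_0 p).
    assert (P1 := pow2_ge_0 (Cmod z1)).
    assert (Cmod p ^ 2 <= B ^ 2) by (apply pow_incr; lra).
    nra. }
  destruct (Sup p Kp Up) as [[r0 [Hr0 In]] [k [r [Hr [Hk [Ek Uk]]]]]].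
  assert (Dk : forall z, Cmod (z - p) < r -> cder k z (Cder k z))
    by (intros z Hz; apply Cder_correct, Hk, Hz).
  destruct (cder_derivative k (Cder k) p r Hr Dk) as [k2 Hk2].
  destruct (taylor2 k (Cder k) p k2 r Hr Dk Hk2 (e / 2)) as [d [Hd T]]; [lra |].
  set (t := Rmin r0 (Rmin r d) / 2).
  assert (Pt : 0 < Rmin r0 (Rmin r d)) by (repeat apply Rmin_glb_lt; auto).
  assert (T0 : t < r0) by (assert (H := Rmin_l r0 (Rmin r d)); unfold t; lra).
  assert (T1 : t < Rmin r d) by (assert (H := Rmin_r r0 (Rmin r d)); unfold t; lra).
  assert (T2 := Rlt_le_trans _ _ _ T1 (Rmin_l _ _)); assert (T3 := Rlt_le_trans _ _ _ T1 (Rmin_r _ _)).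
  assert (Pt' : 0 < t) by (unfold t; lra).
  assert (Dir : forall v, Cmod v = 1 ->
    Re (k p + Cder k p * (RtoC t * v) + k2 / 2 * (RtoC t * v) ^ 2)
      - e / 2 * t ^ 2 + e * Cmod (p + RtoC t * v) ^ 2 <= u p + e * Cmod p ^ 2).
  { intros v Hv.
    assert (Ev : (p + RtoC t * v - p)%C = (RtoC t * v)%C) by ring.
    assert (Mv : Cmod (p + RtoC t * v - p) = t)
      by (rewrite Ev, Cmod_mult, Cmod_R, Hv, Rabs_pos_eq; lra).
    specialize (T (p + RtoC t * v)%C); rewrite Mv in T; specialize (T T3); rewrite Ev in T.
    assert (H1 := Uk (p + RtoC t * v)%C); rewrite Mv in H1; specialize (H1 T2).
    assert (H2 := In (p + RtoC t * v)%C); rewrite Mv in H2; specialize (H2 T0).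
    assert (H3 := Hp _ H2).
    assert (H4 := Rle_trans _ _ _ (re_le_Cmod _) T).
    apply Rabs_le_between in H4.
    replace (Re (k (p + t * v)%C - k p - Cder k p * (t * v) - k2 / 2 * (t * v) ^ 2))
      with (Re (k (p + t * v)%C) - Re (k p + Cder k p * (t * v) + k2 / 2 * (t * v) ^ 2)) in H4
      by (generalize (k2 / 2 * (t * v) ^ 2)%C; intros; reim).
    lra. }
  assert (D1 := Dir 1%C Cmod_1); assert (D2 := Dir (- (1))%C Cmod_m1).
  assert (D3 := Dir Ci Cmod_Ci).
  assert (D4 : Cmod (- Ci) = 1) by (rewrite Cmod_opp; apply Cmod_Ci).
  apply Dir in D4.
  (* Over the directions [1, -1, i, -i] the linear terms cancel, and so do the quadratic ones,
     because the squares of the directions add up to 0. *)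
  assert (S1 : Re (k p + Cder k p * (t * 1) + k2 / 2 * (t * 1) ^ 2) +
    Re (k p + Cder k p * (t * (- (1))) + k2 / 2 * (t * (- (1))) ^ 2) +
    Re (k p + Cder k p * (t * Ci) + k2 / 2 * (t * Ci) ^ 2) +
    Re (k p + Cder k p * (t * (- Ci)) + k2 / 2 * (t * (- Ci)) ^ 2) = 4 * u p).
  { rewrite <- Ek, <- 3!re_plus.
    assert (C2 : ((RtoC t * Ci) ^ 2 = - (RtoC t * RtoC t))%C) by (apply Ceq; unfold Ci, Cpow; reim).
    assert (C3 : ((RtoC t * - Ci) ^ 2 = - (RtoC t * RtoC t))%C) by (apply Ceq; unfold Ci, Cpow; reim).
    rewrite C2, C3.
    replace (4 * Re (k p)) with (Re (RtoC 4 * k p)) by reim.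
    f_equal; simpl; ring. }
  assert (S2 : Cmod (p + t * 1) ^ 2 + Cmod (p + t * (- (1))) ^ 2 + Cmod (p + t * Ci) ^ 2 +
    Cmod (p + t * (- Ci)) ^ 2 = 4 * Cmod p ^ 2 + 4 * t ^ 2).
  { rewrite !Cmod_sq; unfold Ci; reim. }
  assert (S3 := f_equal (Rmult e) S2).
  assert (0 < e * t ^ 2) by (apply Rmult_lt_0_compat; auto; apply pow_lt; auto).
  lra.
Qed.

(** * Maximum modulus, Schwarz's lemma, Cauchy estimates and the identity theorem *)

Lemma disc_closed (c : C) (R : R) : cclosed (fun z => Cmod (z - c) <= R).
Proof.
  intros z Hz; exists (Cmod (z - c) - R); split; [lra |]; intros w Hw Kw.
  assert (T := Cmod_triangle3 z w c); rewrite (Cmod_sub_sym z w) in T; lra.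
Qed.

Lemma disc_bounded (c z : C) (R : R) : Cmod (z - c) <= R -> Cmod z <= R + Cmod c.
Proof. assert (T := Cmod_triangle_rev z c); lra. Qed.

Lemma holo_on_subset (D E : C -> Prop) (f : C -> C) :
  (forall z, E z -> D z) -> holo_on D f -> holo_on E f.
Proof. intros S H z Hz; apply H, S, Hz. Qed.

Lemma holo_on_ccont (D : C -> Prop) (f : C -> C) (z : C) : holo_on D f -> D z -> ccont f z.
Proof. intros H Hz; destruct (H z Hz) as [l Hl]; exact (cder_ccont f z l Hl). Qed.

(** Where [|f z| > M >= 0], the rotation [a] of modulus 1 with [a f z = |f z|] makes [a f] a support
    for [|f|] at [z]. *)
Lemma max_modulus (f : C -> C) (c : C) (R M : R) : 0 < R ->
  holo_on (fun z => Cmod (z - c) <= R) f ->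
  (forall z, Cmod (z - c) = R -> Cmod (f z) <= M) ->
  forall z, Cmod (z - c) <= R -> Cmod (f z) <= M.
Proof.
  intros HR Hf HM.
  assert (PM : 0 <= M).
  { apply Rle_trans with (1 := Cmod_ge_0 (f (c + R)%C)), HM.
    replace (c + R - c)%C with (RtoC R) by ring; rewrite Cmod_R, Rabs_pos_eq; lra. }
  apply (max_principle _ (fun z => Cmod (f z)) (R + Cmod c)); [apply disc_closed | | |].
  - intros z; apply disc_bounded.
  - intros z eps Kz He; destruct (holo_on_ccont _ f z Hf Kz eps He) as [d [Hd D]].
    exists d; split; auto; intros w _ Hw; specialize (D w Hw).
    assert (T := Cmod_triangle_rev (f w) (f z)); lra.
  - intros z Kz L.
    assert (N : Cmod (z - c) <> R) by (intros E; specialize (HM z E); lra).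
    assert (In : forall w, Cmod (w - z) < R - Cmod (z - c) -> Cmod (w - c) <= R)
      by (intros w Hw; assert (T := Cmod_triangle3 w z c); lra).
    split; [exists (R - Cmod (z - c)); split; [lra | auto] |].
    set (a := (Cconj (f z) / RtoC (Cmod (f z)))%C).
    assert (Na : RtoC (Cmod (f z)) <> 0%C) by (apply RtoC_neq; lra).
    assert (Ma : Cmod a = 1).
    { unfold a; rewrite Cmod_div, Cmod_conj, Cmod_R, Rabs_pos_eq by (auto; apply Cmod_ge_0).
      field; lra. }
    exists (fun w => a * f w)%C, (R - Cmod (z - c)); split; [lra |]; split; [| split].
    + intros w Hw; destruct (Hf w (In w Hw)) as [l Hl].
      exists (a * l)%C; apply cder_scal; auto.
    + replace (a * f z)%C with (RtoC (Cmod (f z))); [reflexivity |].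
      unfold a; replace (Cconj (f z) / RtoC (Cmod (f z)) * f z)%C
        with (f z * Cconj (f z) / RtoC (Cmod (f z)))%C by (unfold Cdiv; ring).
      rewrite <- Cmod2_conj, RtoC_pow; field; auto.
    + intros w _; apply Rle_trans with (1 := Rle_abs _), Rle_trans with (1 := re_le_Cmod _).
      rewrite Cmod_mult, Ma; lra.
Qed.

(** Removable singularity: the second-order expansion of [f] shows that the difference quotient has
    derivative [f''(p) / 2] at [p]. *)
Lemma holo_slope (D : C -> Prop) (f : C -> C) (p : C) (r : R) : 0 < r ->
  (forall z, Cmod (z - p) < r -> D z) -> holo_on D f -> holo_on D (slope f p (Cder f p)).
Proof.
  intros Hr In Hf z Hz; destruct (Ceq_dec z p) as [-> | N].
  - assert (Df : forall z, Cmod (z - p) < r -> cder f z (Cder f z))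
      by (intros w Hw; apply Cder_correct, Hf, In, Hw).
    destruct (cder_derivative f (Cder f) p r Hr Df) as [k2 Hk2].
    exists (k2 / 2)%C; apply cder_of_eps; intros eps He.
    destruct (taylor2 f (Cder f) p k2 r Hr Df Hk2 eps He) as [d [Hd T]].
    exists d; split; auto; intros w Hw; specialize (T w Hw).
    rewrite slope_self; unfold slope; destruct (Ceq_dec w p) as [-> | N].
    + replace (Cder f p - Cder f p - k2 / 2 * (p - p))%C with (RtoC 0) by ring.
      rewrite Cmod_0, Cmod_sub_self; lra.
    + assert (P := Cmod_sub_gt0 w p N).
      replace ((f w - f p) / (w - p) - Cder f p - k2 / 2 * (w - p))%C with
        ((f w - f p - Cder f p * (w - p) - k2 / 2 * (w - p) ^ 2) / (w - p))%C
        by (simpl; field; apply Csub_neq, N).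
      rewrite Cmod_div by (apply Csub_neq, N).
      apply Rle_div_l; auto.
      replace (eps * Cmod (w - p) * Cmod (w - p)) with (eps * Cmod (w - p) ^ 2) by ring; exact T.
  - destruct (Hf z Hz) as [m Hm].
    eexists; apply (cder_ext_loc (fun v => (f v - f p) / (v - p))%C _ z _ (Cmod (z - p))).
    + apply Cmod_sub_gt0; auto.
    + intros v Hv; unfold slope; destruct (Ceq_dec v p) as [-> |]; auto.
      rewrite Cmod_sub_sym in Hv; lra.
    + apply cder_div.
      * apply cder_minus; [exact Hm | apply cder_const].
      * apply cder_minus; [apply cder_id | apply cder_const].
      * apply Csub_neq; auto.
Qed.

(** Common source of the Cauchy estimate, read at [p], and of Schwarz's lemma, read elsewhere. *)
Lemma slope_bound (f : C -> C) (p : C) (r M : R) : 0 < r ->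
  holo_on (fun z => Cmod (z - p) <= r) f ->
  (forall z, Cmod (z - p) = r -> Cmod (f z - f p) <= M) ->
  forall z, Cmod (z - p) <= r -> Cmod (slope f p (Cder f p) z) <= M / r.
Proof.
  intros Hr Hf HM; apply max_modulus; auto.
  - apply (holo_slope _ f p r); auto; intros; lra.
  - intros z Hz; unfold slope; destruct (Ceq_dec z p) as [-> | N].
    + rewrite Cmod_sub_self in Hz; lra.
    + rewrite Cmod_div, Hz by (apply Csub_neq, N).
      apply Rmult_le_compat_r; [left; apply Rinv_0_lt_compat; auto | auto].
Qed.

Lemma cauchy_estimate (f : C -> C) (p : C) (r M : R) : 0 < r ->
  holo_on (fun z => Cmod (z - p) <= r) f ->
  (forall z, Cmod (z - p) = r -> Cmod (f z - f p) <= M) -> Cmod (Cder f p) <= M / r.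
Proof.
  intros Hr Hf HM; rewrite <- (slope_self f p (Cder f p)).
  apply (slope_bound f p r M Hr Hf HM); rewrite Cmod_sub_self; lra.
Qed.

Lemma schwarz (f : C -> C) (p : C) (r M : R) : 0 < r ->
  holo_on (fun z => Cmod (z - p) <= r) f ->
  (forall z, Cmod (z - p) = r -> Cmod (f z - f p) <= M) ->
  forall z, Cmod (z - p) <= r -> Cmod (f z - f p) <= M / r * Cmod (z - p).
Proof.
  intros Hr Hf HM z Hz; rewrite (slope_eq f p (Cder f p)), Cmod_mult.
  apply Rmult_le_compat_r; [apply Cmod_ge_0 | apply slope_bound; auto].
Qed.

(** Schwarz's lemma for the difference quotient, which is at most [2 M / r] and hence varies by at
    most [4 M / r]. *)
Lemma taylor1_bound (f : C -> C) (p : C) (r M : R) : 0 < r ->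
  holo_on (fun z => Cmod (z - p) <= r) f ->
  (forall z, Cmod (z - p) <= r -> Cmod (f z) <= M) ->
  forall z, Cmod (z - p) <= r ->
    Cmod (f z - f p - Cder f p * (z - p)) <= 4 * M / r ^ 2 * Cmod (z - p) ^ 2.
Proof.
  intros Hr Hf HM z Hz; set (q := slope f p (Cder f p)).
  assert (Hq : holo_on (fun z => Cmod (z - p) <= r) q)
    by (apply (holo_slope _ f p r); auto; intros; lra).
  assert (Z0 : Cmod (p - p) <= r) by (rewrite Cmod_sub_self; lra).
  assert (Bq : forall z, Cmod (z - p) <= r -> Cmod (q z) <= 2 * M / r).
  { apply slope_bound; auto; intros w Hw.
    apply Rle_trans with (1 := Cmod_triangle_sub _ _).
    assert (H1 := HM w ltac:(lra)); assert (H2 := HM p Z0); lra. }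
  assert (S := schwarz q p r (4 * M / r) Hr Hq).
  replace (f z - f p - Cder f p * (z - p))%C with ((q z - q p) * (z - p))%C.
  2: { unfold q; rewrite slope_self.
       rewrite (slope_eq f p (Cder f p) z); ring. }
  rewrite Cmod_mult.
  replace (4 * M / r ^ 2 * Cmod (z - p) ^ 2)
    with (4 * M / r / r * Cmod (z - p) * Cmod (z - p)) by (field; lra).
  apply Rmult_le_compat_r; [apply Cmod_ge_0 |]; apply S; auto.
  intros w Hw; apply Rle_trans with (1 := Cmod_triangle_sub _ _).
  assert (H1 := Bq w ltac:(lra)); assert (H2 := Bq p Z0).
  replace (4 * M / r) with (2 * M / r + 2 * M / r) by (field; lra); lra.
Qed.

Lemma cder_pow (f : C -> C) (z : C) (n : nat) :
  (exists l, cder f z l) -> exists l, cder (fun w => f w ^ n)%C z l.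
Proof.
  intros [l Hl]; induction n as [| n [m IH]].
  - exists (RtoC 0); simpl; apply cder_const.
  - eexists; simpl; apply cder_mult; [exact Hl | exact IH].
Qed.

(* [f z / (z-c)^n] is still holomorphic, so [|f z| <= M (|z-c| / R)^n] for every [n]. *)
Lemma identity_disc (f : C -> C) (c : C) (r R : R) : 0 < r -> 0 < R ->
  holo_on (fun z => Cmod (z - c) <= R) f -> (forall z, Cmod (z - c) < r -> f z = 0%C) ->
  forall z, Cmod (z - c) < R -> f z = 0%C.
Proof.
  intros Hr HR Hf H0 z Hz.
  destruct (ccont_bounded_compact (fun z => Cmod (z - c) <= R) f (R + Cmod c)) as [M HM].
  { apply disc_closed. }
  { intros w; apply disc_bounded. }
  { intros w Hw; apply (holo_on_ccont _ f w Hf Hw). }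
  destruct (Ceq_dec z c) as [-> | N]; [apply H0; rewrite Cmod_sub_self; auto |].
  assert (Pz := Cmod_sub_gt0 z c N).
  assert (B : forall n, Cmod (f z) <= M * (Cmod (z - c) / R) ^ n).
  { intros n.
    assert (U := max_modulus (fun w => f w * (/ (w - c)) ^ n)%C c R (M * / R ^ n) HR).
    assert (Pn : 0 < R ^ n) by (apply pow_lt; auto).
    assert (V : Cmod (f z * (/ (z - c)) ^ n) <= M * / R ^ n).
    { apply U; [| | lra].
      - intros w Hw; destruct (Ceq_dec w c) as [-> | Nw].
        (* Near [c] the product vanishes because [f] does, whatever value the inverse takes at
           [c]. *)
        + exists (RtoC 0); apply (cder_ext_loc (fun _ => RtoC 0) _ c _ r Hr); [| apply cder_const].
          intros v Hv; rewrite H0 by auto; ring.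
        + destruct (Hf w Hw) as [l Hl].
          destruct (cder_pow (fun w => / (w - c))%C w n) as [m Hm].
          { eexists; apply (cder_inv (fun w => w - c)%C); [| apply Csub_neq, Nw].
            apply cder_minus; [apply cder_id | apply cder_const]. }
          eexists; apply cder_mult; [exact Hl | exact Hm].
      - intros w Hw.
        assert (Nw : (w - c)%C <> 0%C) by (apply Cmod_gt_0; lra).
        rewrite Cmod_mult, Cmod_pow, Cmod_inv, Hw, pow_inv by auto.
        apply Rmult_le_compat_r; [left; apply Rinv_0_lt_compat; auto | apply HM; lra]. }
    rewrite Cmod_mult, Cmod_pow, Cmod_inv, pow_inv in V by (apply Csub_neq, N).
    assert (Pm : 0 < Cmod (z - c) ^ n) by (apply pow_lt; auto).
    unfold Rdiv; rewrite Rpow_mult_distr, pow_inv.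
    apply Rmult_le_compat_r with (r := Cmod (z - c) ^ n) in V; [| lra].
    replace (Cmod (f z) * / Cmod (z - c) ^ n * Cmod (z - c) ^ n) with (Cmod (f z)) in V
      by (field; lra).
    lra. }
  apply Cmod_eq_0; apply Rle_antisym; [| apply Cmod_ge_0].
  apply Rnot_lt_le; intros P.
  assert (PM : 0 < M) by (specialize (B 0%nat); simpl in B; lra).
  destruct (pow_lt_1_zero (Cmod (z - c) / R)) with (y := Cmod (f z) / M) as [n Hn].
  - rewrite Rabs_pos_eq by (left; apply Rdiv_lt_0_compat; auto).
    apply Rlt_div_l; lra.
  - apply Rdiv_lt_0_compat; auto.
  - specialize (Hn n (le_n n)); specialize (B n).
    rewrite Rabs_pos_eq in Hn by (apply pow_le; left; apply Rdiv_lt_0_compat; auto).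
    apply Rlt_div_r in Hn; auto; lra.
Qed.

(** * Finite sums, series and termwise differentiation *)

Fixpoint csum (a : nat -> C) (n : nat) : C :=
  match n with O => RtoC 0 | S n => (csum a n + a n)%C end.

Fixpoint rsum (a : nat -> R) (n : nat) : R :=
  match n with O => 0 | S n => rsum a n + a n end.

Definition cseries (a : nat -> C) (l : C) : Prop :=
  forall eps, 0 < eps -> exists N, forall n, (N <= n)%nat -> Cmod (csum a n - l) < eps.

Lemma csum_ext (a b : nat -> C) (n : nat) :
  (forall k, (k < n)%nat -> a k = b k) -> csum a n = csum b n.
Proof.
  induction n as [| n IH]; simpl; intros E; auto.
  rewrite IH, E; auto.
Qed.

Lemma rsum_ext (a b : nat -> R) (n : nat) :
  (forall k, (k < n)%nat -> a k = b k) -> rsum a n = rsum b n.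
Proof.
  induction n as [| n IH]; simpl; intros E; auto.
  rewrite IH, E; auto.
Qed.

Lemma csum_plus (a b : nat -> C) (n : nat) :
  csum (fun k => a k + b k)%C n = (csum a n + csum b n)%C.
Proof. induction n as [| n IH]; simpl; [| rewrite IH]; ring. Qed.

Lemma csum_scal (a : nat -> C) (c : C) (n : nat) :
  csum (fun k => c * a k)%C n = (c * csum a n)%C.
Proof. induction n as [| n IH]; simpl; [| rewrite IH]; ring. Qed.

Lemma rsum_scal (a : nat -> R) (c : R) (n : nat) : rsum (fun k => c * a k) n = c * rsum a n.
Proof. induction n as [| n IH]; simpl; [| rewrite IH]; ring. Qed.

Lemma rsum_plus (a b : nat -> R) (n : nat) : rsum (fun k => a k + b k) n = rsum a n + rsum b n.
Proof. induction n as [| n IH]; simpl; [| rewrite IH]; ring. Qed.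

Lemma rsum_le (a b : nat -> R) (n : nat) :
  (forall k, (k < n)%nat -> a k <= b k) -> rsum a n <= rsum b n.
Proof.
  induction n as [| n IH]; simpl; intros H; [lra |].
  apply Rplus_le_compat; auto.
Qed.

Lemma rsum_incr (a : nat -> R) (n m : nat) :
  (forall k, 0 <= a k) -> (n <= m)%nat -> rsum a n <= rsum a m.
Proof.
  intros H L; induction L as [| m L IH]; simpl; [lra | specialize (H m); lra].
Qed.

Lemma csum_diff_bound (a : nat -> C) (M : nat -> R) (n m : nat) :
  (forall k, Cmod (a k) <= M k) -> (n <= m)%nat ->
  Cmod (csum a m - csum a n) <= rsum M m - rsum M n.
Proof.
  intros H L; induction L as [| m L IH].
  - rewrite Cmod_sub_self; lra.
  - simpl; replace (csum a m + a m - csum a n)%C with (csum a m - csum a n + a m)%C by ring.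
    apply Rle_trans with (1 := Cmod_triangle _ _); specialize (H m); lra.
Qed.

Lemma cseries_dominated (a : nat -> C) (M : nat -> R) (S : R) :
  (forall k, Cmod (a k) <= M k) -> (forall n, rsum M n <= S) ->
  exists l, cseries a l /\ forall n, Cmod (l - csum a n) <= S - rsum M n.
Proof.
  intros H B.
  assert (PM : forall k, 0 <= M k) by (intros k; apply Rle_trans with (2 := H k), Cmod_ge_0).
  destruct (Un_cv_crit (rsum M)) as [s Hs].
  { intros n; simpl; specialize (PM n); lra. }
  { exists S; intros x [n ->]; auto. }
  assert (Cr : forall eps, 0 < eps -> exists N, forall n m, (N <= n)%nat -> (N <= m)%nat ->
    Cmod (csum a n - csum a m) < eps).
  { intros eps He; destruct (CV_Cauchy (rsum M) (exist _ s Hs) eps He) as [N HN].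
    exists N; intros n m Hn Hm; specialize (HN n m Hn Hm).
    unfold Rdist in HN.
    destruct (Nat.le_ge_cases n m) as [L | L].
    - rewrite Cmod_sub_sym; apply Rle_lt_trans with (1 := csum_diff_bound a M n m H L).
      rewrite Rabs_minus_sym in HN; apply Rle_lt_trans with (1 := Rle_abs _) (2 := HN).
    - apply Rle_lt_trans with (1 := csum_diff_bound a M m n H L).
      apply Rle_lt_trans with (1 := Rle_abs _) (2 := HN). }
  destruct (Rcomplete.R_complete (fun n => Re (csum a n))) as [x Hx].
  { intros eps He; destruct (Cr eps He) as [N HN]; exists N; intros n m Hn Hm.
    apply Rle_lt_trans with (2 := HN n m Hn Hm).
    unfold Rdist; replace (Re (csum a n) - Re (csum a m)) with (Re (csum a n - csum a m)) by reim.
    apply re_le_Cmod. }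
  destruct (Rcomplete.R_complete (fun n => Im (csum a n))) as [y Hy].
  { intros eps He; destruct (Cr eps He) as [N HN]; exists N; intros n m Hn Hm.
    apply Rle_lt_trans with (2 := HN n m Hn Hm).
    unfold Rdist; replace (Im (csum a n) - Im (csum a m)) with (Im (csum a n - csum a m)) by reim.
    apply im_le_Cmod. }
  assert (L : cseries a (x, y)).
  { intros eps He.
    destruct (Hx (eps / 2)) as [N1 H1]; [lra |]; destruct (Hy (eps / 2)) as [N2 H2]; [lra |].
    exists (max N1 N2); intros n Hn.
    apply Rle_lt_trans with (1 := Cmod_le_re_im _).
    specialize (H1 n ltac:(lia)); specialize (H2 n ltac:(lia)); unfold Rdist in H1, H2.
    replace (Re (csum a n - (x, y))) with (Re (csum a n) - x) by reim.
    replace (Im (csum a n - (x, y))) with (Im (csum a n) - y) by reim.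
    lra. }
  exists (x, y); split; auto; intros n.
  apply le_epsilon; intros eps He; destruct (L eps He) as [N HN].
  specialize (HN (max N n) ltac:(lia)).
  assert (T := Cmod_triangle3 (x, y) (csum a (max N n)) (csum a n)).
  rewrite Cmod_sub_sym in HN.
  assert (U := csum_diff_bound a M n (max N n) H ltac:(lia)).
  specialize (B (max N n)); lra.
Qed.

Lemma cseries_unique (a : nat -> C) (l m : C) : cseries a l -> cseries a m -> l = m.
Proof.
  intros Hl Hm; destruct (Ceq_dec l m) as [| N]; auto; exfalso.
  apply Cmod_sub_gt0 in N.
  destruct (Hl (Cmod (l - m) / 2)) as [N1 H1]; [lra |].
  destruct (Hm (Cmod (l - m) / 2)) as [N2 H2]; [lra |].
  specialize (H1 (max N1 N2) ltac:(lia)); specialize (H2 (max N1 N2) ltac:(lia)).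
  assert (T := Cmod_triangle3 l (csum a (max N1 N2)) m).
  rewrite Cmod_sub_sym in H1; lra.
Qed.

Lemma cseries_bound (a : nat -> C) (l : C) (B : R) :
  cseries a l -> (forall n, Cmod (csum a n) <= B) -> Cmod l <= B.
Proof.
  intros H HB; apply le_epsilon; intros eps He; destruct (H eps He) as [N HN].
  specialize (HN N (le_n N)); specialize (HB N).
  rewrite Cmod_sub_sym in HN; assert (T := Cmod_triangle_rev l (csum a N)); lra.
Qed.

Lemma cseries_plus (a b : nat -> C) (l m : C) :
  cseries a l -> cseries b m -> cseries (fun k => a k + b k)%C (l + m)%C.
Proof.
  intros Ha Hb eps He.
  destruct (Ha (eps / 2)) as [N1 H1]; [lra |]; destruct (Hb (eps / 2)) as [N2 H2]; [lra |].
  exists (max N1 N2); intros n Hn.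
  specialize (H1 n ltac:(lia)); specialize (H2 n ltac:(lia)).
  rewrite csum_plus; replace (csum a n + csum b n - (l + m))%C
    with ((csum a n - l) + (csum b n - m))%C by ring.
  apply Rle_lt_trans with (1 := Cmod_triangle _ _); lra.
Qed.

Lemma cseries_scal (a : nat -> C) (c l : C) :
  cseries a l -> cseries (fun k => c * a k)%C (c * l)%C.
Proof.
  intros Ha eps He; assert (P := Cmod_ge_0 c).
  destruct (Ha (eps / (Cmod c + 1))) as [N H]; [apply Rdiv_lt_0_compat; lra |].
  exists N; intros n Hn; specialize (H n Hn).
  rewrite csum_scal; replace (c * csum a n - c * l)%C with (c * (csum a n - l))%C by ring.
  rewrite Cmod_mult; apply Rlt_div_r in H; [| lra].
  assert (Q := Cmod_ge_0 (csum a n - l)); nra.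
Qed.

Lemma cseries_ext (a b : nat -> C) (l : C) : (forall k, a k = b k) -> cseries a l -> cseries b l.
Proof.
  intros E H eps He; destruct (H eps He) as [N HN]; exists N; intros n Hn.
  rewrite <- (csum_ext a b); auto.
Qed.

(** Each term has a first-order Taylor remainder of at most [4 M n / r^2 |z - p|^2]. These bounds
    sum to a quadratic remainder for [F], so derivative and series are exchanged without any
    integral. *)
Lemma weierstrass (f : nat -> C -> C) (F : C -> C) (p : C) (r : R) (M : nat -> R) (S : R) :
  0 < r -> (forall n, holo_on (fun z => Cmod (z - p) <= r) (f n)) ->
  (forall n z, Cmod (z - p) <= r -> Cmod (f n z) <= M n) -> (forall n, rsum M n <= S) ->
  (forall z, Cmod (z - p) <= r -> cseries (fun n => f n z) (F z)) ->
  exists l, cseries (fun n => Cder (f n) p) l /\ cder F p l.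
Proof.
  intros Hr Hf HM HS HF.
  assert (Z0 : Cmod (p - p) <= r) by (rewrite Cmod_sub_self; lra).
  destruct (cseries_dominated (fun n => Cder (f n) p) (fun n => 2 / r * M n) (2 / r * S))
    as [l [Hl _]].
  { intros n; replace (2 / r * M n) with (2 * M n / r) by (field; lra).
    apply cauchy_estimate; auto; intros z Hz.
    apply Rle_trans with (1 := Cmod_triangle_sub _ _).
    assert (H1 := HM n z ltac:(lra)); assert (H2 := HM n p Z0); lra. }
  { intros n; rewrite rsum_scal; apply Rmult_le_compat_l; auto.
    left; apply Rdiv_lt_0_compat; lra. }
  exists l; split; auto.
  apply (cder_of_quadratic _ _ _ r (4 / r ^ 2 * S)); auto; intros z Hz.
  assert (Ser : cseries (fun n => f n z + (- (1)) * f n p + (- (z - p)) * Cder (f n) p)%C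
    (F z + (- (1)) * F p + (- (z - p)) * l)%C).
  { apply (cseries_plus (fun n => f n z + (- (1)) * f n p)%C).
    - apply cseries_plus; [apply HF; lra | apply cseries_scal, HF, Z0].
    - apply cseries_scal, Hl. }
  replace (F z - F p - l * (z - p))%C with (F z + (- (1)) * F p + (- (z - p)) * l)%C by ring.
  apply (cseries_bound _ _ _ Ser); intros n.
  replace (4 / r ^ 2 * S * Cmod (z - p) ^ 2) with (4 / r ^ 2 * Cmod (z - p) ^ 2 * S) by ring.
  assert (Q : 0 <= 4 / r ^ 2 * Cmod (z - p) ^ 2).
  { apply Rmult_le_pos; [left; apply Rdiv_lt_0_compat; [lra | apply pow_lt; auto] | apply pow2_ge_0]. }
  apply Rle_trans with (4 / r ^ 2 * Cmod (z - p) ^ 2 * rsum M n);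
    [| apply Rmult_le_compat_l; auto].
  rewrite <- rsum_scal.
  assert (U := csum_diff_bound (fun n => f n z + (- (1)) * f n p + (- (z - p)) * Cder (f n) p)%C
    (fun k => 4 / r ^ 2 * Cmod (z - p) ^ 2 * M k) 0 n).
  replace (csum _ n - csum _ 0)%C with
    (csum (fun n => f n z + (- (1)) * f n p + (- (z - p)) * Cder (f n) p)%C n) in U
    by (simpl; ring).
  simpl rsum in U at 2; rewrite Rminus_0_r in U; apply U; [| lia].
  intros k.
  replace (f k z + (- (1)) * f k p + (- (z - p)) * Cder (f k) p)%C
    with (f k z - f k p - Cder (f k) p * (z - p))%C by ring.
  replace (4 / r ^ 2 * Cmod (z - p) ^ 2 * M k) with (4 * M k / r ^ 2 * Cmod (z - p) ^ 2)
    by (field; lra).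
  apply (taylor1_bound (f k) p r (M k)); auto; lra.
Qed.

(** * Logarithms of zero-free functions and removal of zeros *)

Lemma Cmod_le_components (a b : C) :
  Rabs (Re a) <= Rabs (Re b) -> Rabs (Im a) <= Rabs (Im b) -> Cmod a <= Cmod b.
Proof.
  intros H1 H2.
  assert (Q1 := Rsqr_le_abs_1 _ _ H1); assert (Q2 := Rsqr_le_abs_1 _ _ H2).
  unfold Rsqr in *; unfold Cmod; apply sqrt_le_1_alt; unfold Re, Im in *; nra.
Qed.

(** The primitive integrates horizontally and then vertically from the centre. Goursat's theorem on
    one rectangle moves the corner of the path, so that the increment from [z] to [w] is an integral
    over two short legs near [z]. *)
Lemma primitive_disc (f : C -> C) (c : C) (R : R) :
  holo_on (fun z => Cmod (z - c) < R) f ->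
  exists F, forall z, Cmod (z - c) < R -> cder F z (f z).
Proof.
  intros Hf.
  exists (fun z => cint (fun t => f (t, Im c)) (Re c) (Re z) +
    Ci * cint (fun t => f (Re z, t)) (Im c) (Im z))%C.
  intros z Hz; apply cder_of_eps; intros eps He.
  (* Each of the two legs costs twice this value because of the factor 2 in [is_cint_bound]. *)
  destruct (holo_on_ccont _ f z Hf Hz (eps / 4)) as [d [Hd Dc]]; [lra |].
  exists (Rmin d (R - Cmod (z - c))); split; [apply Rmin_glb_lt; lra |].
  intros w Hw.
  assert (W0 := Rlt_le_trans _ _ _ Hw (Rmin_l _ _)).
  assert (W1 := Rlt_le_trans _ _ _ Hw (Rmin_r _ _)).
  destruct z as [x y], w as [x' y'], c as [a b].
  unfold Re, Im; simpl fst; simpl snd.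
  set (c := (a, b) : C) in *; set (z := (x, y) : C) in *; set (w := (x', y') : C) in *.
  assert (Dx : Rabs (x' - x) <= Cmod (w - z)).
  { replace (x' - x) with (Re (w - z)) by (unfold w, z; reim); apply re_le_Cmod. }
  assert (Dy : Rabs (y' - y) <= Cmod (w - z)).
  { replace (y' - y) with (Im (w - z)) by (unfold w, z; reim); apply im_le_Cmod. }
  assert (Cont : forall v, Cmod (v - c) < R -> ccont f v)
    by (intros v Hv; apply (holo_on_ccont _ f v Hf Hv)).
  assert (In0 : forall s t, Rabs (s - a) <= Rabs (x - a) -> Rabs (t - b) <= Rabs (y - b) ->
    Cmod ((s, t) - c) <= Cmod (z - c)).
  { intros s t Hs Ht; apply Cmod_le_components; unfold c, z, Re, Im; simpl; auto. }
  assert (In1 : forall s t, Rabs (s - x) <= Rabs (x' - x) -> Rabs (t - b) <= Rabs (y - b) ->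
    Cmod ((s, t) - c) < R).
  { intros s t Hs Ht.
    assert (T := Cmod_triangle3 (s, t) (x, t) c).
    assert (E : ((s, t) - (x, t))%C = RtoC (s - x)) by (apply Ceq; simpl; ring).
    rewrite E, Cmod_R in T; assert (U := In0 x t ltac:(lra) Ht); lra. }
  assert (In2 : forall s t, Rabs (s - x) <= Rabs (x' - x) -> Rabs (t - y) <= Rabs (y' - y) ->
    Cmod ((s, t) - z) <= Cmod (w - z)).
  { intros s t Hs Ht; apply Cmod_le_components; unfold w, z, Re, Im; simpl; auto. }
  assert (In3 : forall s t, Rabs (s - x) <= Rabs (x' - x) -> Rabs (t - y) <= Rabs (y' - y) ->
    Cmod ((s, t) - c) < R).
  { intros s t Hs Ht; assert (T := Cmod_triangle3 (s, t) z c); assert (U := In2 s t Hs Ht); lra. }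
  assert (Zx : Rabs (x - x) <= Rabs (x' - x)) by (rewrite Rminus_diag, Rabs_R0; apply Rabs_pos).
  assert (Zy : Rabs (y - y) <= Rabs (y' - y)) by (rewrite Rminus_diag, Rabs_R0; apply Rabs_pos).
  assert (Zb : Rabs (b - b) <= Rabs (y - b)) by (rewrite Rminus_diag, Rabs_R0; apply Rabs_pos).
  assert (H1 : is_cint (fun t => f (t, b)) a x (cint (fun t => f (t, b)) a x)).
  { apply is_cint_cint; intros t Ht; apply ccont_hline, Cont.
    apply betw_dist in Ht; apply Rle_lt_trans with (2 := Hz), In0; auto. }
  assert (H2 : is_cint (fun t => f (t, b)) x x' (cint (fun t => f (t, b)) x x')).
  { apply is_cint_cint; intros t Ht; apply ccont_hline, Cont.
    apply betw_dist in Ht; apply In1; auto. }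
  assert (V1 : is_cint (fun t => f (x', t)) b y (cint (fun t => f (x', t)) b y)).
  { apply is_cint_cint; intros t Ht; apply ccont_vline, Cont.
    apply betw_dist in Ht; apply In1; auto; lra. }
  assert (V2 : is_cint (fun t => f (x', t)) y y' (cint (fun t => f (x', t)) y y')).
  { apply is_cint_cint; intros t Ht; apply ccont_vline, Cont.
    apply betw_dist in Ht; apply In3; auto; lra. }
  assert (H3 : is_cint (fun t => f (t, y)) x x' (cint (fun t => f (t, y)) x x')).
  { apply is_cint_cint; intros t Ht; apply ccont_hline, Cont.
    apply betw_dist in Ht; apply In3; auto. }
  rewrite (cint_of_is_cint _ _ _ _ (is_cint_Chasles _ _ _ _ _ _ H1 H2)).
  rewrite (cint_of_is_cint _ _ _ _ (is_cint_Chasles _ _ _ _ _ _ V1 V2)).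
  (* The rectangle between the old and the new vertical leg: it exchanges the horizontal step at
     height [b] for one at height [y], close to [z]. *)
  assert (G : rect_int f x x' b y = 0%C).
  { apply goursat; intros [s t] [Hs Ht]; apply Hf; apply betw_dist in Hs; apply betw_dist in Ht.
    apply In1; auto. }
  unfold rect_int in G.
  set (h1 := cint (fun t => f (t, b)) a x) in *; set (h2 := cint (fun t => f (t, b)) x x') in *.
  set (h3 := cint (fun t => f (t, y)) x x') in *; set (v1 := cint (fun t => f (x', t)) b y) in *.
  set (v0 := cint (fun t => f (x, t)) b y) in *; set (v2 := cint (fun t => f (x', t)) y y') in *.
  assert (B3 : Cmod (h3 + - (RtoC (x' - x) * f z)) <= 2 * (eps / 4) * Rabs (x' - x)).
  { apply is_cint_bound with (f := fun t => (f (t, y) + - f z)%C).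
    - replace (- (RtoC (x' - x) * f z))%C with (RtoC (x' - x) * - f z)%C by ring.
      apply is_cint_plus; [exact H3 | apply is_cint_const].
    - intros t Ht; left; apply Dc; apply betw_dist in Ht.
      apply Rle_lt_trans with (2 := W0), In2; auto. }
  assert (B4 : Cmod (v2 + - (RtoC (y' - y) * f z)) <= 2 * (eps / 4) * Rabs (y' - y)).
  { apply is_cint_bound with (f := fun t => (f (x', t) + - f z)%C).
    - replace (- (RtoC (y' - y) * f z))%C with (RtoC (y' - y) * - f z)%C by ring.
      apply is_cint_plus; [exact V2 | apply is_cint_const].
    - intros t Ht; left; apply Dc; apply betw_dist in Ht.
      apply Rle_lt_trans with (2 := W0), In2; auto; lra. }
  assert (Ew : (w - z)%C = (RtoC (x' - x) + Ci * RtoC (y' - y))%C)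
    by (apply Ceq; unfold w, z; simpl; ring).
  replace (h1 + h2 + Ci * (v1 + v2) - (h1 + Ci * v0) - f z * (w - z))%C with
    ((h2 - h3 + Ci * (v1 - v0)) + ((h3 + - (RtoC (x' - x) * f z)) +
      Ci * (v2 + - (RtoC (y' - y) * f z))))%C by (rewrite Ew; ring).
  rewrite G, Cplus_0_l.
  apply Rle_trans with (1 := Cmod_triangle _ _); rewrite Cmod_mult, Cmod_Ci.
  assert (2 * (eps / 4) * Rabs (x' - x) <= eps / 2 * Cmod (w - z)) by nra.
  assert (2 * (eps / 4) * Rabs (y' - y) <= eps / 2 * Cmod (w - z)) by nra.
  lra.
Qed.

Lemma segment_in_disc (c z : C) (t R : R) : Cmod (z - c) < R -> 0 <= t <= 1 ->
  Cmod (c + RtoC t * (z - c) - c) < R.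
Proof.
  intros Hz Ht; replace (c + RtoC t * (z - c) - c)%C with (RtoC t * (z - c))%C by ring.
  rewrite Cmod_mult, Cmod_R, Rabs_pos_eq by lra.
  assert (P := Cmod_ge_0 (z - c)); nra.
Qed.

(** [k] is the primitive of [g'/g] vanishing at [c]; then [g e^(-k)] has derivative 0 along every
    radius. *)
Lemma holomorphic_log (g : C -> C) (c : C) (R : R) : 0 < R ->
  holo_on (fun z => Cmod (z - c) < R) g -> (forall z, Cmod (z - c) < R -> g z <> 0%C) ->
  exists k : C -> C, k c = RtoC 0 /\ (forall z, Cmod (z - c) < R -> cder k z (Cder g z / g z)%C) /\
    forall z, Cmod (z - c) < R -> g z = (g c * cexp (k z))%C.
Proof.
  intros HR Hg N.
  assert (Dg : forall z, Cmod (z - c) < R -> cder g z (Cder g z))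
    by (intros z Hz; apply Cder_correct, Hg, Hz).
  destruct (primitive_disc (fun z => Cder g z / g z)%C c R) as [F HF].
  { intros z Hz.
    destruct (cder_derivative g (Cder g) z (R - Cmod (z - c))) as [l Hl]; [lra | |].
    - intros w Hw; apply Dg; assert (T := Cmod_triangle3 w z c); lra.
    - eexists; apply cder_div; [exact Hl | apply Dg, Hz | apply N, Hz]. }
  set (k := fun z => (F z - F c)%C).
  assert (Dk : forall z, Cmod (z - c) < R -> cder k z (Cder g z / g z)%C).
  { intros z Hz; eapply cder_eq; [| apply cder_minus; [apply HF, Hz | apply cder_const]]; ring. }
  assert (Kc : k c = 0%C) by (unfold k; ring).
  exists k; split; [auto |]; split; [auto |]; intros z Hz.
  set (e := fun z => (g z * cexp (- k z))%C).
  assert (E : Cmod (e z - e c) <= 0 * Cmod (z - c)).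
  { apply (mean_value_segment e (fun _ => RtoC 0)).
    - intros t Ht; assert (S := segment_in_disc c z t R Hz Ht).
      set (v := (c + RtoC t * (z - c))%C) in *.
      eapply cder_eq.
      2: { apply cder_mult; [apply Dg, S | apply (cder_comp (fun z => - k z)%C cexp)];
           [apply cder_opp, Dk, S | apply cder_cexp]. }
      cbv beta; field; apply N, S.
    - intros; rewrite Cmod_0; lra. }
  assert (E' : e z = e c).
  { assert (P := Cmod_ge_0 (e z - e c)).
    replace (e z) with (e z - e c + e c)%C by ring.
    rewrite (Cmod_eq_0 (e z - e c)) by lra; ring. }
  unfold e in E'; rewrite Kc in E'.
  replace (- 0)%C with (RtoC 0) in E' by ring; rewrite cexp_0, cexp_opp in E'.
  assert (Nk := cexp_neq_0 (k z)).
  replace (g c) with (g c * 1)%C by ring; rewrite <- E'; field; auto.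
Qed.

(** Borel-Caratheodory: [k = log (g / g c)] has real part at most [A], so [k / (2A - k)] maps into
    the unit disc and vanishes at [c]. Schwarz's lemma bounds it away from 1, hence bounds [k] by a
    multiple of [A], and the Cauchy estimate bounds [k' = g'/g]. *)
Lemma log_derivative_bound (r R : R) : 0 < r -> r < R -> exists K, 0 < K /\
  forall (g : C -> C) (c : C) (A : Rdefinitions.R), 0 < A ->
    holo_on (fun z => Cmod (z - c) <= R) g ->
    (forall z, Cmod (z - c) <= R -> g z <> 0%C) ->
    (forall z, Cmod (z - c) <= R -> Cmod (g z) <= Cmod (g c) * exp A) ->
    forall z, Cmod (z - c) <= r -> Cmod (Cder g z / g z) <= K * A.
Proof.
  intros Hr HR.
  (* [r2 < R] because [k] lives on the open disc only, [r1 < r2] makes the contraction factor [th]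
     less than 1, and [r1 - r] is the radius of the Cauchy estimate. *)
  set (r1 := (2 * r + R) / 3); set (r2 := (r + 2 * R) / 3).
  assert (O1 : r < r1) by (unfold r1; lra); assert (O2 : r1 < r2) by (unfold r1, r2; lra).
  assert (O3 : r2 < R) by (unfold r2; lra).
  set (th := r1 / r2).
  assert (T0 : 0 < th) by (apply Rdiv_lt_0_compat; lra).
  assert (T1 : th < 1) by (apply Rlt_div_l; lra).
  exists (2 * (2 * th / (1 - th)) / (r1 - r)); split.
  { apply Rdiv_lt_0_compat; [| lra]; apply Rmult_lt_0_compat; [lra |].
    apply Rdiv_lt_0_compat; lra. }
  intros g c A HA Hg N B.
  destruct (holomorphic_log g c R) as [k [Kc [Dk Ek]]]; [lra | | |].
  { apply (holo_on_subset (fun z => Cmod (z - c) <= R)); auto; intros; lra. }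
  { intros; apply N; lra. }
  assert (Nc : 0 < Cmod (g c)) by (apply Cmod_gt_0, N; rewrite Cmod_sub_self; lra).
  assert (ReK : forall z, Cmod (z - c) < R -> Re (k z) <= A).
  { intros z Hz; specialize (B z ltac:(lra)); rewrite (Ek z Hz), Cmod_mult, Cmod_cexp in B.
    apply Rmult_le_reg_l in B; auto; apply Rnot_lt_le; intros L; apply exp_increasing in L; lra. }
  set (D := fun z => (RtoC (2 * A) - k z)%C).
  assert (ReD : forall z, Cmod (z - c) < R -> A <= Re (D z)).
  { intros z Hz; specialize (ReK z Hz); unfold D.
    replace (Re (RtoC (2 * A) - k z)) with (2 * A - Re (k z)) by reim; lra. }
  assert (ND : forall z, Cmod (z - c) < R -> D z <> 0%C).
  { intros z Hz E; specialize (ReD z Hz); rewrite E in ReD; simpl in ReD; lra. }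
  (* Here [|2A - k|^2 - |k|^2 = 4A (A - Re k) >= 0]. *)
  assert (KD : forall z, Cmod (z - c) < R -> Cmod (k z) <= Cmod (D z)).
  { intros z Hz; specialize (ReK z Hz).
    apply Rsqr_incr_0; try apply Cmod_ge_0.
    rewrite 2!Rsqr_pow2, 2!Cmod_sq.
    replace (Re (D z)) with (2 * A - Re (k z)) by (unfold D; reim).
    replace (Im (D z)) with (- Im (k z)) by (unfold D; reim).
    nra. }
  set (Phi := fun z => (k z / D z)%C).
  assert (Pc : Phi c = 0%C) by (unfold Phi; rewrite Kc; unfold Cdiv; ring).
  assert (HPhi : holo_on (fun z => Cmod (z - c) <= r2) Phi).
  { intros z Hz; eexists; apply cder_div; [apply Dk; lra | | apply ND; lra].
    apply cder_minus; [apply cder_const | apply Dk; lra]. }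
  assert (S : forall z, Cmod (z - c) <= r1 -> Cmod (Phi z) <= th).
  { intros z Hz.
    assert (Q := schwarz Phi c r2 1 ltac:(lra) HPhi).
    replace (Phi z) with (Phi z - Phi c)%C by (rewrite Pc; ring).
    apply Rle_trans with (1 / r2 * Cmod (z - c)).
    - apply Q; [| lra]; intros w Hw; rewrite Pc.
      replace (Phi w - 0)%C with (Phi w) by ring; unfold Phi.
      rewrite Cmod_div by (apply ND; lra).
      apply Rle_div_l; [apply Cmod_gt_0, ND; lra |].
      rewrite Rmult_1_l; apply KD; lra.
    - unfold th, Rdiv; rewrite Rmult_1_l, (Rmult_comm r1).
      apply Rmult_le_compat_l; auto; left; apply Rinv_0_lt_compat; lra. }
  assert (Bk : forall z, Cmod (z - c) <= r1 -> Cmod (k z) <= 2 * th / (1 - th) * A).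
  { intros z Hz; specialize (S z Hz).
    assert (E : Cmod (k z) = Cmod (Phi z) * Cmod (D z)).
    { rewrite <- Cmod_mult; f_equal; unfold Phi; field; apply ND; lra. }
    assert (T : Cmod (D z) <= 2 * A + Cmod (k z)).
    { apply Rle_trans with (1 := Cmod_triangle_sub _ _); rewrite Cmod_R, Rabs_pos_eq; lra. }
    assert (P := Cmod_ge_0 (D z)); assert (P' := Cmod_ge_0 (Phi z)).
    assert (U : Cmod (k z) * (1 - th) <= 2 * th * A) by nra.
    replace (2 * th / (1 - th) * A) with (2 * th * A / (1 - th)) by (field; lra).
    apply Rle_div_r; lra. }
  intros z Hz.
  rewrite <- (Cder_unique k z _ (Dk z ltac:(lra))).
  replace (2 * (2 * th / (1 - th)) / (r1 - r) * A)
    with (2 * (2 * th / (1 - th) * A) / (r1 - r)) by (field; lra).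
  assert (In : forall w, Cmod (w - z) <= r1 - r -> Cmod (w - c) <= r1)
    by (intros w Hw; assert (T := Cmod_triangle3 w z c); lra).
  apply cauchy_estimate; [lra | |].
  - intros w Hw; specialize (In w Hw); eexists; apply Dk; lra.
  - intros w Hw; apply Rle_trans with (1 := Cmod_triangle_sub _ _).
    assert (H1 := Bk w (In w ltac:(lra))); assert (H2 := Bk z ltac:(lra)); lra.
Qed.

(** * Blaschke factors and the logarithmic derivative in the presence of zeros *)

Lemma Cmod_conj_sub (a b : C) : Cmod (Cconj a - Cconj b) = Cmod (a - b).
Proof. rewrite <- (Cmod_conj (a - b)); f_equal; apply Ceq; simpl; ring. Qed.

(** The Blaschke factor of [a] for the disc of centre [c] and radius [R] is [R (z - a)] divided by
    this. *)
Definition blaschke_den (c a : C) (R : R) (z : C) : C :=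
  (RtoC (R ^ 2) - Cconj (a - c) * (z - c))%C.

Lemma blaschke_den_lower (c a z : C) (R r1 r : R) :
  Cmod (a - c) <= r1 -> Cmod (z - c) <= r -> 0 <= R -> R ^ 2 - r1 * r <= Cmod (blaschke_den c a R z).
Proof.
  intros Ha Hz HR; unfold blaschke_den.
  apply Rle_trans with (2 := Cmod_triangle_rev _ _).
  rewrite Cmod_mult, Cmod_conj, Cmod_R, Rabs_pos_eq by (apply pow_le; auto).
  assert (P1 := Cmod_ge_0 (a - c)); assert (P2 := Cmod_ge_0 (z - c)).
  assert (Cmod (a - c) * Cmod (z - c) <= r1 * r) by (apply Rmult_le_compat; auto); lra.
Qed.

(** On the circle [R^2 = (z - c) conj(z - c)], and [z - c] factors out; hence the Blaschke factor
    has modulus 1 there. *)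
Lemma blaschke_den_circle (c a z : C) (R : R) : 0 <= R -> Cmod (z - c) = R ->
  Cmod (blaschke_den c a R z) = R * Cmod (z - a).
Proof.
  intros HR Hz; unfold blaschke_den.
  rewrite <- Hz at 1; rewrite Cmod2_conj.
  replace ((z - c) * Cconj (z - c) - Cconj (a - c) * (z - c))%C
    with ((z - c) * (Cconj (z - c) - Cconj (a - c)))%C by ring.
  rewrite Cmod_mult, Cmod_conj_sub, Hz.
  replace (z - c - (a - c))%C with (z - a)%C by ring; auto.
Qed.

Lemma cder_blaschke_den (c a z : C) (R : R) : cder (blaschke_den c a R) z (- Cconj (a - c))%C.
Proof.
  unfold blaschke_den; eapply cder_eq; [| apply cder_minus; [apply cder_const |
    apply cder_scal, cder_minus; [apply cder_id | apply cder_const]]].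
  ring.
Qed.

Section ZeroRemoval.

Variables (f : C -> C) (c a : C) (r1 R : R).
Hypothesis r1_pos : 0 < r1.
Hypothesis r1_lt_R : r1 < R.
Hypothesis f_holo : holo_on (fun z => Cmod (z - c) <= R) f.
Hypothesis a_in : Cmod (a - c) <= r1.
Hypothesis f_a : f a = 0%C.

(* [f] divided by the Blaschke factor of its zero [a]. *)
Definition remove_zero (z : C) : C :=
  (slope f a (Cder f a) z * blaschke_den c a R z * RtoC (/ R))%C.

(** Free of division by [z - a], hence valid at [a] too. *)
Lemma remove_zero_eq (z : C) :
  (remove_zero z * (z - a) = f z * blaschke_den c a R z * RtoC (/ R))%C.
Proof.
  unfold remove_zero.
  replace (f z) with (f z - f a)%C by (rewrite f_a; ring).
  rewrite (slope_eq f a (Cder f a) z); ring.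
Qed.

Lemma blaschke_den_neq_0 (z : C) : Cmod (z - c) <= R -> blaschke_den c a R z <> 0%C.
Proof.
  intros Hz; apply Cmod_gt_0.
  apply Rlt_le_trans with (2 := blaschke_den_lower c a z R r1 R a_in Hz ltac:(lra)); nra.
Qed.

Lemma holo_slope_zero : holo_on (fun z => Cmod (z - c) <= R) (slope f a (Cder f a)).
Proof.
  apply (holo_slope _ f a (R - r1)); [lra | | auto].
  intros z Hz; assert (T := Cmod_triangle3 z a c); lra.
Qed.

Lemma remove_zero_holo : holo_on (fun z => Cmod (z - c) <= R) remove_zero.
Proof.
  intros z Hz; destruct (holo_slope_zero z Hz) as [l Hl].
  eexists; apply cder_mult; [apply cder_mult; [exact Hl | apply cder_blaschke_den] | apply cder_const].
Qed.

Lemma remove_zero_bound (M : Rdefinitions.R) :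
  (forall z, Cmod (z - c) <= R -> Cmod (f z) <= M) ->
  forall z, Cmod (z - c) <= R -> Cmod (remove_zero z) <= M.
Proof.
  intros HM; apply max_modulus; [lra | apply remove_zero_holo |]; intros z Hz.
  assert (N : z <> a) by (intros ->; lra).
  assert (P := Cmod_sub_gt0 z a N).
  apply Rmult_le_reg_r with (1 := P).
  rewrite <- Cmod_mult, remove_zero_eq, 2!Cmod_mult, blaschke_den_circle by lra.
  rewrite Cmod_R, Rabs_pos_eq by (left; apply Rinv_0_lt_compat; lra).
  replace (Cmod (f z) * (R * Cmod (z - a)) * / R) with (Cmod (f z) * Cmod (z - a)) by (field; lra).
  apply Rmult_le_compat_r; [lra | apply HM; lra].
Qed.

Lemma remove_zero_center : R / r1 * Cmod (f c) <= Cmod (remove_zero c).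
Proof.
  assert (E := f_equal Cmod (remove_zero_eq c)).
  rewrite 3!Cmod_mult in E.
  assert (D : Cmod (blaschke_den c a R c) = R ^ 2).
  { unfold blaschke_den; replace (RtoC (R ^ 2) - Cconj (a - c) * (c - c))%C with (RtoC (R ^ 2)) by ring.
    rewrite Cmod_R; apply Rabs_pos_eq, pow2_ge_0. }
  rewrite D, Cmod_R, Rabs_pos_eq in E by (left; apply Rinv_0_lt_compat; lra).
  replace (Cmod (f c) * R ^ 2 * / R) with (Cmod (f c) * R) in E by (field; lra).
  rewrite (Cmod_sub_sym c a) in E.
  replace (R / r1 * Cmod (f c)) with (Cmod (f c) * R / r1) by (field; lra).
  apply Rle_div_l; auto; rewrite <- E.
  apply Rmult_le_compat_l; [apply Cmod_ge_0 | auto].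
Qed.

Lemma remove_zero_root (z : C) : Cmod (z - c) <= R -> remove_zero z = 0%C -> f z = 0%C.
Proof.
  intros Hz E; assert (H := remove_zero_eq z); rewrite E, Cmult_0_l in H.
  assert (ND := blaschke_den_neq_0 z Hz).
  assert (NR : RtoC R <> 0%C) by (apply RtoC_neq; lra).
  replace (f z) with (f z * blaschke_den c a R z * RtoC (/ R) * (RtoC R / blaschke_den c a R z))%C.
  - rewrite <- H; ring.
  - rewrite RtoC_inv by lra; field; auto.
Qed.

(** To the right of the zero, [1/(z - a)] has nonnegative real part. A lower bound for [Re (f'/f)]
    thus ignores the distance to the zeros, whereas the bound for the modulus pays its inverse. *)
Lemma remove_zero_log_derivative (z : C) : Cmod (z - c) <= R -> f z <> 0%C ->
  (Cder f z / f z = Cder remove_zero z / remove_zero z + / (z - a)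
    + Cconj (a - c) / blaschke_den c a R z)%C.
Proof.
  intros Hz Nf.
  assert (ND := blaschke_den_neq_0 z Hz).
  assert (NR : RtoC R <> 0%C) by (apply RtoC_neq; lra).
  assert (Na : z <> a) by (intros ->; auto).
  assert (Nza := Csub_neq z a Na).
  destruct (holo_slope_zero z Hz) as [l Hl].
  set (q := slope f a (Cder f a)) in *.
  assert (Ef : forall w, f w = (q w * (w - a))%C).
  { intros w; unfold q; rewrite <- slope_eq, f_a; ring. }
  assert (Df : Cder f z = (l * (z - a) + q z * 1)%C).
  { apply Cder_unique, (cder_ext (fun w => q w * (w - a))%C); [intros; rewrite Ef; auto |].
    eapply cder_eq; [| apply cder_mult; [exact Hl | apply cder_minus; [apply cder_id | apply cder_const]]].
    cbv beta; ring. }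
  assert (Dg : Cder remove_zero z =
    ((l * blaschke_den c a R z + q z * - Cconj (a - c)) * RtoC (/ R))%C).
  { apply Cder_unique; unfold remove_zero; fold q.
    eapply cder_eq; [| apply cder_mult; [apply cder_mult; [exact Hl | apply cder_blaschke_den] | apply cder_const]].
    cbv beta; ring. }
  assert (Nq : q z <> 0%C) by (intros E; apply Nf; rewrite Ef, E; ring).
  rewrite Df, Dg, Ef; unfold remove_zero; fold q; rewrite RtoC_inv by lra.
  field; auto.
Qed.

End ZeroRemoval.

Lemma Re_inv_nonneg (z : C) : 0 <= Re z -> 0 <= Re (/ z).
Proof.
  intros H; rewrite Re_inv; unfold Rdiv.
  apply Rmult_le_pos; auto.
  destruct (Req_dec (Re z ^ 2 + Im z ^ 2) 0) as [E | E].
  - rewrite E, Rinv_0; lra.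
  - left; apply Rinv_0_lt_compat; assert (H1 := pow2_ge_0 (Re z)); assert (H2 := pow2_ge_0 (Im z)); lra.
Qed.

(* Removing a zero multiplies [|f c|] by at least [R / R1] without increasing the maximum of [|f|],
   so that at most [n] zeros can be removed. *)
Lemma log_derivative_zeros_aux (r R1 R : R) : 0 < r -> r < R1 -> R1 < R ->
  exists K0 K1, 0 < K0 /\ 0 < K1 /\
  forall (n : nat) (f : C -> C) (c : C) (A B b : Rdefinitions.R), 0 < A ->
    holo_on (fun z => Cmod (z - c) <= R) f -> f c <> 0%C ->
    (forall z, Cmod (z - c) <= R -> Cmod (f z) <= Cmod (f c) * exp A) ->
    (forall z, Cmod (z - c) <= R -> Cmod (f z) <= Cmod (f c) * exp B) ->
    B < INR n * ln (R / R1) ->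
    (forall z, Cmod (z - c) <= R1 -> f z = 0%C -> Re z <= b) ->
    forall z, Cmod (z - c) <= r -> b < Re z ->
      - (K0 * A + INR n * K1) <= Re (Cder f z / f z) /\
      Cmod (Cder f z / f z) <= K0 * A + INR n * (K1 + / (Re z - b)).
Proof.
  intros Hr H1 H2.
  destruct (log_derivative_bound r R1 Hr H1) as [K0 [P0 BC]].
  set (K1 := R1 / (R ^ 2 - R1 * r)).
  assert (PD : 0 < R ^ 2 - R1 * r) by nra.
  assert (P1 : 0 < K1) by (apply Rdiv_lt_0_compat; lra).
  exists K0, K1; split; [auto |]; split; [auto |].
  (* [A] stays fixed and serves when no zero is left; [B] is a budget, lowered by [ln (R / R1)] with
     each zero. With [n = 0] it is negative, which is absurd at the centre. *)
  induction n as [| n IH]; intros f c A B b HA Hf Nc FA FB LB Z z Hz Hb.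
  { exfalso; simpl in LB; rewrite Rmult_0_l in LB.
    apply Cmod_gt_0 in Nc; specialize (FB c ltac:(rewrite Cmod_sub_self; lra)).
    assert (exp B < 1) by (rewrite <- exp_0; apply exp_increasing; auto).
    nra. }
  rewrite S_INR.
  assert (Pb : 0 < / (Re z - b)) by (apply Rinv_0_lt_compat; lra).
  assert (Pn := pos_INR n).
  destruct (classic (exists a, Cmod (a - c) <= R1 /\ f a = 0%C)) as [[a [Ha Fa]] | N].
  - set (g := remove_zero f c a R).
    assert (PR1 : 0 < R1) by lra.
    assert (Hg : holo_on (fun z => Cmod (z - c) <= R) g) by (apply (remove_zero_holo f c a R1); auto).
    assert (Cg : R / R1 * Cmod (f c) <= Cmod (g c)) by (apply remove_zero_center; auto).
    apply Cmod_gt_0 in Nc.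
    assert (Q1 : 1 < R / R1) by (apply Rlt_div_r; lra).
    assert (Cg' : Cmod (f c) <= Cmod (g c)) by nra.
    assert (Ng : g c <> 0%C) by (apply Cmod_gt_0; lra).
    assert (GA : forall z, Cmod (z - c) <= R -> Cmod (g z) <= Cmod (g c) * exp A).
    { intros w Hw; apply Rle_trans with (Cmod (f c) * exp A).
      - apply (remove_zero_bound f c a R1); auto.
      - apply Rmult_le_compat_r; auto; left; apply exp_pos. }
    assert (GB : forall z, Cmod (z - c) <= R -> Cmod (g z) <= Cmod (g c) * exp (B - ln (R / R1))).
    { intros w Hw; apply Rle_trans with (Cmod (f c) * exp B).
      - apply (remove_zero_bound f c a R1); auto.
      - unfold Rminus; rewrite exp_plus, exp_Ropp, exp_ln by lra.
        assert (PB := exp_pos B).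
        apply Rle_trans with (R / R1 * Cmod (f c) * (exp B * / (R / R1))).
        + right; field; lra.
        + apply Rmult_le_compat_r; auto; left; apply Rmult_lt_0_compat; auto.
          apply Rinv_0_lt_compat; lra. }
    assert (Hzn : b < Re z) by auto.
    rewrite S_INR in LB.
    destruct (IH g c A (B - ln (R / R1)) b HA Hg Ng GA GB ltac:(lra)) with (z := z) as [I1 I2]; auto.
    { intros w Hw Ew; apply Z; auto.
      apply (remove_zero_root f c a R1 R); auto; lra. }
    assert (Nf : f z <> 0%C) by (intros E; apply (Z z ltac:(lra)) in E; lra).
    assert (Za := Z a Ha Fa).
    rewrite (remove_zero_log_derivative f c a R1 R); auto; [| lra].
    fold g.
    assert (BD := blaschke_den_lower c a z R R1 r Ha Hz ltac:(lra)).
    assert (ND : blaschke_den c a R z <> 0%C) by (apply Cmod_gt_0; lra).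
    assert (T : Cmod (Cconj (a - c) / blaschke_den c a R z) <= K1).
    { rewrite Cmod_div, Cmod_conj by auto; unfold K1.
      apply Rmult_le_compat; [apply Cmod_ge_0 | left; apply Rinv_0_lt_compat; lra | auto |].
      apply Rinv_le_contravar; auto. }
    assert (ReZ : Re z - b <= Re (z - a)) by (replace (Re (z - a)) with (Re z - Re a) by reim; lra).
    assert (U : 0 <= Re (/ (z - a))) by (apply Re_inv_nonneg; lra).
    assert (V : Cmod (/ (z - a)) <= / (Re z - b)).
    { assert (Rle1 := re_le_Cmod (z - a)); rewrite Rabs_pos_eq in Rle1 by lra.
      rewrite Cmod_inv by (apply Cmod_gt_0; lra).
      apply Rinv_le_contravar; lra. }
    split.
    + rewrite 2!re_plus.
      assert (W := re_le_Cmod (Cconj (a - c) / blaschke_den c a R z)).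
      assert (W' := Rle_trans _ _ _ W T); apply Rabs_le_between in W'; lra.
    + apply Rle_trans with (1 := Cmod_triangle _ _).
      assert (W := Cmod_triangle (Cder g z / g z) (/ (z - a))); lra.
  - assert (Nf : forall w, Cmod (w - c) <= R1 -> f w <> 0%C)
      by (intros w Hw E; apply N; exists w; auto).
    assert (L : Cmod (Cder f z / f z) <= K0 * A).
    { apply (BC f c A); auto.
      - apply (holo_on_subset (fun z => Cmod (z - c) <= R)); auto; intros; lra.
      - intros w Hw; apply FA; lra. }
    assert (W := Rle_trans _ _ _ (re_le_Cmod _) L); apply Rabs_le_between in W.
    assert (0 <= INR n * K1) by (apply Rmult_le_pos; lra).
    assert (0 <= INR n * / (Re z - b)) by (apply Rmult_le_pos; lra).
    split; lra.
Qed.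

Lemma log_derivative_zeros (r R1 R : R) : 0 < r -> r < R1 -> R1 < R ->
  exists K, 0 < K /\
  forall (f : C -> C) (c : C) (A b : Rdefinitions.R), 1 <= A ->
    holo_on (fun z => Cmod (z - c) <= R) f -> f c <> 0%C ->
    (forall z, Cmod (z - c) <= R -> Cmod (f z) <= Cmod (f c) * exp A) ->
    (forall z, Cmod (z - c) <= R1 -> f z = 0%C -> Re z <= b) ->
    forall z, Cmod (z - c) <= r -> b < Re z ->
      - (K * A) <= Re (Cder f z / f z) /\
      Cmod (Cder f z / f z) <= K * A * (1 + / (Re z - b)).
Proof.
  intros Hr H1 H2.
  destruct (log_derivative_zeros_aux r R1 R Hr H1 H2) as [K0 [K1 [P0 [P1 H]]]].
  set (q := ln (R / R1)) in *.
  assert (Pq : 0 < q) by (unfold q; rewrite <- ln_1; apply ln_increasing; [lra | apply Rlt_div_r; lra]).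
  set (N0 := / q + 1).
  assert (PN : 1 < N0) by (assert (X := Rinv_0_lt_compat q Pq); unfold N0; lra).
  exists (K0 + N0 * (K1 + 1)); split.
  { assert (0 < N0 * (K1 + 1)) by (apply Rmult_lt_0_compat; lra); lra. }
  intros f c A b HA Hf Nc FA Z z Hz Hb.
  (* [n] exceeds [A / q] by at most 1, and [1 <= A] turns this into [n <= N0 * A]: there are [O(A)]
     zeros to remove. *)
  destruct (archimed (A / q)) as [U1 U2].
  assert (PA : 0 < A / q) by (apply Rdiv_lt_0_compat; lra).
  assert (Pu : (0 <= up (A / q))%Z) by (apply le_IZR; lra).
  set (n := Z.to_nat (up (A / q))).
  assert (En : INR n = IZR (up (A / q))) by (unfold n; rewrite INR_IZR_INZ, Z2Nat.id; auto).
  rewrite <- En in U1, U2.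
  assert (Un : INR n <= N0 * A).
  { unfold N0; replace ((/ q + 1) * A) with (A / q + A) by (unfold Rdiv; ring); lra. }
  assert (LA : A < INR n * q).
  { apply Rgt_lt in U1; apply Rlt_div_l in U1; lra. }
  destruct (H n f c A A b ltac:(lra) Hf Nc FA FA LA Z z Hz Hb) as [I1 I2].
  assert (Pb : 0 < / (Re z - b)) by (apply Rinv_0_lt_compat; lra).
  assert (Pn := pos_INR n).
  assert (Q1 : INR n * K1 <= N0 * A * K1) by (apply Rmult_le_compat_r; lra).
  assert (Q2 : INR n * / (Re z - b) <= N0 * A * / (Re z - b)) by (apply Rmult_le_compat_r; lra).
  assert (Q3 : 0 < N0 * A) by (apply Rmult_lt_0_compat; lra).
  assert (Q4 : 0 < N0 * A * / (Re z - b)) by (apply Rmult_lt_0_compat; lra).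
  assert (Q5 : 0 < K0 * A) by (apply Rmult_lt_0_compat; lra).
  assert (Q6 : 0 < K0 * A * / (Re z - b)) by (apply Rmult_lt_0_compat; lra).
  assert (Q7 : 0 < N0 * A * K1) by (apply Rmult_lt_0_compat; lra).
  assert (Q8 : 0 < N0 * A * K1 * / (Re z - b)) by (apply Rmult_lt_0_compat; lra).
  split; lra.
Qed.

(** * The von Mangoldt function *)

(** [primes] lists the distinct prime divisors, so a one-element list characterizes the prime
    powers; it is empty for 0 and 1. *)
Definition vonMangoldt (n : nat) : R :=
  match prime.primes n with cons p nil => ln (INR p) | _ => 0 end.

Module Arithmetic.
Import ssreflect ssrfun ssrbool eqtype ssrnat seq div prime.

Lemma rsum_single (c : R) (k N : nat) :
  rsum (fun d => if d == k then c else 0) N = if (k < N)%N then c else 0.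
Proof.
elim: N => [//|N IH] /=; rewrite IH ltnS (leq_eqVlt k N) [N == k]eq_sym.
by case: eqP => [-> | _] /=; rewrite ?ltnn ?Rplus_0_l ?Rplus_0_r.
Qed.

Definition divisor_term (n d : nat) : R := if d %| n then vonMangoldt d else 0.

(** Multiplying [m] by [p] creates exactly one new prime power divisor, the power of [p] just above
    the one in [m]. *)
Lemma divisor_term_step (p m d : nat) : prime p -> (0 < m)%N ->
  divisor_term (p * m) d = divisor_term m d + (if d == (p ^ (logn p m).+1)%N then ln (INR p) else 0).
Proof.
move=> p_pr m_gt0; rewrite /divisor_term /vonMangoldt.
have p_gt0 := prime_gt0 p_pr.
case Ed: (primes d) => [|q [|q' s]].
- have -> : (d == (p ^ (logn p m).+1)%N) = false.
    by apply/eqP => E; move: Ed; rewrite E primesX // primes_prime.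
  by rewrite /= !if_same Rplus_0_r.
- have q_pr : prime q.
    have : q \in primes d by rewrite Ed inE.
    by rewrite mem_primes => /andP[].
  have d_gt0 : (0 < d)%N by case: (d) Ed.
  have : q.-nat d by rewrite /pnat d_gt0 Ed /= inE eqxx.
  case/p_natP => e De; rewrite De.
  rewrite !pfactor_dvdn ?muln_gt0 ?p_gt0 // lognM // logn_prime //.
  case: (eqVneq q p) De => [-> | neq] De.
    rewrite eqn_exp2l ?prime_gt1 // add1n leq_eqVlt ltnS.
    case: eqP => [-> | _] /=; first by rewrite ltnn Rplus_0_l.
    by rewrite Rplus_0_r.
  have -> : ((q ^ e)%N == (p ^ (logn p m).+1)%N) = false.
    apply/eqP => E; move: Ed; rewrite De E primesX // primes_prime // => -[] Epq.
    by rewrite Epq eqxx in neq.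
  by rewrite add0n Rplus_0_r.
- have -> : (d == (p ^ (logn p m).+1)%N) = false.
    by apply/eqP => E; move: Ed; rewrite E primesX // primes_prime.
  by rewrite /= !if_same Rplus_0_r.
Qed.

(** The identity [log n = sum_(d | n) Lambda(d)], by strong induction through the smallest prime
    factor. The range may be any [N >= n], so that different [n] share one range when sums are
    exchanged. *)
Lemma sum_divisor_term (n N : nat) : (0 < n)%N -> (n <= N)%N ->
  rsum (divisor_term n) N.+1 = ln (INR n).
Proof.
elim/ltn_ind: n => n IH n_gt0 n_le.
case: (leqP n 1) => [n_le1 | n_gt1].
  have -> : n = 1%N by apply/eqP; rewrite eqn_leq n_le1.
  rewrite ln_1; elim: N.+1 => [//|k IHk] /=.
  rewrite IHk /divisor_term dvdn1; case: eqP => [-> | _]; rewrite /vonMangoldt /= ; lra.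
have p_pr := pdiv_prime n_gt1; set p := pdiv n in p_pr.
case/dvdnP: (pdiv_dvd n) => m; rewrite -/p mulnC => En.
have m_gt0 : (0 < m)%N by move: n_gt0; rewrite En muln_gt0 => /andP[].
have p_gt1 := prime_gt1 p_pr.
have m_lt : (m < n)%N by rewrite En ltn_Pmull.
rewrite En (rsum_ext _ (fun d => divisor_term m d +
  (if d == (p ^ (logn p m).+1)%N then ln (INR p) else 0))); last first.
  by move=> k _; apply: divisor_term_step.
rewrite rsum_plus rsum_single IH //; last by apply: leq_trans n_le; apply: ltnW.
have -> : ((p ^ (logn p m).+1) < N.+1)%N.
  rewrite ltnS; apply: leq_trans n_le; rewrite En expnS leq_pmul2l ?prime_gt0 //.
  by apply: dvdn_leq => //; apply: pfactor_dvdnn.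
rewrite mult_INR ln_mult; first by rewrite Rplus_comm.
- by apply: lt_0_INR; apply/ltP; apply: prime_gt0.
- by apply: lt_0_INR; apply/ltP.
Qed.

Lemma vonMangoldt_ge_0 (n : nat) : 0 <= vonMangoldt n.
Proof.
rewrite /vonMangoldt; case E: (primes n) => [|p [|q s]]; try lra.
have p_pr : prime p.
  have : p \in primes n by rewrite E inE.
  by rewrite mem_primes => /andP[].
rewrite -ln_1; apply: ln_le; first lra.
have -> : 1 = INR 1 by [].
by apply: le_INR; apply/leP; apply: prime_gt0.
Qed.

Lemma rsum_multiples (a : nat -> R) (d N : nat) : (0 < d)%N ->
  rsum (fun i => if d %| i.+1 then a i.+1 else 0) N = rsum (fun k => a (d * k.+1)%N) (N %/ d).
Proof.
move=> d_gt0; elim: N => [|N IH]; first by rewrite div0n.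
rewrite /= IH divnS //; case: ifP => dv; last by rewrite add0n Rplus_0_r.
by rewrite add1n /=; congr (_ + a _); rewrite -{1}(divnK dv) divnS // dv mulnC.
Qed.

Lemma csum_multiples (a : nat -> C) (d N : nat) : (0 < d)%N ->
  csum (fun i => if d %| i.+1 then a i.+1 else RtoC 0) N =
  csum (fun k => a (d * k.+1)%N) (N %/ d).
Proof.
move=> d_gt0; elim: N => [|N IH]; first by rewrite div0n.
rewrite /= IH divnS //; case: ifP => dv; last by rewrite add0n Cplus_0_r.
by rewrite add1n /=; congr (Cplus _ (a _)); rewrite -{1}(divnK dv) divnS // dv mulnC.
Qed.

Lemma divisor_term_mult (n d : nat) :
  divisor_term n d = vonMangoldt d * (if d %| n then 1 else 0).
Proof. by rewrite /divisor_term; case: ifP => _; rewrite ?Rmult_1_r ?Rmult_0_r. Qed.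

Lemma divisor_term_0 (n : nat) : divisor_term n 0 = 0.
Proof. by rewrite /divisor_term /vonMangoldt /=; case: ifP. Qed.

(** The source of Chebyshev's bound: in [log (2N)! - 2 log N!] every [d] between [N] and [2N] is
    counted at least once and none negatively. *)
Lemma divn_double (N d : nat) : (0 < d)%N ->
  2 * INR (N %/ d) + (if (N < d <= 2 * N)%N then 1 else 0) <= INR ((2 * N) %/ d).
Proof.
move=> d_gt0; case: ifP => [/andP[lt le] | _].
- have /ltP/le_INR : (0 < (2 * N) %/ d)%N by rewrite divn_gt0.
  by rewrite (divn_small lt) /= => ?; lra.
- have /leP/le_INR : (2 * (N %/ d) <= (2 * N) %/ d)%N by rewrite leq_divRL // -mulnA leq_mul2l leq_divM.
  by rewrite mult_INR /= => ?; lra.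
Qed.

(** Rounding costs at most a factor 2; this controls the tails of zeta after [N/d] terms in
    [cder_zeta_gt1]. *)
Lemma divn_half (N d : nat) : (0 < d)%N -> (d <= N)%N ->
  INR N <= 2 * INR d * INR (N %/ d) /\ 1 <= INR (N %/ d).
Proof.
move=> d_gt0 d_le.
have /ltP/le_INR H0 : (0 < N %/ d)%N by rewrite divn_gt0.
have /ltP/lt_INR H1 : (N < (N %/ d).+1 * d)%N by apply: ltn_ceil.
move: H0 H1; rewrite mult_INR (S_INR (N %/ d)) => H0 H1; rewrite [INR 1]/= in H0.
have Hd := pos_INR d.
have H2 : 0 <= (INR (N %/ d) - 1) * INR d by apply: Rmult_le_pos; lra.
split; lra.
Qed.

Lemma ltn_of_lt (m n : nat) : (m < n)%coq_nat -> (m < n)%N.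
Proof. by move/ltP. Qed.

Lemma leq_of_le (m n : nat) : (m <= n)%coq_nat -> (m <= n)%N.
Proof. by move/leP. Qed.

Lemma lt_of_ltn (m n : nat) : (m < n)%N -> (m < n)%coq_nat.
Proof. by move/ltP. Qed.

End Arithmetic.

Lemma rsum_shift (a : nat -> R) (n : nat) : rsum a (S n) = a O + rsum (fun i => a (S i)) n.
Proof. induction n as [| n IH]; [simpl; ring |]. simpl in *; rewrite IH; ring. Qed.

Lemma rsum_swap (f : nat -> nat -> R) (n m : nat) :
  rsum (fun i => rsum (f i) m) n = rsum (fun j => rsum (fun i => f i j) n) m.
Proof.
  induction n as [| n IH]; simpl.
  - induction m as [| m IH]; simpl; [auto | rewrite <- IH; ring].
  - rewrite IH, <- rsum_plus; auto.
Qed.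

Lemma csum_swap (f : nat -> nat -> C) (n m : nat) :
  csum (fun i => csum (f i) m) n = csum (fun j => csum (fun i => f i j) n) m.
Proof.
  induction n as [| n IH]; simpl.
  - induction m as [| m IH]; simpl; [auto | rewrite <- IH; ring].
  - rewrite IH, <- csum_plus; auto.
Qed.

Lemma rsum_const (c : R) (n : nat) : rsum (fun _ => c) n = INR n * c.
Proof. induction n as [| n IH]; [simpl; ring |]. rewrite S_INR; simpl; rewrite IH; ring. Qed.

Lemma log_eq_sum_vonMangoldt (i M : nat) : (i < M)%nat ->
  ln (INR (S i)) = rsum (fun j => Arithmetic.divisor_term (S i) (S j)) M.
Proof.
  intros L; rewrite <- (Arithmetic.sum_divisor_term (S i) M).
  - rewrite rsum_shift, Arithmetic.divisor_term_0; ring.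
  - apply Arithmetic.ltn_of_lt; lia.
  - apply Arithmetic.leq_of_le; lia.
Qed.

(** Legendre's formula for [log N!]; the free [M] lets [N!] and [(2N)!] be compared term by term. *)
Lemma sum_log_eq (N M : nat) : (N <= M)%nat ->
  rsum (fun i => ln (INR (S i))) N =
  rsum (fun j => vonMangoldt (S j) * INR (div.divn N (S j))) M.
Proof.
  intros L.
  rewrite (rsum_ext _ (fun i => rsum (fun j => Arithmetic.divisor_term (S i) (S j)) M))
    by (intros; apply log_eq_sum_vonMangoldt; lia).
  rewrite rsum_swap; apply rsum_ext; intros j _.
  rewrite (rsum_ext _ (fun i => vonMangoldt (S j) * (if div.dvdn (S j) (S i) then 1 else 0)))
    by (intros; apply Arithmetic.divisor_term_mult).
  rewrite rsum_scal; f_equal.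
  rewrite (Arithmetic.rsum_multiples (fun _ => 1)) by reflexivity.
  rewrite rsum_const; ring.
Qed.

(** The logarithm of the central binomial coefficient: passing to the next [N] multiplies it by less
    than 4, and [ln 4 <= 2]. *)
Lemma sum_log_double (N : nat) :
  rsum (fun i => ln (INR (S i))) (2 * N) - 2 * rsum (fun i => ln (INR (S i))) N <= 2 * INR N.
Proof.
  induction N as [| N IH]; [simpl; lra |].
  replace (2 * S N)%nat with (S (S (2 * N))) by lia.
  cbn [rsum].
  assert (PN := pos_INR N).
  rewrite !S_INR, mult_INR; simpl (INR 2).
  assert (E : ln ((2 * INR N + 1) * (2 * INR N + 2)) <= ln ((INR N + 1) * (INR N + 1) * 4))
    by (apply ln_le; nra).
  rewrite 3!ln_mult in E by nra.
  assert (L4 : ln 4 <= 2).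
  { replace 4 with (2 * 2) by ring; rewrite ln_mult by lra.
    assert (H : ln 2 <= ln (exp 1)) by (apply ln_le; [| assert (X := exp_ineq1_le 1)]; lra).
    rewrite ln_exp in H; lra. }
  replace (2 * INR N + 1 + 1) with (2 * INR N + 2) by ring.
  replace ((1 + 1) * INR N) with (2 * INR N) by ring.
  replace (2 * INR N + 1 + 1) with (2 * INR N + 2) by ring.
  lra.
Qed.

(** * Chebyshev's bound and partial summation *)

Definition psi (N : nat) : R := rsum (fun i => vonMangoldt (S i)) N.

Lemma psi_incr (n m : nat) : (n <= m)%nat -> psi n <= psi m.
Proof. apply rsum_incr; intros; apply Arithmetic.vonMangoldt_ge_0. Qed.

Lemma psi_double (N : nat) : psi (2 * N) - psi N <= 2 * INR N.
Proof.
  apply Rle_trans with (2 := sum_log_double N).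
  rewrite (sum_log_eq N (2 * N)), (sum_log_eq (2 * N) (2 * N)) by lia.
  assert (H : psi N + rsum (fun j => vonMangoldt (S j) *
    (if andb (ssrnat.leq (S N) (S j)) (ssrnat.leq (S j) (2 * N)) then 1 else 0)) (2 * N) = psi (2 * N)).
  { replace (2 * N)%nat with (N + N)%nat by lia; unfold psi.
    assert (G : forall k, (k <= N)%nat -> rsum (fun i => vonMangoldt (S i)) N + rsum (fun j => vonMangoldt (S j) *
      (if andb (ssrnat.leq (S N) (S j)) (ssrnat.leq (S j) (N + N)) then 1 else 0)) (N + k) =
      rsum (fun i => vonMangoldt (S i)) (N + k)).
    { induction k as [| k IHk]; intros Hk.
      - rewrite Nat.add_0_r, (rsum_ext (fun j => _ * _) (fun _ => 0)).
        + rewrite rsum_const; ring.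
        + intros j Hj; destruct (ssrnat.leq (S N) (S j)) eqn:E; simpl; [| ring].
          apply Arithmetic.lt_of_ltn in E; lia.
      - rewrite Nat.add_succ_r; cbn [rsum]; rewrite <- (IHk ltac:(lia)).
        rewrite (Arithmetic.leq_of_le (S N) (S (N + k))) by lia.
        rewrite (Arithmetic.leq_of_le (S (N + k)) (N + N)) by lia.
        simpl andb; cbv iota; ring. }
    apply G; lia. }
  rewrite <- H.
  assert (Q : rsum (fun j => vonMangoldt (S j) *
    (if andb (ssrnat.leq (S N) (S j)) (ssrnat.leq (S j) (2 * N)) then 1 else 0)) (2 * N) +
    2 * rsum (fun j => vonMangoldt (S j) * INR (div.divn N (S j))) (2 * N) <=
    rsum (fun j => vonMangoldt (S j) * INR (div.divn (2 * N) (S j))) (2 * N)).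
  { rewrite <- rsum_scal, <- rsum_plus; apply rsum_le; intros j _.
    assert (D := Arithmetic.divn_double N (S j) eq_refl).
    assert (P := Arithmetic.vonMangoldt_ge_0 (S j)).
    replace (vonMangoldt (S j) * (if andb (ssrnat.leq (S N) (S j)) (ssrnat.leq (S j) (2 * N)) then 1 else 0) +
      2 * (vonMangoldt (S j) * INR (div.divn N (S j)))) with
      (vonMangoldt (S j) * (2 * INR (div.divn N (S j)) +
        (if andb (ssrnat.leq (S N) (S j)) (ssrnat.leq (S j) (2 * N)) then 1 else 0))) by ring.
    apply Rmult_le_compat_l; auto. }
  lra.
Qed.

(** Halving [N] makes the increments of [psi_double] a geometric series. The constant 4 leaves slack
    for rounding an odd [N] up to the next even number. *)
Lemma chebyshev (N : nat) : psi N <= 4 * INR N.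
Proof.
  induction N as [N IH] using (well_founded_induction lt_wf).
  destruct (Nat.Even_or_Odd N) as [[m E] | [m E]].
  - destruct m as [| m]; [rewrite E; unfold psi; simpl; lra |].
    assert (D := psi_double (S m)); assert (I := IH (S m) ltac:(lia)).
    rewrite E, mult_INR; simpl (INR 2); assert (P := pos_INR (S m)); lra.
  (* [N = 1] is apart: rounded up and halved, it would not decrease. *)
  - destruct m as [| m]; [rewrite E; unfold psi, vonMangoldt; simpl; lra |].
    assert (D := psi_double (S (S m))); assert (I := IH (S (S m)) ltac:(lia)).
    assert (M := psi_incr N (2 * S (S m)) ltac:(lia)).
    assert (P := pos_INR m).
    assert (EN : INR N = 2 * INR m + 3) by (rewrite E, plus_INR, mult_INR, (S_INR m); change (INR 2) with (1 + 1); change (INR 1) with 1; ring).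
    rewrite 2!S_INR in D, I; lra.
Qed.

(** Summation by parts, with the nonnegative boundary term kept in the induction statement [G]. *)
Lemma abel_bound (u b : nat -> R) (c : R) (N : nat) :
  (forall n, rsum u n <= c * INR n) -> (forall n, 0 <= b n) -> (forall n, b (S n) <= b n) ->
  rsum (fun i => u i * b i) N <= c * rsum b N.
Proof.
  intros Hu Hb Hd.
  assert (G : (c * INR N - rsum u N) * b N <= c * rsum b N - rsum (fun i => u i * b i) N).
  { induction N as [| N IH]; [simpl; lra |].
    rewrite S_INR; cbn [rsum].
    assert (H := Hu (S N)); rewrite S_INR in H; cbn [rsum] in H.
    specialize (Hd N); specialize (Hb (S N)).
    assert ((c * (INR N + 1) - (rsum u N + u N)) * b (S N) <=
      (c * (INR N + 1) - (rsum u N + u N)) * b N) by (apply Rmult_le_compat_l; lra).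
    lra. }
  assert (0 <= (c * INR N - rsum u N) * b N)
    by (apply Rmult_le_pos; [specialize (Hu N); lra | auto]).
  lra.
Qed.

Lemma vonMangoldt_abel (b : nat -> R) (N : nat) :
  (forall n, 0 <= b n) -> (forall n, b (S n) <= b n) ->
  rsum (fun i => vonMangoldt (S i) * b i) N <= 4 * rsum b N.
Proof. apply abel_bound; intros n; apply chebyshev. Qed.

(** A single term of the nonnegative divisor sum for the logarithm. *)
Lemma vonMangoldt_le_log (i : nat) : vonMangoldt (S i) <= ln (INR (S i)).
Proof.
  rewrite (log_eq_sum_vonMangoldt i (S i)) by lia; simpl.
  assert (E : Arithmetic.divisor_term (S i) (S i) = vonMangoldt (S i)).
  { unfold Arithmetic.divisor_term; rewrite div.dvdnn; auto. }
  rewrite E.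
  assert (P : forall n m, 0 <= rsum (fun j => Arithmetic.divisor_term n (S j)) m).
  { intros n m; induction m as [| m IH]; simpl; [lra |].
    unfold Arithmetic.divisor_term at 2; destruct (div.dvdn _ _);
      [assert (H := Arithmetic.vonMangoldt_ge_0 (S m)) |]; lra. }
  specialize (P (S i) i); lra.
Qed.

(** * Dirichlet series of zeta and of its logarithmic derivative *)

(* [npow a n] is [(n+1)^(-a)], in accordance with [dirichlet_term]. *)
Definition npow (a : R) (n : nat) : R := exp (- (a * ln (INR (S n)))).

Lemma INR_S_ge_1 (n : nat) : 1 <= INR (S n).
Proof. rewrite S_INR; assert (H := pos_INR n); lra. Qed.

Lemma ln_ge_0 (x : R) : 1 <= x -> 0 <= ln x.
Proof. intros H; rewrite <- ln_1; apply ln_le; lra. Qed.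

Lemma ln_INR_S_ge_0 (n : nat) : 0 <= ln (INR (S n)).
Proof. apply ln_ge_0, INR_S_ge_1. Qed.

Lemma npow_pos (a : R) (n : nat) : 0 < npow a n.
Proof. apply exp_pos. Qed.

Lemma npow_le (a b : R) (n : nat) : a <= b -> npow b n <= npow a n.
Proof. intros H; apply exp_le_compat; assert (P := ln_INR_S_ge_0 n); nra. Qed.

Lemma npow_decr (a : R) (n : nat) : 0 <= a -> npow a (S n) <= npow a n.
Proof.
  intros H; apply exp_le_compat.
  assert (L : ln (INR (S n)) <= ln (INR (S (S n)))).
  { assert (P := INR_S_ge_1 n); apply ln_le; rewrite ?(S_INR (S n)); lra. }
  nra.
Qed.

Lemma Cmod_dirichlet_term (s : C) (n : nat) : Cmod (dirichlet_term s n) = npow (Re s) n.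
Proof.
  unfold dirichlet_term, npow; rewrite Cmod_cexp; f_equal.
  generalize (ln (INR (S n))); intros l; reim.
Qed.

Lemma cder_dirichlet_term (s : C) (n : nat) :
  cder (fun s => dirichlet_term s n) s (- (RtoC (ln (INR (S n))) * dirichlet_term s n))%C.
Proof.
  unfold dirichlet_term; set (l := RtoC (ln (INR (S n)))).
  eapply cder_eq; [| apply (cder_comp (fun s => - (s * l))%C cexp); [| apply cder_cexp]].
  2: { apply cder_opp, cder_mult; [apply cder_id | apply cder_const]. }
  cbv beta; ring.
Qed.

Lemma dirichlet_term_mult (s : C) (j k : nat) :
  dirichlet_term s (pred (S j * S k)) = (dirichlet_term s j * dirichlet_term s k)%C.
Proof.
  unfold dirichlet_term; rewrite <- cexp_plus; f_equal.
  replace (S (pred (S j * S k))) with (S j * S k)%nat by lia.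
  assert (P := INR_S_ge_1 j); assert (Q := INR_S_ge_1 k).
  rewrite mult_INR, ln_mult, RtoC_plus by lra; ring.
Qed.

(** Comparison of [(n+2)^(-a)] with the integral of [x^(-a)] over the preceding unit interval,
    phrased as the monotonicity of the primitive minus a linear function. *)
Lemma npow_step (a : R) (n : nat) : 0 <= a -> a <> 1 ->
  npow a (S n) <= (exp ((1 - a) * ln (INR (S (S n)))) - exp ((1 - a) * ln (INR (S n)))) / (1 - a).
Proof.
  intros Ha N.
  assert (Pn := INR_S_ge_1 n).
  assert (H := incr_of_derive
    (fun x => exp ((1 - a) * ln x) / (1 - a) - npow a (S n) * x)
    (fun x => exp ((1 - a) * ln x) / x - npow a (S n)) (INR (S n)) (INR (S (S n)))).
  rewrite (S_INR (S n)) in *.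
  cut (exp ((1 - a) * ln (INR (S n))) / (1 - a) - npow a (S n) * INR (S n) <=
       exp ((1 - a) * ln (INR (S n) + 1)) / (1 - a) - npow a (S n) * (INR (S n) + 1)).
  { intros G; unfold Rdiv in *; lra. }
  apply H; [lra | |].
  - intros x Hx; auto_derive; [lra | field; lra].
  - intros x Hx.
    replace (exp ((1 - a) * ln x) / x) with (exp (- (a * ln x))).
    + apply Rge_le, Rge_minus, Rle_ge, exp_le_compat.
      assert (L : ln x <= ln (INR (S (S n)))) by (apply ln_le; rewrite ?(S_INR (S n)); lra).
      nra.
    + replace ((1 - a) * ln x) with (- (a * ln x) + ln x) by ring.
      rewrite exp_plus, exp_ln by lra; field; lra.
Qed.

Lemma rsum_npow_diff (a : R) (N M : nat) : 0 <= a -> a <> 1 -> (1 <= N)%nat -> (N <= M)%nat ->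
  rsum (npow a) M - rsum (npow a) N <=
  (exp ((1 - a) * ln (INR M)) - exp ((1 - a) * ln (INR N))) / (1 - a).
Proof.
  intros Ha N1 HN L; induction L as [| M L IH].
  - unfold Rdiv; rewrite 2!Rminus_diag, Rmult_0_l; lra.
  - destruct M as [| M]; [lia |].
    assert (St := npow_step a M Ha N1); cbn [rsum] in *.
    unfold Rdiv in *; lra.
Qed.

Lemma npow_0 (a : R) : npow a 0 = 1.
Proof. unfold npow; simpl; rewrite ln_1, Rmult_0_r, Ropp_0, exp_0; auto. Qed.

Lemma rsum_npow_gt1 (a : R) (N : nat) : 1 < a -> rsum (npow a) N <= 1 + / (a - 1).
Proof.
  intros Ha; assert (P : 0 < / (a - 1)) by (apply Rinv_0_lt_compat; lra).
  destruct N as [| N]; [simpl; lra |].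
  assert (H := rsum_npow_diff a 1 (S N) ltac:(lra) ltac:(lra) (le_n 1) ltac:(lia)).
  simpl (rsum (npow a) 1) in H; rewrite npow_0 in H.
  simpl (INR 1) in H; rewrite ln_1, Rmult_0_r, exp_0 in H.
  replace ((exp ((1 - a) * ln (INR (S N))) - 1) / (1 - a))
    with ((1 - exp ((1 - a) * ln (INR (S N)))) * / (a - 1)) in H by (field; lra).
  assert (E := exp_pos ((1 - a) * ln (INR (S N)))); nra.
Qed.

Lemma rsum_npow_lt1 (a : R) (N : nat) : 0 <= a < 1 -> (1 <= N)%nat ->
  rsum (npow a) N <= exp ((1 - a) * ln (INR N)) / (1 - a).
Proof.
  intros Ha HN.
  assert (H := rsum_npow_diff a 1 N ltac:(lra) ltac:(lra) (le_n 1) HN).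
  simpl (rsum (npow a) 1) in H; rewrite npow_0 in H.
  simpl (INR 1) in H; rewrite ln_1, Rmult_0_r, exp_0 in H.
  assert (P : 1 <= / (1 - a)) by (rewrite <- Rinv_1; apply Rinv_le_contravar; lra).
  unfold Rdiv in *; lra.
Qed.

Lemma ln_le_pow (e x : R) : 0 < e -> 0 < x -> ln x <= / e * exp (e * ln x).
Proof.
  intros He Hx; assert (H := exp_ineq1_le (e * ln x)).
  apply Rmult_le_reg_l with (1 := He).
  rewrite <- Rmult_assoc, Rinv_r, Rmult_1_l by lra; lra.
Qed.

Lemma log_npow_le (a e : R) (n : nat) : 0 < e ->
  ln (INR (S n)) * npow a n <= / e * npow (a - e) n.
Proof.
  intros He; assert (P := INR_S_ge_1 n).
  assert (H := ln_le_pow e (INR (S n)) He ltac:(lra)).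
  apply Rle_trans with (/ e * exp (e * ln (INR (S n))) * npow a n).
  - apply Rmult_le_compat_r; auto; left; apply npow_pos.
  - right; unfold npow; rewrite Rmult_assoc, <- exp_plus; f_equal; f_equal; ring.
Qed.

Lemma rsum_log_npow (a : R) (N : nat) : 1 < a ->
  rsum (fun n => ln (INR (S n)) * npow a n) N <= 2 / (a - 1) * (1 + 2 / (a - 1)).
Proof.
  (* Half of the margin [a - 1] absorbs the logarithm, the other half ensures convergence. *)
  intros Ha; set (e := (a - 1) / 2).
  apply Rle_trans with (rsum (fun n => / e * npow (a - e) n) N).
  - apply rsum_le; intros n _; apply log_npow_le; unfold e; lra.
  - rewrite rsum_scal.
    assert (H := rsum_npow_gt1 (a - e) N ltac:(unfold e; lra)).
    assert (E1 : / e = 2 / (a - 1)) by (unfold e; field; lra).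
    assert (E2 : / (a - e - 1) = 2 / (a - 1)) by (unfold e; field; lra).
    rewrite E1; rewrite E2 in H.
    apply Rmult_le_compat_l; auto; left; apply Rdiv_lt_0_compat; lra.
Qed.

Definition lambda_term (s : C) (n : nat) : C :=
  (RtoC (vonMangoldt (S n)) * dirichlet_term s n)%C.

Lemma Cmod_lambda_term (s : C) (n : nat) :
  Cmod (lambda_term s n) = vonMangoldt (S n) * npow (Re s) n.
Proof.
  unfold lambda_term; rewrite Cmod_mult, Cmod_R, Cmod_dirichlet_term, Rabs_pos_eq; auto.
  apply Arithmetic.vonMangoldt_ge_0.
Qed.

Lemma Cmod_lambda_term_le (s : C) (n : nat) :
  Cmod (lambda_term s n) <= ln (INR (S n)) * npow (Re s) n.
Proof.
  rewrite Cmod_lambda_term; apply Rmult_le_compat_r; [left; apply npow_pos | apply vonMangoldt_le_log].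
Qed.

Lemma lambda_series_exists (s : C) : 1 < Re s -> exists l, cseries (lambda_term s) l.
Proof.
  intros Hs; destruct (cseries_dominated (lambda_term s)
    (fun n => ln (INR (S n)) * npow (Re s) n) (2 / (Re s - 1) * (1 + 2 / (Re s - 1)))) as [l [Hl _]].
  - apply Cmod_lambda_term_le.
  - intros n; apply rsum_log_npow, Hs.
  - exists l; auto.
Qed.

Lemma RtoC_rsum (u : nat -> R) (n : nat) : RtoC (rsum u n) = csum (fun k => RtoC (u k)) n.
Proof. induction n as [| n IH]; simpl; [auto | rewrite RtoC_plus, IH; auto]. Qed.

(** The relation between [zeta'], [zeta] and the series of [Lambda], truncated at [n <= N]. Being
    exact for each [N], it avoids rearranging a double series. *)
Lemma log_dirichlet_convolution (s : C) (N : nat) :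
  csum (fun i => RtoC (ln (INR (S i))) * dirichlet_term s i)%C N =
  csum (fun j => lambda_term s j * csum (dirichlet_term s) (div.divn N (S j)))%C N.
Proof.
  rewrite (csum_ext _ (fun i => csum (fun j =>
    RtoC (Arithmetic.divisor_term (S i) (S j)) * dirichlet_term s i) N)%C).
  2: { intros i Hi; rewrite (log_eq_sum_vonMangoldt i N Hi).
       rewrite RtoC_rsum, Cmult_comm, <- csum_scal; apply csum_ext; intros; ring. }
  rewrite csum_swap; apply csum_ext; intros j _.
  rewrite (csum_ext _ (fun i => RtoC (vonMangoldt (S j)) *
    (if div.dvdn (S j) (S i) then dirichlet_term s (pred (S i)) else RtoC 0))%C).
  2: { intros i _; rewrite Arithmetic.divisor_term_mult, RtoC_mult; simpl pred.
       destruct (div.dvdn (S j) (S i)); ring. }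
  rewrite csum_scal, (Arithmetic.csum_multiples (fun n => dirichlet_term s (pred n))) by reflexivity.
  unfold lambda_term; rewrite <- Cmult_assoc; f_equal.
  rewrite <- csum_scal; apply csum_ext; intros k _; apply (dirichlet_term_mult s j k).
Qed.

Section Zeta.

Variable zeta : C -> C.
Hypothesis zeta_series : forall s, 1 < Re s -> cseries (dirichlet_term s) (zeta s).

Lemma zeta_tail (s : C) (m : nat) : 1 < Re s -> (1 <= m)%nat ->
  Cmod (zeta s - csum (dirichlet_term s) m) <= / (Re s - 1) * exp ((1 - Re s) * ln (INR m)).
Proof.
  intros Hs Hm; apply le_epsilon; intros eps He.
  destruct (zeta_series s Hs eps He) as [N HN].
  specialize (HN (max N m) ltac:(lia)); rewrite Cmod_sub_sym in HN.
  assert (T := Cmod_triangle3 (zeta s) (csum (dirichlet_term s) (max N m)) (csum (dirichlet_term s) m)).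
  assert (U := csum_diff_bound (dirichlet_term s) (npow (Re s)) m (max N m)
    ltac:(intros; rewrite Cmod_dirichlet_term; lra) ltac:(lia)).
  assert (V := rsum_npow_diff (Re s) m (max N m) ltac:(lra) ltac:(lra) Hm ltac:(lia)).
  set (X := exp ((1 - Re s) * ln (INR (max N m)))) in *.
  assert (PX : 0 < X) by apply exp_pos.
  replace ((X - exp ((1 - Re s) * ln (INR m))) / (1 - Re s)) with
    (/ (Re s - 1) * exp ((1 - Re s) * ln (INR m)) - / (Re s - 1) * X) in V by (field; lra).
  assert (0 < / (Re s - 1) * X) by (apply Rmult_lt_0_compat; auto; apply Rinv_0_lt_compat; lra).
  lra.
Qed.

(** Termwise differentiation gives the series of [log n n^(-s)]. By the truncated convolution its
    partial sums differ from those of [Lambda] times [zeta s] only through tails of zeta, and this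
    error is [O(N^(-r))]. *)
Lemma cder_zeta_gt1 (s l : C) : 1 < Re s -> cseries (lambda_term s) l ->
  cder zeta s (- (l * zeta s))%C.
Proof.
  intros Hs Hl; set (a := Re s) in *; set (r := (a - 1) / 2).
  assert (Pr : 0 < r) by (unfold r; lra).
  destruct (weierstrass (fun n z => dirichlet_term z n) zeta s r (npow (a - r)) (1 + / (a - r - 1)))
    as [d [Hd Dz]]; auto.
  { intros n z _; eexists; apply cder_dirichlet_term. }
  { intros n z Hz; rewrite Cmod_dirichlet_term; apply npow_le.
    assert (H := re_le_Cmod (z - s)); replace (Re (z - s)) with (Re z - a) in H by (unfold a; reim).
    assert (H1 := Rle_trans _ _ _ H Hz); apply Rabs_le_between in H1; lra. }
  { intros n; apply rsum_npow_gt1; unfold r; lra. }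
  { intros z Hz; apply zeta_series.
    assert (H := re_le_Cmod (z - s)); replace (Re (z - s)) with (Re z - a) in H by (unfold a; reim).
    assert (H1 := Rle_trans _ _ _ H Hz); apply Rabs_le_between in H1; unfold r in H1; lra. }
  assert (Hd' : cseries (fun n => RtoC (ln (INR (S n))) * dirichlet_term s n)%C (- (1) * d)%C).
  { apply (cseries_ext (fun n => - (1) * Cder (fun z => dirichlet_term z n) s)%C);
      [| apply cseries_scal, Hd].
    intros n; rewrite (Cder_unique _ _ _ (cder_dirichlet_term s n)); ring. }
  replace (- (l * zeta s))%C with d; [exact Dz |].
  cut ((- (1) * d)%C = (l * zeta s)%C).
  { intros E; rewrite <- E; ring. }
  apply (cseries_unique _ _ _ Hd'); clear Dz Hd Hd'.
  set (S0 := 2 / (a - r - 1) * (1 + 2 / (a - r - 1))).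
  assert (PS0 : 0 < S0).
  { assert (0 < 2 / (a - r - 1)) by (apply Rdiv_lt_0_compat; unfold r; lra).
    apply Rmult_lt_0_compat; lra. }
  (* The tail of zeta after [m >= N/(2j)] terms is at most [m^(1-a)/(a-1)]. Of the exponent
     [a - 1 = 2r] only [r] is used, which gives [(2j/N)^r] and leaves the convergent sum of
     [log j j^(-(a-r))], bounded by [S0]. *)
  set (K := / (a - 1) * exp (r * ln 2)).
  assert (PK : 0 < K) by (apply Rmult_lt_0_compat; [apply Rinv_0_lt_compat; lra | apply exp_pos]).
  assert (Err : forall N, (1 <= N)%nat ->
    Cmod (csum (fun i => RtoC (ln (INR (S i))) * dirichlet_term s i)%C N
      - csum (lambda_term s) N * zeta s) <= K * S0 * exp (- (r * ln (INR N)))).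
  { intros N HN; rewrite log_dirichlet_convolution.
    replace (csum (fun j => lambda_term s j * csum (dirichlet_term s) (div.divn N (S j)))%C N
      - csum (lambda_term s) N * zeta s)%C with
      (csum (fun j => lambda_term s j * (csum (dirichlet_term s) (div.divn N (S j)) - zeta s))%C N).
    2: { rewrite (Cmult_comm _ (zeta s)).
         replace (csum (fun j => lambda_term s j * (csum (dirichlet_term s) (div.divn N (S j)) - zeta s))%C N)
           with (csum (fun j => lambda_term s j * csum (dirichlet_term s) (div.divn N (S j))
             + (- zeta s) * lambda_term s j)%C N) by (apply csum_ext; intros; ring).
         rewrite csum_plus, csum_scal; ring. }
    apply Rle_trans with (rsum (fun j => K * exp (- (r * ln (INR N))) *
      (ln (INR (S j)) * npow (a - r) j)) N).
    2: { rewrite rsum_scal.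
         replace (K * S0 * exp (- (r * ln (INR N)))) with (K * exp (- (r * ln (INR N))) * S0) by ring.
         apply Rmult_le_compat_l; [left; apply Rmult_lt_0_compat; auto; apply exp_pos |].
         apply rsum_log_npow; unfold r; lra. }
    assert (G : forall k, (k <= N)%nat -> Cmod (csum (fun j => lambda_term s j *
      (csum (dirichlet_term s) (div.divn N (S j)) - zeta s))%C k) <=
      rsum (fun j => K * exp (- (r * ln (INR N))) * (ln (INR (S j)) * npow (a - r) j)) k).
    { induction k as [| k IH]; intros Hk; cbn [csum rsum]; [rewrite Cmod_0; lra |].
      apply Rle_trans with (1 := Cmod_triangle _ _), Rplus_le_compat; [apply IH; lia |].
      rewrite Cmod_mult, Cmod_sub_sym.
      destruct (Arithmetic.divn_half N (S k) eq_refl (Arithmetic.leq_of_le _ _ Hk)) as [D1 D2].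
      set (m := div.divn N (S k)) in *.
      assert (Pm : (1 <= m)%nat) by (apply INR_le; exact D2).
      assert (T := zeta_tail s m Hs Pm); fold a in T.
      assert (Pk := INR_S_ge_1 k).
      assert (L : ln (INR N) <= ln 2 + ln (INR (S k)) + ln (INR m)).
      { rewrite <- 2!ln_mult by lra; apply ln_le; [apply lt_0_INR; lia | lra]. }
      assert (Lm := ln_ge_0 _ D2).
      assert (Q : exp ((1 - a) * ln (INR m)) <=
        exp (r * ln 2) * exp (r * ln (INR (S k))) * exp (- (r * ln (INR N)))).
      { rewrite <- 2!exp_plus; apply exp_le_compat.
        replace (1 - a) with (- (2 * r)) by (unfold r; field); nra. }
      apply Rle_trans with (ln (INR (S k)) * npow a k *
        (/ (a - 1) * (exp (r * ln 2) * exp (r * ln (INR (S k))) * exp (- (r * ln (INR N)))))).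
      - apply Rmult_le_compat; try apply Cmod_ge_0; [apply Cmod_lambda_term_le |].
        apply Rle_trans with (1 := T), Rmult_le_compat_l; auto; left; apply Rinv_0_lt_compat; lra.
      - right; unfold K, npow.
        replace (- ((a - r) * ln (INR (S k)))) with (- (a * ln (INR (S k))) + r * ln (INR (S k))) by ring.
        rewrite exp_plus; ring. }
    apply G; lia. }
  intros eps He.
  destruct (cseries_scal _ (zeta s) _ Hl (eps / 2)) as [N1 H1]; [lra |].
  set (y := eps / 2 / (K * S0)).
  assert (Py : 0 < y) by (apply Rdiv_lt_0_compat; [lra | apply Rmult_lt_0_compat; auto]).
  destruct (archimed (exp (- ln y / r))) as [A1 _].
  set (N2 := Z.to_nat (up (exp (- ln y / r)))).
  exists (max 1 (max N1 N2)); intros n Hn.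
  specialize (H1 n ltac:(lia)); specialize (Err n ltac:(lia)).
  rewrite csum_scal in H1.
  assert (Bn : exp (- ln y / r) < INR n).
  { apply Rlt_le_trans with (1 := Rgt_lt _ _ A1).
    apply Rle_trans with (INR N2); [| apply le_INR; lia].
    unfold N2; rewrite INR_IZR_INZ, Z2Nat.id; [lra |].
    apply le_IZR; assert (H := exp_pos (- ln y / r)); lra. }
  assert (Lt : exp (- (r * ln (INR n))) < y).
  { rewrite <- (exp_ln y) by auto; apply exp_increasing.
    assert (H : - ln y / r < ln (INR n))
      by (rewrite <- (ln_exp (- ln y / r)); apply ln_increasing; [apply exp_pos | auto]).
    apply Rlt_div_l in H; lra. }
  assert (E2 : K * S0 * exp (- (r * ln (INR n))) < eps / 2).
  { assert (PKS : 0 < K * S0) by (apply Rmult_lt_0_compat; auto).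
    apply Rlt_le_trans with (K * S0 * y); [apply Rmult_lt_compat_l; auto |].
    right; unfold y; field; lra. }
  assert (T := Cmod_triangle3 (csum (fun i => RtoC (ln (INR (S i))) * dirichlet_term s i)%C n)
    (csum (lambda_term s) n * zeta s) (l * zeta s)).
  replace (csum (lambda_term s) n * zeta s - l * zeta s)%C with
    (zeta s * csum (lambda_term s) n - zeta s * l)%C in T by ring.
  lra.
Qed.

End Zeta.

Lemma is_derive_ln_Cmod (F : R -> C) (x : R) (l : C) : rder F x l -> F x <> 0%C ->
  is_derive (fun t => ln (Cmod (F t))) x (Re (l / F x)).
Proof.
  intros H N.
  assert (H1 := rder_Re _ _ _ H); assert (H2 := rder_Im _ _ _ H).
  apply Cmod_gt_0 in N.
  assert (P : 0 < Re (F x) ^ 2 + Im (F x) ^ 2) by (rewrite <- Cmod_sq; apply pow_lt; auto).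
  apply (is_derive_ext (fun t => ln (sqrt (Re (F t) ^ 2 + Im (F t) ^ 2)))); [reflexivity |].
  assert (G : forall u v : R -> R, is_derive u x (Re l) -> is_derive v x (Im l) ->
    0 < u x ^ 2 + v x ^ 2 ->
    is_derive (fun t => ln (sqrt (u t ^ 2 + v t ^ 2))) x
      ((Re l * u x + Im l * v x) / (u x ^ 2 + v x ^ 2))).
  { intros u v Hu Hv Huv; assert (Q := sqrt_lt_R0 _ Huv).
    assert (QE : sqrt (u x ^ 2 + v x ^ 2) * sqrt (u x ^ 2 + v x ^ 2) = u x ^ 2 + v x ^ 2)
      by (apply sqrt_sqrt; lra).
    auto_derive.
    - replace (u x * (u x * 1) + v x * (v x * 1)) with (u x ^ 2 + v x ^ 2) by ring.
      split; [exists (Re l); auto |]; split; [exists (Im l); auto | auto].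
    - assert (U1 : Derive u x = Re l) by (apply is_derive_unique, Hu).
      assert (U2 : Derive v x = Im l) by (apply is_derive_unique, Hv).
      change (Derive (fun t => u t) x) with (Derive u x).
      change (Derive (fun t => v t) x) with (Derive v x).
      rewrite U1, U2.
      replace (u x * (u x * 1) + v x * (v x * 1)) with (u x ^ 2 + v x ^ 2) by ring.
      set (s := sqrt (u x ^ 2 + v x ^ 2)) in *; rewrite <- QE; field; lra. }
  replace (Re (l / F x)) with
    ((Re l * Re (F x) + Im l * Im (F x)) / (Re (F x) ^ 2 + Im (F x) ^ 2)).
  - apply (G (fun t => Re (F t)) (fun t => Im (F t))); auto.
  - unfold Cdiv; rewrite re_mult, Re_inv, Im_inv; field; lra.
Qed.

Section ZetaNonvanishing.

Variable zeta : C -> C.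
Hypothesis zeta_series : forall s, 1 < Re s -> cseries (dirichlet_term s) (zeta s).

(** The first term is 1, the second at most 1/4 and the remaining tail at most 1/2. *)
Lemma zeta_ge2_lower (s : C) : 2 <= Re s -> 1 / 4 <= Cmod (zeta s).
Proof.
  intros Hs; assert (T := zeta_tail zeta zeta_series s 2 ltac:(lra) ltac:(lia)).
  set (l2 := ln 2).
  assert (P2 : 0 < l2) by (unfold l2; rewrite <- ln_1; apply ln_increasing; lra).
  assert (E2 : exp l2 = 2) by (apply exp_ln; lra).
  assert (E0 : dirichlet_term s 0 = 1%C).
  { unfold dirichlet_term; simpl INR; rewrite ln_1, <- cexp_0; f_equal; ring. }
  assert (M1 : Cmod (dirichlet_term s 1) <= 1 / 4).
  { rewrite Cmod_dirichlet_term; unfold npow; change (INR 2) with 2; fold l2.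
    replace (1 / 4) with (exp (- (2 * l2))).
    - apply exp_le_compat; nra.
    - rewrite exp_Ropp; replace (2 * l2) with (l2 + l2) by ring; rewrite exp_plus, E2; field. }
  change (INR 2) with 2 in T; fold l2 in T.
  assert (M2 : / (Re s - 1) * exp ((1 - Re s) * l2) <= 1 * (1 / 2)).
  { apply Rmult_le_compat.
    - left; apply Rinv_0_lt_compat; lra.
    - left; apply exp_pos.
    - rewrite <- Rinv_1; apply Rinv_le_contravar; lra.
    - replace (1 / 2) with (exp (- l2)) by (rewrite exp_Ropp, E2; field).
      apply exp_le_compat; nra. }
  simpl csum in T; rewrite E0 in T.
  assert (T1 := Cmod_triangle_rev 1 (- (zeta s - (0 + 1 + dirichlet_term s 1) + dirichlet_term s 1))%C).
  replace (1 - - (zeta s - (0 + 1 + dirichlet_term s 1) + dirichlet_term s 1))%C with (zeta s) in T1 by ring.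
  rewrite Cmod_opp, Cmod_1 in T1.
  assert (T2 := Cmod_triangle (zeta s - (0 + 1 + dirichlet_term s 1)) (dirichlet_term s 1)).
  lra.
Qed.

Lemma zeta_le (s : C) : 1 < Re s -> Cmod (zeta s) <= 1 + / (Re s - 1).
Proof.
  intros Hs; apply (cseries_bound _ _ _ (zeta_series s Hs)); intros n.
  assert (H := csum_diff_bound (dirichlet_term s) (npow (Re s)) 0 n
    ltac:(intros; rewrite Cmod_dirichlet_term; lra) ltac:(lia)).
  simpl (csum _ 0) in H; simpl (rsum _ 0) in H.
  replace (csum (dirichlet_term s) n - 0)%C with (csum (dirichlet_term s) n) in H by ring.
  assert (H1 := rsum_npow_gt1 (Re s) n Hs); lra.
Qed.

Lemma lambda_series_bound (s l : C) : 1 < Re s -> cseries (lambda_term s) l ->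
  Cmod l <= 2 / (Re s - 1) * (1 + 2 / (Re s - 1)).
Proof.
  intros Hs Hl; apply (cseries_bound _ _ _ Hl); intros n.
  assert (H := csum_diff_bound (lambda_term s) _ 0 n (Cmod_lambda_term_le s) ltac:(lia)).
  simpl (csum _ 0) in H; simpl (rsum _ 0) in H.
  replace (csum (lambda_term s) n - 0)%C with (csum (lambda_term s) n) in H by ring.
  assert (H1 := rsum_log_npow (Re s) n Hs); lra.
Qed.

(** This is [-zeta'/zeta] for [Re s > 1], and an arbitrary value where the series diverges. *)
Definition lambda_sum (s : C) : C := epsilon (inhabits (RtoC 0)) (cseries (lambda_term s)).

Lemma lambda_sum_correct (s : C) : 1 < Re s -> cseries (lambda_term s) (lambda_sum s).
Proof.
  intros Hs; exact (epsilon_spec (inhabits (RtoC 0)) (cseries (lambda_term s)) (lambda_series_exists s Hs)).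
Qed.

Lemma cder_zeta_lambda (s : C) : 1 < Re s -> cder zeta s (- (lambda_sum s * zeta s))%C.
Proof. intros Hs; apply cder_zeta_gt1; auto; apply lambda_sum_correct, Hs. Qed.

(* A zero would propagate to the right along [zeta' = - lambda_sum * zeta]. *)
Lemma zeta_neq_0_gt1 (s : C) : 1 < Re s -> zeta s <> 0%C.
Proof.
  intros Hs E.
  destruct (Rle_dec 2 (Re s)) as [L | L].
  { assert (H := zeta_ge2_lower s L); rewrite E, Cmod_0 in H; lra. }
  destruct s as [a y]; simpl in Hs, L.
  set (K := 2 / (a - 1) * (1 + 2 / (a - 1))).
  assert (Bd : forall x, a <= x <= 2 -> Cmod (lambda_sum (x, y)) <= K).
  { intros x Hx.
    apply Rle_trans with (1 := lambda_series_bound (x, y) _ ltac:(simpl; lra) (lambda_sum_correct (x, y) ltac:(simpl; lra))).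
    simpl; unfold K.
    assert (I : / (x - 1) <= / (a - 1)) by (apply Rinv_le_contravar; lra).
    assert (I0 : 0 < / (x - 1)) by (apply Rinv_0_lt_compat; lra).
    unfold Rdiv; nra. }
  (* Gronwall's argument: as [|lambda_sum| <= K] on the segment, [|zeta|^2 e^(-2Kx)] does not
     increase up to [x = 2], where it is positive. *)
  set (N := fun x => Re (zeta (x, y)) ^ 2 + Im (zeta (x, y)) ^ 2).
  assert (H := incr_of_derive (fun x => - (N x * exp (- (2 * K * x))))
    (fun x => (2 * K + 2 * Re (lambda_sum (x, y))) * N x * exp (- (2 * K * x))) a 2 ltac:(lra)).
  assert (G : - (N a * exp (- (2 * K * a))) <= - (N 2 * exp (- (2 * K * 2)))).
  { apply H.
    - intros x Hx.
      assert (D := rder_hline zeta x y _ (cder_zeta_lambda (x, y) ltac:(simpl; lra))).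
      assert (D1 := rder_Re _ _ _ D); assert (D2 := rder_Im _ _ _ D); cbv beta in D1, D2.
      assert (Gen : forall (u v : R -> R) u' v', is_derive u x u' -> is_derive v x v' ->
        is_derive (fun t => - ((u t ^ 2 + v t ^ 2) * exp (- (2 * K * t)))) x
          (2 * (K * (u x ^ 2 + v x ^ 2) - u x * u' - v x * v') * exp (- (2 * K * x)))).
      { intros u v u' v' Hu Hv; auto_derive.
        - split; [exists u'; auto |]; split; [exists v'; auto | auto].
        - change (Derive (fun t => u t) x) with (Derive u x).
          change (Derive (fun t => v t) x) with (Derive v x).
          rewrite (is_derive_unique u x u' Hu), (is_derive_unique v x v' Hv); ring. }
      assert (D3 := Gen _ _ _ _ D1 D2); cbv beta in D3.
      replace ((2 * K + 2 * Re (lambda_sum (x, y))) * N x * exp (- (2 * K * x))) with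
        (2 * (K * (Re (zeta (x, y)) ^ 2 + Im (zeta (x, y)) ^ 2) -
          Re (zeta (x, y)) * Re (- (lambda_sum (x, y) * zeta (x, y))) -
          Im (zeta (x, y)) * Im (- (lambda_sum (x, y) * zeta (x, y)))) * exp (- (2 * K * x)));
        [exact D3 |].
      unfold N; generalize (lambda_sum (x, y)), (zeta (x, y)); intros l z; reim.
    - intros x Hx; specialize (Bd x Hx).
      assert (R1 := Rle_trans _ _ _ (re_le_Cmod (lambda_sum (x, y))) Bd); apply Rabs_le_between in R1.
      apply Rmult_le_pos; [| left; apply exp_pos].
      apply Rmult_le_pos; [lra |].
      unfold N; assert (H1 := pow2_ge_0 (Re (zeta (x, y)))); assert (H2 := pow2_ge_0 (Im (zeta (x, y)))); lra. }
  unfold N in G; rewrite E in G; simpl (Re 0) in G; simpl (Im 0) in G.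
  assert (Q := zeta_ge2_lower (2, y) ltac:(simpl; lra)).
  assert (Q2 : 0 < Cmod (zeta (2, y)) ^ 2) by (apply pow_lt; lra).
  rewrite Cmod_sq in Q2.
  assert (X := exp_pos (- (2 * K * 2))).
  assert (0 < (Re (zeta (2, y)) ^ 2 + Im (zeta (2, y)) ^ 2) * exp (- (2 * K * 2)))
    by (apply Rmult_lt_0_compat; auto).
  replace ((0 ^ 2 + 0 ^ 2) * exp (- (2 * K * a))) with 0 in G by ring.
  lra.
Qed.

End ZetaNonvanishing.

(** * Zeta in the strip *)

Lemma Re_csum (a : nat -> C) (n : nat) : Re (csum a n) = rsum (fun k => Re (a k)) n.
Proof. induction n as [| n IH]; cbn [csum rsum]; [auto | rewrite re_plus, IH; auto]. Qed.

Lemma cseries_Re_ge_0 (a : nat -> C) (l : C) :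
  cseries a l -> (forall k, 0 <= Re (a k)) -> 0 <= Re l.
Proof.
  intros H P; apply le_epsilon; intros eps He; destruct (H eps He) as [N HN].
  specialize (HN N (le_n N)).
  assert (R1 := Rle_lt_trans _ _ _ (re_le_Cmod _) HN).
  replace (Re (csum a N - l)) with (Re (csum a N) - Re l) in R1 by reim.
  apply Rabs_lt_between in R1.
  assert (0 <= Re (csum a N)).
  { rewrite Re_csum; clear R1 HN; induction N as [| N IH]; cbn [rsum]; [lra | specialize (P N); lra]. }
  lra.
Qed.

(** * Non-vanishing on the line of real part 1 *)

Lemma Re_lambda_term (x y : R) (n : nat) :
  Re (lambda_term (x, y) n) = vonMangoldt (S n) * npow x n * cos (y * ln (INR (S n))).
Proof.
  unfold lambda_term, dirichlet_term, npow, cexp; set (v := vonMangoldt (S n)).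
  generalize (ln (INR (S n))); intros l.
  replace (Re (- ((x, y) * RtoC l))) with (- (x * l)) by reim.
  replace (Im (- ((x, y) * RtoC l))) with (- (y * l)) by reim.
  rewrite cos_neg, sin_neg; reim.
Qed.

(** The expression is [2 (1 + cos t)^2]. Its coefficients matter later: a zero counted 4 times
    outweighs a pole counted 3 times. *)
Lemma three_four_one (t : R) : 0 <= 3 + 4 * cos t + cos (2 * t).
Proof.
  rewrite cos_2a_cos; assert (H := pow2_ge_0 (1 + cos t)); lra.
Qed.

Lemma lambda_sum_341 (x y : R) : 1 < x ->
  0 <= 3 * Re (lambda_sum (x, 0)) + 4 * Re (lambda_sum (x, y)) + Re (lambda_sum (x, 2 * y)).
Proof.
  intros Hx.
  assert (H0 := lambda_sum_correct (x, 0) ltac:(simpl; lra)).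
  assert (H1 := lambda_sum_correct (x, y) ltac:(simpl; lra)).
  assert (H2 := lambda_sum_correct (x, 2 * y) ltac:(simpl; lra)).
  assert (H := cseries_plus _ _ _ _ (cseries_plus _ _ _ _ (cseries_scal _ 3 _ H0) (cseries_scal _ 4 _ H1)) H2).
  apply cseries_Re_ge_0 in H.
  - rewrite 2!re_plus, 2!re_scal_l in H; exact H.
  - intros k; rewrite 2!re_plus, 2!re_scal_l, 3!Re_lambda_term.
    rewrite Rmult_0_l, cos_0, Rmult_assoc.
    assert (P := three_four_one (y * ln (INR (S k)))).
    assert (V := Arithmetic.vonMangoldt_ge_0 (S k)); assert (N := npow_pos x k).
    assert (0 <= vonMangoldt (S k) * npow x k) by (apply Rmult_le_pos; lra).
    replace (2 * y * ln (INR (S k))) with (2 * (y * ln (INR (S k)))) by ring.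
    nra.
Qed.

Section ZetaStrip.

Variable zeta : C -> C.
Hypothesis zeta_series : forall s, 1 < Re s -> cseries (dirichlet_term s) (zeta s).
Hypothesis zeta_holo : forall s : C, s <> RtoC 1 -> exists l, cder zeta s l.

Lemma is_derive_ln_zeta (x y : R) : 1 < x ->
  is_derive (fun t => ln (Cmod (zeta (t, y)))) x (- Re (lambda_sum (x, y))).
Proof.
  intros Hx.
  assert (N := zeta_neq_0_gt1 zeta zeta_series (x, y) Hx).
  assert (D := rder_hline zeta x y _ (cder_zeta_lambda zeta zeta_series (x, y) Hx)).
  replace (- Re (lambda_sum (x, y))) with (Re (- (lambda_sum (x, y) * zeta (x, y)) / zeta (x, y))).
  - apply is_derive_ln_Cmod; auto.
  - replace (- (lambda_sum (x, y) * zeta (x, y)) / zeta (x, y))%C with (- lambda_sum (x, y))%C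
      by (field; auto); reim.
Qed.

(** The combination of logarithms does not increase with [x], by [lambda_sum_341]; at [x = 2] the
    lower bound 1/4 for zeta is used [3 + 4 + 1 = 8] times. *)
Lemma zeta_341_ge (x y : R) : 1 < x -> x <= 2 ->
  - 8 * ln 4 <= 3 * ln (Cmod (zeta (x, 0))) + 4 * ln (Cmod (zeta (x, y))) + ln (Cmod (zeta (x, 2 * y))).
Proof.
  intros Hx Hx2.
  assert (H := incr_of_derive
    (fun t => - (3 * ln (Cmod (zeta (t, 0))) + 4 * ln (Cmod (zeta (t, y))) + ln (Cmod (zeta (t, 2 * y)))))
    (fun t => 3 * Re (lambda_sum (t, 0)) + 4 * Re (lambda_sum (t, y)) + Re (lambda_sum (t, 2 * y))) x 2 Hx2).
  assert (G : - (3 * ln (Cmod (zeta (x, 0))) + 4 * ln (Cmod (zeta (x, y))) + ln (Cmod (zeta (x, 2 * y)))) <=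
    - (3 * ln (Cmod (zeta (2, 0))) + 4 * ln (Cmod (zeta (2, y))) + ln (Cmod (zeta (2, 2 * y))))).
  { apply H.
    - intros t Ht.
      assert (D0 := is_derive_ln_zeta t 0 ltac:(lra)); assert (D1 := is_derive_ln_zeta t y ltac:(lra)).
      assert (D2 := is_derive_ln_zeta t (2 * y) ltac:(lra)).
      assert (Gen : forall (u v w : R -> R) u' v' w', is_derive u t u' -> is_derive v t v' ->
        is_derive w t w' -> is_derive (fun t => - (3 * u t + 4 * v t + w t)) t (- (3 * u' + 4 * v' + w'))).
      { intros u v w u' v' w' Hu Hv Hw; auto_derive.
        - split; [exists u'; auto |]; split; [exists v'; auto |]; split; [exists w'; auto | auto].
        - change (Derive (fun t => u t) t) with (Derive u t).
          change (Derive (fun t => v t) t) with (Derive v t).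
          change (Derive (fun t => w t) t) with (Derive w t).
          rewrite (is_derive_unique u t u' Hu), (is_derive_unique v t v' Hv), (is_derive_unique w t w' Hw); ring. }
      assert (D3 := Gen _ _ _ _ _ _ D0 D1 D2); cbv beta in D3.
      replace (3 * Re (lambda_sum (t, 0)) + 4 * Re (lambda_sum (t, y)) + Re (lambda_sum (t, 2 * y))) with
        (- (3 * - Re (lambda_sum (t, 0)) + 4 * - Re (lambda_sum (t, y)) + - Re (lambda_sum (t, 2 * y))))
        by ring; exact D3.
    - intros t Ht; apply lambda_sum_341; lra. }
  assert (L : forall v, - ln 4 <= ln (Cmod (zeta (2, v)))).
  { intros v; rewrite <- ln_Rinv by lra; apply ln_le; [lra |].
    assert (Q := zeta_ge2_lower zeta zeta_series (2, v) ltac:(simpl; lra)); lra. }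
  assert (L0 := L 0); assert (L1 := L y); assert (L2 := L (2 * y)); lra.
Qed.

(** The Riemann hypothesis speaks of the open strip only. At distance [e] to the right of a zero,
    the product in [zeta_341_ge] would be [O(e^(-3) e^4)], which tends to 0. *)
Lemma zeta_neq_0_line1 (y : R) : y <> 0 -> zeta (1, y) <> 0%C.
Proof.
  intros Hy E.
  assert (N1 : ((1, y) : C) <> 1%C) by (intros H; injection H; auto).
  assert (N2 : ((1, 2 * y) : C) <> 1%C) by (intros H; injection H; intros; lra).
  destruct (zeta_holo (1, y) N1) as [l Hl]; destruct (zeta_holo (1, 2 * y) N2) as [m Hm].
  destruct (cder_eps zeta (1, y) l Hl 1) as [d [Hd K]]; [lra |].
  destruct (ccont_bounded zeta (1, 2 * y) (cder_ccont _ _ _ Hm)) as [d' [Hd' B]].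
  set (C2 := Cmod l + 1); set (C3 := Cmod (zeta (1, 2 * y)) + 1) in *.
  assert (P2 : 0 < C2) by (assert (H := Cmod_ge_0 l); unfold C2; lra).
  assert (P3 : 0 < C3) by (assert (H := Cmod_ge_0 (zeta (1, 2 * y))); unfold C3; lra).
  (* The three upper bounds below turn [zeta_341_ge] into [Q <= ln e], which fails for
     [e <= exp (Q - 1)]. *)
  set (Q := - 8 * ln 4 - 3 * ln 2 - 4 * ln C2 - ln C3).
  set (e := Rmin (Rmin 1 (Rmin (d / 2) (d' / 2))) (exp (Q - 1))).
  assert (PX := exp_pos (Q - 1)).
  assert (Pe : 0 < e) by (repeat apply Rmin_glb_lt; lra).
  assert (E1 : e <= 1) by (unfold e; apply Rle_trans with (1 := Rmin_l _ _), Rmin_l).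
  assert (E2 : e <= d / 2).
  { unfold e; apply Rle_trans with (1 := Rmin_l _ _), Rle_trans with (1 := Rmin_r _ _), Rmin_l. }
  assert (E3 : e <= d' / 2).
  { unfold e; apply Rle_trans with (1 := Rmin_l _ _), Rle_trans with (1 := Rmin_r _ _), Rmin_r. }
  assert (E4 : e <= exp (Q - 1)) by apply Rmin_r.
  assert (G := zeta_341_ge (1 + e) y ltac:(lra) ltac:(lra)).
  assert (Sub : forall v : R, (((1 + e)%R, v) - (1, v))%C = RtoC e) by (intros; apply Ceq; simpl; ring).
  assert (M : forall v : R, Cmod (((1 + e)%R, v) - (1, v)) = e)
    by (intros; rewrite Sub, Cmod_R, Rabs_pos_eq; lra).
  assert (Pos : forall v, 0 < Cmod (zeta (1 + e, v)))
    by (intros v; apply Cmod_gt_0, zeta_neq_0_gt1; auto; simpl; lra).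
  assert (A1 : ln (Cmod (zeta (1 + e, 0))) <= ln 2 - ln e).
  { rewrite <- ln_div by lra; apply ln_le; auto.
    apply Rle_trans with (1 := zeta_le zeta zeta_series (1 + e, 0) ltac:(simpl; lra)).
    simpl; replace (1 + e - 1) with e by ring.
    assert (1 <= / e) by (rewrite <- Rinv_1; apply Rinv_le_contravar; lra).
    unfold Rdiv; lra. }
  assert (A2 : ln (Cmod (zeta (1 + e, y))) <= ln C2 + ln e).
  { rewrite <- ln_mult by auto; apply ln_le; auto.
    specialize (K (1 + e, y) ltac:(rewrite M; lra)); rewrite M, E, Sub in K.
    set (w := zeta (1 + e, y)) in *.
    replace w with ((w - 0 - l * RtoC e) + l * RtoC e)%C by ring.
    apply Rle_trans with (1 := Cmod_triangle _ _).
    rewrite (Cmod_mult l), Cmod_R, (Rabs_pos_eq e) by lra; unfold C2; lra. }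
  assert (A3 : ln (Cmod (zeta (1 + e, 2 * y))) <= ln C3).
  { apply ln_le; auto; left; apply B; rewrite M; lra. }
  assert (A4 : ln e <= Q - 1) by (rewrite <- (ln_exp (Q - 1)); apply ln_le; auto).
  unfold Q in A4; lra.
Qed.

(* [(n+1)^(-s) - int_(n+1)^(n+2) x^(-s) dx]; summing over [n] continues [zeta s - 1/(s-1)]
   to the half-plane [Re s > 0]. *)
Definition em_term (s : C) (n : nat) : C :=
  (dirichlet_term s n - (cexp ((1 - s) * RtoC (ln (INR (S (S n))))) -
    cexp ((1 - s) * RtoC (ln (INR (S n))))) / (1 - s))%C.

Lemma rder_cexp_ln (w : C) (x : R) : 0 < x ->
  rder (fun t => cexp (w * RtoC (ln t))) x (cexp (w * RtoC (ln x)) * (w * RtoC (/ x)))%C.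
Proof.
  intros Hx; apply (rder_comp cexp (fun t => w * RtoC (ln t))%C); [| apply cder_cexp].
  destruct w as [a b]; apply rder_of_components; simpl; auto_derive; auto; field; lra.
Qed.

(** Two mean value inequalities: [x^(-s)] moves by at most [|s| m^(-Re s - 1)] over the unit
    interval from [m = n + 1], and so does its average from its value at [m]. The gain of one power
    gives convergence for [Re s > 0]. *)
Lemma em_term_bound (s : C) (n : nat) : 0 < Re s -> s <> 1%C ->
  Cmod (em_term s n) <= Cmod s * npow (Re s + 1) n.
Proof.
  intros Hs N1.
  assert (Pm := INR_S_ge_1 n); unfold em_term, dirichlet_term.
  assert (Em : INR (S (S n)) = INR (S n) + 1) by apply S_INR.
  rewrite Em; set (m := INR (S n)) in *.
  assert (Nz : (1 - s)%C <> 0%C) by (apply Csub_neq; auto).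
  set (K := Cmod s * npow (Re s + 1) n).
  assert (PK : 0 <= K) by (apply Rmult_le_pos; [apply Cmod_ge_0 | left; apply npow_pos]).
  assert (Db : forall x, m <= x <= m + 1 -> Cmod (cexp (- s * RtoC (ln x)) * (- s * RtoC (/ x))) <= K).
  { intros x Hx; rewrite 2!Cmod_mult, Cmod_opp, Cmod_R, Cmod_cexp, Rabs_pos_eq
      by (left; apply Rinv_0_lt_compat; lra).
    replace (exp (Re (- s * RtoC (ln x))) * (Cmod s * / x)) with
      (Cmod s * exp (- ((Re s + 1) * ln x))).
    - apply Rmult_le_compat_l; [apply Cmod_ge_0 |]; apply exp_le_compat.
      assert (L : ln m <= ln x) by (apply ln_le; lra); fold m; nra.
    - replace (Re (- s * RtoC (ln x))) with (- (Re s * ln x)) by reim.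
      replace (- ((Re s + 1) * ln x)) with (- (Re s * ln x) + - ln x) by ring.
      rewrite exp_plus, (exp_Ropp (ln x)), exp_ln by lra; ring. }
  assert (D1 : forall x, m <= x <= m + 1 ->
    Cmod (cexp (- s * RtoC (ln x)) - cexp (- s * RtoC (ln m))) <= K).
  { intros x Hx.
    assert (H := mean_value_ineq (fun t => cexp (- s * RtoC (ln t)))
      (fun t => cexp (- s * RtoC (ln t)) * (- s * RtoC (/ t)))%C (fun t => K * t) (fun _ => K) m x).
    apply Rle_trans with (K * x - K * m); [| nra].
    apply H; [lra | | |].
    - intros t Ht; apply rder_cexp_ln; lra.
    - intros t Ht; auto_derive; [auto | ring].
    - intros t Ht; apply Db; lra. }
  (* The function is [(t - m) m^(-s) - t^(1-s)/(1-s)]; its increment from [m] to [m + 1] is the term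
     to be bounded. *)
  assert (H := mean_value_ineq
    (fun t => (cexp (- s * RtoC (ln m)) * - RtoC m + RtoC t * cexp (- s * RtoC (ln m))) -
      / (1 - s) * cexp ((1 - s) * RtoC (ln t)))%C
    (fun t => cexp (- s * RtoC (ln m)) - / (1 - s) * (cexp ((1 - s) * RtoC (ln t)) * ((1 - s) * RtoC (/ t))))%C
    (fun t => K * t) (fun _ => K) m (m + 1)).
  cbv beta in H.
  replace (K * (m + 1) - K * m) with K in H by ring.
  eapply Rle_trans; [| apply H].
  - right; f_equal.
    replace (- (s * RtoC (ln m)))%C with (- s * RtoC (ln m))%C by ring.
    rewrite RtoC_plus; field; auto.
  - lra.
  - intros t Ht; apply rder_minus; [apply rder_affine |].
    apply (rder_comp (fun w => / (1 - s) * w)%C (fun t => cexp ((1 - s) * RtoC (ln t))));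
      [apply rder_cexp_ln; lra |].
    eapply cder_eq; [| apply cder_scal, cder_id]; ring.
  - intros t Ht; auto_derive; [auto | ring].
  - intros t Ht; rewrite Cmod_sub_sym.
    replace (/ (1 - s) * (cexp ((1 - s) * RtoC (ln t)) * ((1 - s) * RtoC (/ t))))%C
      with (cexp (- s * RtoC (ln t))); [apply D1; lra |].
    replace ((1 - s) * RtoC (ln t))%C with (- s * RtoC (ln t) + RtoC (ln t))%C by ring.
    rewrite cexp_plus.
    replace (cexp (RtoC (ln t))) with (RtoC t).
    + rewrite RtoC_inv by lra; field; split; auto; apply RtoC_neq; lra.
    + apply Ceq; unfold cexp; simpl; [rewrite cos_0 | rewrite sin_0]; rewrite ?exp_ln by lra; ring.
Qed.

Lemma em_term_holo (n : nat) (s : C) : s <> 1%C -> exists l, cder (fun z => em_term z n) s l.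
Proof.
  intros N1; unfold em_term.
  assert (D : forall c, cder (fun z => cexp ((1 - z) * c)) s (cexp ((1 - s) * c) * (- c))%C).
  { intros c; apply (cder_comp (fun z => (1 - z) * c)%C cexp); [| apply cder_cexp].
    eapply cder_eq; [| apply cder_mult; [apply cder_minus; [apply cder_const | apply cder_id] | apply cder_const]].
    cbv beta; ring. }
  eexists; apply cder_minus; [apply cder_dirichlet_term |].
  apply cder_div; [apply cder_minus; apply D | | apply Csub_neq; auto].
  apply cder_minus; [apply cder_const | apply cder_id].
Qed.

Lemma csum_em_term (s : C) (N : nat) : s <> 1%C ->
  csum (em_term s) N = (csum (dirichlet_term s) N -
    (cexp ((1 - s) * RtoC (ln (INR (S N)))) - 1) / (1 - s))%C.
Proof.
  intros N1; assert (Nz : (1 - s)%C <> 0%C) by (apply Csub_neq; auto).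
  induction N as [| N IH]; cbn [csum].
  - simpl INR; rewrite ln_1; replace ((1 - s) * 0)%C with (RtoC 0) by ring; rewrite cexp_0.
    field; auto.
  - rewrite IH; unfold em_term; field; auto.
Qed.

Lemma pow_neg_to_0 (a eps : R) : a < 0 -> 0 < eps ->
  exists N, forall n, (N <= n)%nat -> exp (a * ln (INR (S n))) < eps.
Proof.
  intros Ha He.
  destruct (archimed (exp (ln eps / a))) as [A1 _].
  assert (X := exp_pos (ln eps / a)).
  exists (Z.to_nat (up (exp (ln eps / a)))); intros n Hn.
  assert (Bn : exp (ln eps / a) < INR (S n)).
  { apply Rlt_le_trans with (1 := Rgt_lt _ _ A1).
    apply Rle_trans with (INR (Z.to_nat (up (exp (ln eps / a))))); [| apply le_INR; lia].
    rewrite INR_IZR_INZ, Z2Nat.id; [lra | apply le_IZR; lra]. }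
  apply Rlt_le_trans with (exp (ln eps)); [apply exp_increasing | rewrite exp_ln; lra].
  assert (L : ln eps / a < ln (INR (S n)))
    by (rewrite <- (ln_exp (ln eps / a)); apply ln_increasing; auto).
  replace (ln eps) with (a * (ln eps / a)) by (field; lra).
  apply Rmult_lt_gt_compat_neg_l; auto.
Qed.

(** The integrals telescope, and the boundary term [(N+1)^(1-s)/(1-s)] tends to 0. *)
Lemma em_series_gt1 (s : C) : 1 < Re s -> cseries (em_term s) (zeta s - / (s - 1))%C.
Proof.
  intros Hs eps He.
  assert (N1 : s <> 1%C) by (intros ->; simpl in Hs; lra).
  assert (Nz : (1 - s)%C <> 0%C) by (apply Csub_neq; auto).
  assert (Nz' : (s - 1)%C <> 0%C) by (apply Csub_neq; auto).
  assert (Pm : 0 < Cmod (1 - s)) by (apply Cmod_gt_0; auto).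
  destruct (zeta_series s Hs (eps / 2)) as [M1 H1]; [lra |].
  destruct (pow_neg_to_0 (1 - Re s) (eps / 2 * Cmod (1 - s))) as [M2 H2]; [lra | |].
  { apply Rmult_lt_0_compat; lra. }
  exists (max M1 M2); intros n Hn; specialize (H1 n ltac:(lia)); specialize (H2 n ltac:(lia)).
  rewrite csum_em_term by auto.
  set (w := cexp ((1 - s) * RtoC (ln (INR (S n))))).
  replace (csum (dirichlet_term s) n - (w - 1) / (1 - s) - (zeta s - / (s - 1)))%C
    with ((csum (dirichlet_term s) n - zeta s) - w / (1 - s))%C by (field; auto).
  apply Rle_lt_trans with (1 := Cmod_triangle_sub _ _).
  assert (Q : Cmod (w / (1 - s)) < eps / 2).
  { rewrite Cmod_div by auto; apply Rlt_div_l; auto.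
    unfold w; rewrite Cmod_cexp.
    replace (Re ((1 - s) * RtoC (ln (INR (S n))))) with ((1 - Re s) * ln (INR (S n))); auto.
    generalize (ln (INR (S n))); intros l; reim. }
  lra.
Qed.

Definition em_sum (s : C) : C := epsilon (inhabits (RtoC 0)) (cseries (em_term s)).

Lemma em_sum_correct (s : C) : 0 < Re s -> s <> 1%C -> cseries (em_term s) (em_sum s).
Proof.
  intros Hs N1.
  assert (H : exists l, cseries (em_term s) l).
  { destruct (cseries_dominated (em_term s) (fun n => Cmod s * npow (Re s + 1) n)
      (Cmod s * (1 + / (Re s + 1 - 1)))) as [l [Hl _]].
    - intros n; apply em_term_bound; auto.
    - intros n; rewrite rsum_scal; apply Rmult_le_compat_l; [apply Cmod_ge_0 |].
      apply rsum_npow_gt1; lra.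
    - exists l; auto. }
  exact (epsilon_spec (inhabits (RtoC 0)) (cseries (em_term s)) H).
Qed.

Lemma em_sum_bound (s : C) : 0 < Re s -> s <> 1%C -> Cmod (em_sum s) <= Cmod s * (1 + / Re s).
Proof.
  intros Hs N1; apply (cseries_bound _ _ _ (em_sum_correct s Hs N1)); intros n.
  assert (H := csum_diff_bound (em_term s) (fun n => Cmod s * npow (Re s + 1) n) 0 n
    ltac:(intros; apply em_term_bound; auto) ltac:(lia)).
  simpl (csum _ 0) in H; simpl (rsum _ 0) in H.
  replace (csum (em_term s) n - 0)%C with (csum (em_term s) n) in H by ring.
  rewrite rsum_scal in H.
  assert (H1 := rsum_npow_gt1 (Re s + 1) n ltac:(lra)).
  replace (Re s + 1 - 1) with (Re s) in H1 by ring.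
  assert (P := Cmod_ge_0 s); nra.
Qed.

Lemma em_sum_holo (s : C) : 0 < Re s -> s <> 1%C -> exists l, cder em_sum s l.
Proof.
  intros Hs N1; assert (P1 := Cmod_sub_gt0 s 1 N1).
  set (r := Rmin (Re s) (Cmod (s - 1)) / 2).
  assert (Pr0 : 0 < Rmin (Re s) (Cmod (s - 1))) by (apply Rmin_glb_lt; auto).
  assert (R1 := Rmin_l (Re s) (Cmod (s - 1))); assert (R2 := Rmin_r (Re s) (Cmod (s - 1))).
  assert (Pr : 0 < r) by (unfold r; lra).
  assert (In : forall z, Cmod (z - s) <= r -> Re s - r <= Re z /\ z <> 1%C).
  { intros z Hz; split.
    - assert (H := Rle_trans _ _ _ (re_le_Cmod _) Hz).
      replace (Re (z - s)) with (Re z - Re s) in H by reim; apply Rabs_le_between in H; lra.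
    - intros ->; rewrite Cmod_sub_sym in Hz; unfold r in Hz; lra. }
  destruct (weierstrass (fun n z => em_term z n) em_sum s r
    (fun n => (Cmod s + r) * npow (Re s - r + 1) n) ((Cmod s + r) * (1 + / (Re s - r + 1 - 1))))
    as [l [_ Hl]]; auto.
  - intros n z Hz; apply em_term_holo, In, Hz.
  - intros n z Hz; destruct (In z Hz) as [I1 I2].
    assert (Rz : 0 < Re z) by (unfold r in I1; lra).
    apply Rle_trans with (1 := em_term_bound z n Rz I2).
    assert (T := Cmod_triangle_rev z s).
    apply Rmult_le_compat; [apply Cmod_ge_0 | left; apply npow_pos | lra | apply npow_le; lra].
  - intros n; rewrite rsum_scal; apply Rmult_le_compat_l.
    + assert (H := Cmod_ge_0 s); lra.
    + apply rsum_npow_gt1; unfold r; lra.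
  - intros z Hz; destruct (In z Hz) as [I1 I2]; apply em_sum_correct; auto; unfold r in I1; lra.
  - exists l; auto.
Qed.

(** The disc of radius [31/16 < 2] about [2 + it] stays in [Re z > 0] and, as [t >= 3], off the
    pole. In the concentric disc of radius 1 both sides are given by convergent series, and the
    identity theorem extends the equality. The radius leaves room above the [15/8] of
    [zeta_growth]. *)
Lemma zeta_eq_em_sum (t : R) (z : C) : 3 <= t -> Cmod (z - (2, t)) < 31 / 16 ->
  zeta z = (/ (z - 1) + em_sum z)%C.
Proof.
  intros Ht.
  assert (In : forall z, Cmod (z - (2, t)) <= 31 / 16 -> 1 / 16 <= Re z /\ z <> 1%C).
  { intros w Hw.
    assert (H1 := Rle_trans _ _ _ (re_le_Cmod _) Hw); assert (H2 := Rle_trans _ _ _ (im_le_Cmod _) Hw).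
    replace (Re (w - (2, t))) with (Re w - 2) in H1 by reim.
    replace (Im (w - (2, t))) with (Im w - t) in H2 by reim.
    apply Rabs_le_between in H1; apply Rabs_le_between in H2; split; [lra |].
    intros ->; simpl in H2; lra. }
  intros Hz.
  assert (E : (fun z => zeta z + - / (z - 1) + - em_sum z)%C z = 0%C).
  { apply (identity_disc (fun z => zeta z + - / (z - 1) + - em_sum z)%C (2, t) 1 (31 / 16)); [lra | lra | | | auto].
    - intros w Hw; destruct (In w Hw) as [I1 I2].
      destruct (zeta_holo w I2) as [l1 H1]; destruct (em_sum_holo w ltac:(lra) I2) as [l2 H2].
      eexists; apply cder_plus; [apply cder_plus; [exact H1 |] | apply cder_opp, H2].
      apply cder_opp, (cder_inv (fun z => z - 1)%C); [| apply Csub_neq; auto].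
      apply cder_minus; [apply cder_id | apply cder_const].
    - intros w Hw; destruct (In w ltac:(lra)) as [I1 I2].
      assert (H1 := Rle_lt_trans _ _ _ (re_le_Cmod _) Hw).
      replace (Re (w - (2, t))) with (Re w - 2) in H1 by reim; apply Rabs_lt_between in H1.
      rewrite (cseries_unique _ _ _ (em_sum_correct w ltac:(lra) I2) (em_series_gt1 w ltac:(lra))); ring. }
  cbv beta in E.
  replace (zeta z) with (zeta z + - / (z - 1) + - em_sum z + (/ (z - 1) + em_sum z))%C by ring.
  rewrite E; ring.
Qed.

(** Only polynomial growth matters: the bound enters through its logarithm. *)
Lemma zeta_growth (t : R) (z : C) : 3 <= t -> Cmod (z - (2, t)) <= 15 / 8 -> Cmod (zeta z) <= 30 * t.
Proof.
  intros Ht Hz; rewrite (zeta_eq_em_sum t z Ht ltac:(lra)).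
  assert (H1 := Rle_trans _ _ _ (re_le_Cmod _) Hz); assert (H2 := Rle_trans _ _ _ (im_le_Cmod _) Hz).
  replace (Re (z - (2, t))) with (Re z - 2) in H1 by reim.
  replace (Im (z - (2, t))) with (Im z - t) in H2 by reim.
  apply Rabs_le_between in H1; apply Rabs_le_between in H2.
  assert (N1 : z <> 1%C) by (intros ->; simpl in H2; lra).
  apply Rle_trans with (1 := Cmod_triangle _ _).
  assert (A1 : Cmod (/ (z - 1)) <= 1).
  { rewrite Cmod_inv by (apply Csub_neq; auto).
    apply Rle_trans with (/ 1); [| lra]; apply Rinv_le_contravar; [lra |].
    apply Rle_trans with (2 := im_le_Cmod _), Rle_trans with (2 := Rle_abs _).
    replace (Im (z - 1)) with (Im z) by reim; lra. }
  assert (A2 := em_sum_bound z ltac:(lra) N1).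
  assert (A3 : Cmod z <= t + 4).
  { assert (T := Cmod_triangle_rev z (2, t)).
    assert (T2 := Cmod_le_re_im (2, t)); simpl in T2; rewrite 2!Rabs_pos_eq in T2 by lra; lra. }
  assert (A4 : / Re z <= 8).
  { replace 8 with (/ (1 / 8)) by field; apply Rinv_le_contravar; lra. }
  assert (A5 := Cmod_ge_0 z).
  assert (0 < / Re z) by (apply Rinv_0_lt_compat; lra).
  assert (Cmod z * (1 + / Re z) <= (t + 4) * 9) by (apply Rmult_le_compat; lra).
  lra.
Qed.

(** * Consequences of the Riemann hypothesis for the logarithmic derivative *)

Hypothesis zeta_RH : riemann_hypothesis zeta.

Lemma zeta_neq_0_right (s : C) : 1 / 2 < Re s -> Im s <> 0 -> zeta s <> 0%C.
Proof.
  intros Hs Hi E; destruct (Rtotal_order (Re s) 1) as [L | [L | L]].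
  - assert (H := zeta_RH s ltac:(lra) E); lra.
  - destruct s as [x y]; simpl in L, Hi; subst x; exact (zeta_neq_0_line1 y Hi E).
  - exact (zeta_neq_0_gt1 zeta zeta_series s L E).
Qed.

(** [log_derivative_zeros] for discs about [2 + i Im s]: radius 3/2 reaches from real part 1/2
    beyond 3, while radius [15/8 < 2] keeps within the region of [zeta_growth]. The zeros met there
    have real part at most [b = 1/2]. *)
Lemma zeta_log_derivative_bound : exists K, 0 < K /\ forall s,
  1 / 2 < Re s -> Re s <= 3 -> 3 <= Im s ->
  - (K * ln (Im s)) <= Re (Cder zeta s / zeta s) /\
  Cmod (Cder zeta s / zeta s) <= K * ln (Im s) * (1 + / (Re s - 1 / 2)).
Proof.
  destruct (log_derivative_zeros (3 / 2) (7 / 4) (15 / 8)) as [K [PK H]]; try lra.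
  exists (K * 6); split; [lra |]; intros s H1 H2 H3.
  set (t := Im s) in *; set (c := (2, t) : C).
  assert (Lt : 1 <= ln t).
  { rewrite <- (ln_exp 1); apply ln_le; [apply exp_pos |]; assert (X := exp_le_3); lra. }
  assert (Near : forall z, Cmod (z - c) <= 15 / 8 -> 1 / 8 <= Re z /\ 1 <= Im z).
  { intros z Hz.
    assert (X1 := Rle_trans _ _ _ (re_le_Cmod _) Hz); assert (X2 := Rle_trans _ _ _ (im_le_Cmod _) Hz).
    replace (Re (z - c)) with (Re z - 2) in X1 by (unfold c; reim).
    replace (Im (z - c)) with (Im z - t) in X2 by (unfold c; reim).
    apply Rabs_le_between in X1; apply Rabs_le_between in X2; split; lra. }
  assert (Lc := zeta_ge2_lower zeta zeta_series c ltac:(simpl; lra)).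
  (* The 6 comes from [30 t <= t^6 / 4 <= t^6 |zeta c|] for [t >= 3]. *)
  destruct (H zeta c (6 * ln t) (1 / 2)) with (z := s) as [B1 B2]; auto.
  - lra.
  - intros z Hz; apply zeta_holo; destruct (Near z Hz) as [N1 N2]; intros ->; simpl in N2; lra.
  - apply Cmod_gt_0; lra.
  - intros z Hz; apply Rle_trans with (1 := zeta_growth t z H3 Hz).
    assert (E6 : exp (6 * ln t) = t ^ 6).
    { replace (6 * ln t) with (ln t + (ln t + (ln t + (ln t + (ln t + ln t))))) by ring.
      rewrite !exp_plus, exp_ln by lra; ring. }
    rewrite E6.
    assert (P5 : 3 ^ 5 <= t ^ 5) by (apply pow_incr; lra).
    replace (t ^ 6) with (t * t ^ 5) by ring.
    apply Rle_trans with (1 / 4 * (t * t ^ 5)); [nra |].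
    apply Rmult_le_compat_r; [| auto].
    apply Rmult_le_pos; [lra | apply pow_le; lra].
  - intros z Hz Ez; apply Rnot_lt_le; intros L; destruct (Near z ltac:(lra)) as [N1 N2].
    apply (zeta_neq_0_right z L); auto; lra.
  - apply Rle_trans with (1 := Cmod_le_re_im _).
    replace (Re (s - c)) with (Re s - 2) by (unfold c; reim).
    replace (Im (s - c)) with 0 by (unfold c, t; reim).
    rewrite Rabs_R0, Rplus_0_r; apply Rabs_le; lra.
  - split; [| apply Rle_trans with (1 := B2); right; ring].
    apply Rle_trans with (2 := B1); right; ring.
Qed.

End ZetaStrip.

(** * Approximation of the logarithmic derivative near the critical line *)

(* The principal branch; the formula divides by [0] on the closed negative real axis. *)
Definition csqrt (z : C) : C :=
  (sqrt ((Cmod z + Re z) / 2), Im z / (2 * sqrt ((Cmod z + Re z) / 2))).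

Lemma csqrt_Re_sq (z : C) : 0 < Re z ->
  0 < Re (csqrt z) /\ Re (csqrt z) * Re (csqrt z) = (Cmod z + Re z) / 2.
Proof.
  intros H; assert (P := Cmod_ge_0 z).
  split; [apply sqrt_lt_R0; lra | apply sqrt_sqrt; lra].
Qed.

Lemma csqrt_sq (z : C) : 0 < Re z -> (csqrt z * csqrt z)%C = z.
Proof.
  intros H; destruct (csqrt_Re_sq z H) as [P E].
  assert (Ei : Im (csqrt z) = Im z / (2 * Re (csqrt z))) by reflexivity.
  apply Ceq.
  - rewrite re_mult, Ei.
    assert (Q : Im z ^ 2 = (Cmod z - Re z) * (Cmod z + Re z)) by (assert (S := Cmod_sq z); lra).
    replace (Im z / (2 * Re (csqrt z)) * (Im z / (2 * Re (csqrt z))))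
      with (Im z ^ 2 / (4 * (Re (csqrt z) * Re (csqrt z)))) by (field; lra).
    assert (PC := Cmod_ge_0 z); rewrite E, Q; field; lra.
  - rewrite im_mult, Ei; field; lra.
Qed.

Lemma Cmod_csqrt_sq (z : C) : 0 < Re z -> Cmod (csqrt z) ^ 2 = Cmod z.
Proof.
  intros H; rewrite <- (csqrt_sq z H) at 2; rewrite Cmod_mult; ring.
Qed.

Lemma Cmod_csqrt (z : C) : 0 < Re z -> Cmod (csqrt z) = sqrt (Cmod z).
Proof.
  intros H; rewrite <- (Cmod_csqrt_sq z H), <- Rsqr_pow2.
  symmetry; apply sqrt_Rsqr, Cmod_ge_0.
Qed.

(** The root of a number in the right half-plane has argument less than [pi/4] in absolute value. *)
Lemma Cmod_le_Re_csqrt (z : C) : 0 < Re z -> Cmod z <= 2 * Re (csqrt z) ^ 2.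
Proof.
  intros H; destruct (csqrt_Re_sq z H) as [P E]; assert (S := re_le_Cmod z);
    rewrite Rabs_pos_eq in S by lra; nra.
Qed.

Lemma Re_near (z w : C) : Cmod (w - z) < Re z -> 0 < Re w.
Proof.
  intros H; assert (H1 := Rle_lt_trans _ _ _ (re_le_Cmod _) H).
  replace (Re (w - z)) with (Re w - Re z) in H1 by reim; apply Rabs_lt_between in H1; lra.
Qed.

Lemma csqrt_diff (z w : C) : 0 < Re z -> 0 < Re w ->
  (csqrt z + csqrt w)%C <> 0%C /\ (csqrt w - csqrt z = (w - z) / (csqrt w + csqrt z))%C.
Proof.
  intros Hz Hw.
  destruct (csqrt_Re_sq z Hz) as [Pz _]; destruct (csqrt_Re_sq w Hw) as [Pw _].
  assert (N : forall a b, 0 < Re a -> 0 < Re b -> (a + b)%C <> 0%C).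
  { intros a b Ha Hb E; apply (f_equal Re) in E; rewrite re_plus in E; simpl in E; lra. }
  split; [apply N; auto |].
  rewrite <- (csqrt_sq w Hw) at 2; rewrite <- (csqrt_sq z Hz) at 2.
  field; apply N; auto.
Qed.

Lemma cder_csqrt (z : C) : 0 < Re z -> exists l, cder csqrt z l.
Proof.
  intros Hz; destruct (csqrt_Re_sq z Hz) as [Pz _].
  assert (Hc : ccont csqrt z).
  { intros eps He; exists (Rmin (Re z) (eps * Re (csqrt z))); split.
    { apply Rmin_glb_lt; auto; apply Rmult_lt_0_compat; auto. }
    intros w Hw.
    assert (Pw := Re_near z w (Rlt_le_trans _ _ _ Hw (Rmin_l _ _))).
    assert (W := Rlt_le_trans _ _ _ Hw (Rmin_r _ _)).
    destruct (csqrt_diff z w Hz Pw) as [N E]; rewrite E.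
    destruct (csqrt_Re_sq w Pw) as [Pw' _].
    assert (N' : (csqrt w + csqrt z)%C <> 0%C) by (rewrite Cplus_comm; auto).
    rewrite Cmod_div by auto; apply Rlt_div_l; [apply Cmod_gt_0; auto |].
    apply Rlt_le_trans with (1 := W), Rmult_le_compat_l; [lra |].
    apply Rle_trans with (2 := re_le_Cmod _), Rle_trans with (2 := Rle_abs _).
    rewrite re_plus; lra. }
  exists (1 / (csqrt z + csqrt z))%C.
  apply (cder_intro _ (fun w => 1 / (csqrt w + csqrt z))%C z (Re z) Hz).
  - intros w Hw; destruct (csqrt_diff z w Hz (Re_near z w Hw)) as [N E]; rewrite E.
    field; rewrite Cplus_comm; auto.
  - apply ccont_div; [apply ccont_const | apply ccont_plus; [auto | apply ccont_const] |].
    apply csqrt_diff; auto.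
Qed.

Lemma Re_csqrt_RtoC (a : R) : 0 <= a -> Re (csqrt (RtoC a)) = sqrt a.
Proof.
  intros Ha; change (sqrt ((Cmod (RtoC a) + a) / 2) = sqrt a).
  f_equal; rewrite Cmod_R, Rabs_pos_eq by auto; field.
Qed.

Lemma sqrt_add_le (a b : R) : 0 <= a -> 0 <= b -> sqrt (a + b) <= sqrt a + sqrt b.
Proof.
  intros Ha Hb; assert (Pa := sqrt_pos a); assert (Pb := sqrt_pos b).
  rewrite <- (sqrt_Rsqr (sqrt a + sqrt b)) by lra; apply sqrt_le_1_alt.
  unfold Rsqr; assert (Ea := sqrt_sqrt a Ha); assert (Eb := sqrt_sqrt b Hb); nra.
Qed.

(** Near a point [z] with [Om z <> 0], a rotation [a] brings [a Om] into the right half-plane, where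
    the root is holomorphic. Then [csqrt (a Om) - C1 csqrt H] supports the difference at [z],
    because [Re csqrt (a Om) <= |Om|^(1/2)] with equality at [z]. *)
Lemma sqrt_max_principle (Om H : C -> C) (x0 x1 y0 y1 C1 m : R) : 0 <= C1 -> 0 <= m ->
  x0 < x1 -> y0 < y1 ->
  holo_on (in_rect x0 x1 y0 y1) Om -> holo_on (in_rect x0 x1 y0 y1) H ->
  (forall z, in_rect x0 x1 y0 y1 z -> 0 < Re (H z)) ->
  (forall z, rect_edges x0 x1 y0 y1 z -> sqrt (Cmod (Om z)) <= m + C1 * Re (csqrt (H z))) ->
  forall z, in_rect x0 x1 y0 y1 z -> sqrt (Cmod (Om z)) <= m + C1 * Re (csqrt (H z)).
Proof.
  intros HC1 Hm Hx Hy HOm HH PH Edge.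
  set (V := fun z => csqrt (H z)).
  assert (HV : holo_on (in_rect x0 x1 y0 y1) V).
  { intros z Hz; destruct (HH z Hz) as [l Hl]; destruct (cder_csqrt (H z) (PH z Hz)) as [l' Hl'].
    exists (l' * l)%C; apply (cder_comp H csqrt); auto. }
  assert (U : forall z, in_rect x0 x1 y0 y1 z -> sqrt (Cmod (Om z)) - C1 * Re (V z) <= m).
  { apply (max_principle _ (fun z => sqrt (Cmod (Om z)) - C1 * Re (V z)) (Rabs x0 + Rabs x1 + Rabs y0 + Rabs y1));
      [apply rect_closed | apply in_rect_bounded | |].
    - intros z eps Hz He.
      (* The square is there because the root is subadditive: a change of [Om] by [(eps/2)^2]
         changes the root of its modulus by at most [eps/2]. *)
      destruct (holo_on_ccont _ Om z HOm Hz ((eps / 2) ^ 2)) as [d1 [Hd1 D1]]; [apply pow_lt; lra |].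
      destruct (holo_on_ccont _ V z HV Hz (eps / 2 / (C1 + 1))) as [d2 [Hd2 D2]].
      { apply Rdiv_lt_0_compat; lra. }
      exists (Rmin d1 d2); split; [apply Rmin_glb_lt; auto |]; intros w _ Hw.
      specialize (D1 w (Rlt_le_trans _ _ _ Hw (Rmin_l _ _))).
      specialize (D2 w (Rlt_le_trans _ _ _ Hw (Rmin_r _ _))).
      assert (B1 : sqrt (Cmod (Om w)) < sqrt (Cmod (Om z)) + eps / 2).
      { assert (T := Cmod_triangle_rev (Om w) (Om z)).
        apply Rle_lt_trans with (sqrt (Cmod (Om z) + Cmod (Om w - Om z)));
          [apply sqrt_le_1_alt; lra |].
        apply Rle_lt_trans with (1 := sqrt_add_le _ _ (Cmod_ge_0 _) (Cmod_ge_0 _)).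
        apply Rplus_lt_compat_l.
        rewrite <- (sqrt_Rsqr (eps / 2)) by lra; apply sqrt_lt_1_alt.
        split; [apply Cmod_ge_0 | rewrite Rsqr_pow2; auto]. }
      assert (R1 := Rle_lt_trans _ _ _ (re_le_Cmod _) D2).
      replace (Re (V w - V z)) with (Re (V w) - Re (V z)) in R1 by reim.
      apply Rabs_lt_between in R1; destruct R1 as [R1 _].
      assert (B2 : C1 * (eps / 2 / (C1 + 1)) <= eps / 2).
      { replace (C1 * (eps / 2 / (C1 + 1))) with (eps / 2 * (C1 / (C1 + 1))) by (field; lra).
        rewrite <- (Rmult_1_r (eps / 2)) at 2; apply Rmult_le_compat_l; [lra | apply Rle_div_l; lra]. }
      nra.
    - intros z Hz L.
      assert (Pr : forall z, in_rect x0 x1 y0 y1 z -> 0 < Re (V z))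
        by (intros v Hv; apply csqrt_Re_sq, PH, Hv).
      assert (PV := Pr z Hz).
      (* At a zero of [Om] the difference is at most [0 <= m], so a point above [m] is not a
         zero. *)
      assert (PO : 0 < Cmod (Om z)).
      { destruct (Rle_lt_or_eq_dec 0 _ (Cmod_ge_0 (Om z))) as [P | E]; auto.
        rewrite <- E, sqrt_0 in L; nra. }
      assert (Rz := proj1 (in_rect_ordered x0 x1 y0 y1 z (Rlt_le _ _ Hx) (Rlt_le _ _ Hy)) Hz).
      assert (NE : Re z <> x0 /\ Re z <> x1 /\ Im z <> y0 /\ Im z <> y1).
      { repeat split; intros E;
          assert (Q : rect_edges x0 x1 y0 y1 z) by (split; [exact Hz | tauto]);
          specialize (Edge z Q); fold (V z) in Edge; lra. }
      set (r := Rmin (Rmin (Re z - x0) (x1 - Re z)) (Rmin (Im z - y0) (y1 - Im z))).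
      assert (Pr0 : 0 < r) by (unfold r; repeat apply Rmin_glb_lt; lra).
      assert (M1 := Rmin_l (Rmin (Re z - x0) (x1 - Re z)) (Rmin (Im z - y0) (y1 - Im z))).
      assert (M2 := Rmin_r (Rmin (Re z - x0) (x1 - Re z)) (Rmin (Im z - y0) (y1 - Im z))).
      assert (M3 := Rmin_l (Re z - x0) (x1 - Re z)); assert (M4 := Rmin_r (Re z - x0) (x1 - Re z)).
      assert (M5 := Rmin_l (Im z - y0) (y1 - Im z)); assert (M6 := Rmin_r (Im z - y0) (y1 - Im z)).
      fold r in M1, M2.
      assert (In : forall w, Cmod (w - z) < r -> in_rect x0 x1 y0 y1 w).
      { intros w Hw; apply in_rect_ordered; [lra | lra |].
        assert (A1 := Rle_lt_trans _ _ _ (re_le_Cmod _) Hw).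
        assert (A2 := Rle_lt_trans _ _ _ (im_le_Cmod _) Hw).
        replace (Re (w - z)) with (Re w - Re z) in A1 by reim.
        replace (Im (w - z)) with (Im w - Im z) in A2 by reim.
        apply Rabs_lt_between in A1; apply Rabs_lt_between in A2; lra. }
      split; [exists r; auto |].
      set (a := (Cconj (Om z) / RtoC (Cmod (Om z)))%C).
      assert (Na : RtoC (Cmod (Om z)) <> 0%C) by (apply RtoC_neq; lra).
      assert (Ma : Cmod a = 1).
      { unfold a; rewrite Cmod_div, Cmod_conj, Cmod_R, Rabs_pos_eq by (auto; lra); field; lra. }
      assert (Ez : (a * Om z)%C = RtoC (Cmod (Om z))).
      { unfold a; replace (Cconj (Om z) / RtoC (Cmod (Om z)) * Om z)%C
          with (Om z * Cconj (Om z) / RtoC (Cmod (Om z)))%C by (unfold Cdiv; ring).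
        rewrite <- Cmod2_conj, RtoC_pow; field; auto. }
      destruct (holo_on_ccont _ Om z HOm Hz (Cmod (Om z)) PO) as [d [Hd D]].
      assert (Near : forall w, Cmod (w - z) < d -> 0 < Re (a * Om w)).
      { intros w Hw; apply (Re_near (a * Om z)).
        replace (a * Om w - a * Om z)%C with (a * (Om w - Om z))%C by ring.
        rewrite Cmod_mult, Ma, Rmult_1_l, Ez; simpl; auto. }
      exists (fun w => csqrt (a * Om w) + (- RtoC C1) * V w)%C, (Rmin r d).
      split; [apply Rmin_glb_lt; auto |]; split; [| split].
      + intros w Hw.
        assert (W0 := In w (Rlt_le_trans _ _ _ Hw (Rmin_l _ _))).
        assert (W1 := Near w (Rlt_le_trans _ _ _ Hw (Rmin_r _ _))).
        destruct (HOm w W0) as [l1 H1]; destruct (HV w W0) as [l2 H2].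
        destruct (cder_csqrt _ W1) as [l3 H3].
        eexists; apply cder_plus; [| apply cder_scal, H2].
        apply (cder_comp (fun w => a * Om w)%C csqrt); [apply cder_scal, H1 | exact H3].
      + rewrite re_plus, Ez.
        replace (Re (- RtoC C1 * V z)) with (- (C1 * Re (V z))) by reim.
        rewrite Re_csqrt_RtoC; lra.
      + intros w Hw.
        assert (W1 := Near w (Rlt_le_trans _ _ _ Hw (Rmin_r _ _))).
        rewrite re_plus; replace (Re (- RtoC C1 * V w)) with (- (C1 * Re (V w))) by reim.
        assert (A1 := Rle_trans _ _ _ (Rle_abs _) (re_le_Cmod (csqrt (a * Om w)))).
        rewrite Cmod_csqrt, Cmod_mult, Ma, Rmult_1_l in A1 by auto; lra. }
  intros z Hz; specialize (U z Hz); unfold V in U; lra.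
Qed.

(** * Partial sums and tails of the series of [Lambda] *)

Lemma lambda_partial_sum_bound (s : C) (N : nat) (a X : R) : 0 <= a < 1 -> a <= Re s ->
  0 < X -> INR N <= X -> Cmod (csum (lambda_term s) N) <= 4 / (1 - a) * exp ((1 - a) * ln X).
Proof.
  intros Ha Hs PX HN.
  assert (U := csum_diff_bound (lambda_term s) (fun n => vonMangoldt (S n) * npow a n) 0 N).
  simpl (csum _ 0) in U; simpl (rsum _ 0) in U.
  replace (csum (lambda_term s) N - 0)%C with (csum (lambda_term s) N) in U by ring.
  eapply Rle_trans; [apply U; [| lia] |].
  - intros k; rewrite Cmod_lambda_term; apply Rmult_le_compat_l;
      [apply Arithmetic.vonMangoldt_ge_0 | apply npow_le; auto].
  - rewrite Rminus_0_r.
    apply Rle_trans with (4 * rsum (npow a) N).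
    { apply vonMangoldt_abel; [intros; left; apply npow_pos | intros; apply npow_decr; lra]. }
    assert (PE := exp_pos ((1 - a) * ln X)).
    replace (4 / (1 - a) * exp ((1 - a) * ln X)) with (4 * (exp ((1 - a) * ln X) / (1 - a))) by (field; lra).
    apply Rmult_le_compat_l; [lra |].
    destruct N as [| N].
    { simpl; left; apply Rdiv_lt_0_compat; lra. }
    apply Rle_trans with (1 := rsum_npow_lt1 a (S N) Ha ltac:(lia)).
    apply Rmult_le_compat_r; [left; apply Rinv_0_lt_compat; lra |].
    apply exp_le_compat, Rmult_le_compat_l; [lra |].
    assert (P := INR_S_ge_1 N); apply ln_le; lra.
Qed.

Lemma rsum_split (a : nat -> R) (N M : nat) : (N <= M)%nat ->
  rsum (fun i => if Nat.ltb i N then a N else a i) M = INR N * a N + (rsum a M - rsum a N).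
Proof.
  intros L; induction L as [| M L IH].
  - rewrite (rsum_ext _ (fun _ => a N)), rsum_const; [ring |].
    intros k Hk; replace (Nat.ltb k N) with true; auto; symmetry; apply Nat.ltb_lt; auto.
  - cbn [rsum]; rewrite IH; replace (Nat.ltb M N) with false; [ring |].
    symmetry; apply Nat.ltb_ge; auto.
Qed.

(** For the right edge of the rectangle. Bounding [Lambda] by the logarithm would cost a factor
    [log X]; Chebyshev's bound avoids it. *)
Lemma lambda_tail_bound (s l : C) (N : nat) (X : R) : Re s = 3 -> (1 <= N)%nat ->
  0 < X -> X <= 2 * INR N -> cseries (lambda_term s) l ->
  Cmod (l - csum (lambda_term s) N) <= 24 * exp (-2 * ln X).
Proof.
  intros Hs HN PX HX Hl.
  set (a := fun n => npow 3 n).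
  assert (PN : 1 <= INR N) by (apply (le_INR 1 N HN)).
  assert (LN := ln_ge_0 _ PN).
  assert (LX : ln X <= ln 2 + ln (INR N)) by (rewrite <- ln_mult by lra; apply ln_le; lra).
  assert (EN : exp (-2 * ln (INR N)) <= 4 * exp (-2 * ln X)).
  { replace 4 with (exp (ln 2 + ln 2)) by (rewrite exp_plus, exp_ln by lra; ring).
    rewrite <- exp_plus; apply exp_le_compat; lra. }
  (* Frozen below [N], the weight is nonincreasing from the start, so partial summation applies to
     the tail. It gives [4 (1 + 1/2) N^(-2)], and [X <= 2N] turns the 6 into 24. *)
  set (b := fun i => if Nat.ltb i N then a N else a i).
  assert (Bd : forall M, (N <= M)%nat ->
    Cmod (csum (lambda_term s) M - csum (lambda_term s) N) <= 6 * exp (-2 * ln (INR N))).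
  { intros M HM.
    assert (B1 : forall k, 0 <= b k)
      by (intros k; unfold b, a; destruct (Nat.ltb k N); left; apply npow_pos).
    assert (B2 : forall k, b (S k) <= b k).
    { intros k; unfold b, a; destruct (Nat.ltb (S k) N) eqn:E1; destruct (Nat.ltb k N) eqn:E2.
      - lra.
      - apply Nat.ltb_lt in E1; apply Nat.ltb_ge in E2; lia.
      - apply Nat.ltb_ge in E1; apply Nat.ltb_lt in E2; replace (S k) with N by lia; lra.
      - apply npow_decr; lra. }
    assert (V := vonMangoldt_abel b M B1 B2).
    unfold b in V at 2; rewrite (rsum_split a N M HM) in V.
    assert (D := rsum_npow_diff 3 N M ltac:(lra) ltac:(lra) HN HM).
    replace (1 - 3) with (-2) in D by ring.
    assert (PM := exp_pos (-2 * ln (INR M))).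
    assert (A1 : INR N * a N <= exp (-2 * ln (INR N))).
    { unfold a; apply Rle_trans with (INR N * exp (- (3 * ln (INR N)))).
      - apply Rmult_le_compat_l; [lra |]; apply exp_le_compat.
        assert (ln (INR N) <= ln (INR (S N))) by (apply ln_le; rewrite ?S_INR; lra); lra.
      - right; rewrite <- (exp_ln (INR N)) at 1 by lra; rewrite <- exp_plus; f_equal; ring. }
    assert (A2 : Cmod (csum (lambda_term s) M - csum (lambda_term s) N) <=
      rsum (fun i => vonMangoldt (S i) * b i) M).
    { clear V D PM; induction HM as [| M HM IH].
      - rewrite Cmod_sub_self; apply (rsum_incr _ 0 N); [| lia].
        intros k; apply Rmult_le_pos; auto; apply Arithmetic.vonMangoldt_ge_0.
      - cbn [csum rsum].
        replace (csum (lambda_term s) M + lambda_term s M - csum (lambda_term s) N)%C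
          with (csum (lambda_term s) M - csum (lambda_term s) N + lambda_term s M)%C by ring.
        apply Rle_trans with (1 := Cmod_triangle _ _), Rplus_le_compat; auto.
        rewrite Cmod_lambda_term, Hs; apply Rmult_le_compat_l; [apply Arithmetic.vonMangoldt_ge_0 |].
        unfold b, a; replace (Nat.ltb M N) with false; [lra |].
        symmetry; apply Nat.ltb_ge; auto. }
    change (npow 3) with a in D; lra. }
  apply Rle_trans with (6 * exp (-2 * ln (INR N))); [| lra].
  apply le_epsilon; intros eps He; destruct (Hl eps He) as [M0 HM0].
  specialize (HM0 (max M0 N) ltac:(lia)); specialize (Bd (max M0 N) ltac:(lia)).
  assert (T := Cmod_triangle3 l (csum (lambda_term s) (max M0 N)) (csum (lambda_term s) N)).
  rewrite Cmod_sub_sym in HM0; lra.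
Qed.

Lemma nat_floor (x : R) : 1 <= x -> exists n, (1 <= n)%nat /\ INR n <= x < INR n + 1.
Proof.
  intros Hx; destruct (archimed x) as [A1 A2].
  assert (Pu : (1 < up x)%Z) by (apply lt_IZR; lra).
  exists (Z.to_nat (up x - 1)); split; [lia |].
  rewrite INR_IZR_INZ, Z2Nat.id, minus_IZR by lia; lra.
Qed.

Lemma exp_ge_2x (u : R) : 2 * u <= exp u.
Proof.
  destruct (Rle_dec u 0) as [H | H]; [assert (X := exp_pos u); lra |].
  assert (H1 := exp_ineq1_le (u / 2)).
  replace u with (u / 2 + u / 2) at 2 by field; rewrite exp_plus.
  assert ((1 + u / 2) * (1 + u / 2) <= exp (u / 2) * exp (u / 2)) by (apply Rmult_le_compat; lra).
  assert (Q := Rle_0_sqr (1 - u / 2)); unfold Rsqr in Q; lra.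
Qed.

(** For the horizontal edges: [l^2] comes from [G], [l^6] from [X^3]. The constant is [4^4], from
    [e^u >= (u/4)^4]. *)
Lemma pow8_exp_le (l : R) : l ^ 8 * exp (- (l * l)) <= 256.
Proof.
  assert (H := exp_ineq1_le (l * l / 4)).
  assert (P : 0 <= l * l) by apply Rle_0_sqr.
  assert (E : exp (l * l) = exp (l * l / 4) ^ 4).
  { replace (l * l) with (l * l / 4 + (l * l / 4 + (l * l / 4 + l * l / 4))) at 1 by field.
    rewrite !exp_plus; ring. }
  assert (Q : (l * l / 4) ^ 4 <= exp (l * l / 4) ^ 4) by (apply pow_incr; lra).
  rewrite exp_Ropp; apply Rle_div_l; [apply exp_pos |].
  rewrite E; apply Rle_trans with (256 * (l * l / 4) ^ 4); [right; field | lra].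
Qed.

Lemma csum_holo (f : nat -> C -> C) (z : C) (N : nat) : (forall n, exists l, cder (f n) z l) ->
  exists l, cder (fun w => csum (fun n => f n w) N) z l.
Proof.
  intros H; induction N as [| N [l IH]]; cbn [csum].
  - eexists; apply cder_const.
  - destruct (H N) as [m Hm]; eexists; apply cder_plus; [exact IH | exact Hm].
Qed.

Lemma lambda_partial_holo (z : C) (N : nat) : exists l, cder (fun w => csum (lambda_term w) N) z l.
Proof.
  apply (csum_holo (fun n w => lambda_term w n)); intros n.
  eexists; apply cder_scal, cder_dirichlet_term.
Qed.

Lemma sqrt_le_of_sq (a b : R) : 0 <= b -> a <= b * b -> sqrt a <= b.
Proof.
  intros Hb H; rewrite <- (sqrt_Rsqr b Hb); apply sqrt_le_1_alt, H.
Qed.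

(** * The estimate in the rectangle *)

Section Main.

Variable zeta : C -> C.
Hypothesis zeta_series : forall s, 1 < Re s -> cseries (dirichlet_term s) (zeta s).
Hypothesis zeta_holo : forall s : C, s <> RtoC 1 -> exists l, cder zeta s l.
Hypothesis zeta_RH : riemann_hypothesis zeta.

Let h (s : C) : C := (Cder zeta s / zeta s)%C.

Lemma log_derivative_holo (s : C) : 1 / 2 < Re s -> 0 < Im s -> exists l, cder h s l.
Proof.
  intros H1 H2.
  assert (Dz : forall z : C, z <> 1%C -> cder zeta z (Cder zeta z))
    by (intros z Hz; apply Cder_correct, zeta_holo, Hz).
  assert (N1 : s <> 1%C) by (intros ->; simpl in H2; lra).
  destruct (cder_derivative zeta (Cder zeta) s (Im s) H2) as [l Hl].
  { intros z Hz; apply Dz; intros ->.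
    assert (H := Rle_lt_trans _ _ _ (im_le_Cmod _) Hz).
    replace (Im (1 - s)) with (- Im s) in H by reim.
    rewrite Rabs_Ropp, Rabs_pos_eq in H by lra; lra. }
  eexists; apply cder_div; [exact Hl | apply Dz, N1 |].
  apply zeta_neq_0_right; auto; lra.
Qed.

Lemma log_derivative_gt1 (s : C) : 1 < Re s -> h s = (- lambda_sum s)%C.
Proof.
  intros Hs; unfold h.
  rewrite (Cder_unique zeta s _ (cder_zeta_lambda zeta zeta_series s Hs)).
  field; apply zeta_neq_0_gt1; auto.
Qed.

(* Near the critical line [|h|] itself may exceed [log t], but [|h|^(1/2)] is dominated by a harmonic
   function which is [O((log t)^(1/2))] for [Re s >= sigma1]; the exponent [1/2] thus avoids any loss. *)
Lemma log_derivative_approx (sigma1 : R) : 1 / 2 < sigma1 ->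
  exists C0 t0, 0 < C0 /\ 6 <= t0 /\ forall (t sigma : R) (N : nat),
    t0 <= t -> sigma1 <= sigma -> sigma <= 2 -> (1 <= N)%nat ->
    INR N <= ln t * ln t < INR N + 1 ->
    Cmod (h (sigma, t) + csum (lambda_term (sigma, t)) N) <= C0 * exp ((1 - sigma) * ln (ln t * ln t)).
Proof.
  intros Hs1.
  assert (HK0 : exists K, 0 < K /\ forall s, 1 / 2 < Re s -> Re s <= 3 -> 3 <= Im s ->
    - (K * ln (Im s)) <= Re (h s) /\ Cmod (h s) <= K * ln (Im s) * (1 + / (Re s - 1 / 2)))
    by exact (zeta_log_derivative_bound zeta zeta_series zeta_holo zeta_RH).
  destruct HK0 as [K [PK HK]].
  (* In the rectangle [ln (Im z) <= 2 l], so [Re h >= -2 K l], and adding [K1 l] leaves real part at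
     least [l]. *)
  set (K1 := 2 * K + 1).
  set (K2 := K * (1 + / (sigma1 - 1 / 2)) + K1).
  (* Collects [e^9] from [(z - s0)^2], where [|Re z - sigma| <= 3], and [e = X^(1/L)] from the
     offset of the left edge. *)
  set (E10 := exp 10).
  assert (PE10 : 1 < E10) by (unfold E10; rewrite <- exp_0; apply exp_increasing; lra).
  (* [M^2 X] exceeds every boundary contribution not carried by [H]: up to powers of [e], these are
     [(K1 + 8) X] on the left, [24 X] on the right and [256 (4 K + 8)] on the horizontal edges. *)
  set (M := sqrt (E10 * (256 * (4 * K + K1 + 32)))).
  assert (PMM : 0 <= E10 * (256 * (4 * K + K1 + 32))) by (apply Rmult_le_pos; unfold K1; lra).
  assert (PM : 0 <= M) by apply sqrt_pos.
  assert (EM : M * M = E10 * (256 * (4 * K + K1 + 32))) by (apply sqrt_sqrt; auto).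
  assert (Ps1 : 0 < / (sigma1 - 1 / 2)) by (apply Rinv_0_lt_compat; lra).
  assert (PK2 : 0 < K2) by (unfold K2, K1; assert (0 < K * (1 + / (sigma1 - 1 / 2))) by (apply Rmult_lt_0_compat; lra); lra).
  set (Q := sqrt (2 * E10 * K2)).
  assert (PQ : 0 <= Q) by apply sqrt_pos.
  assert (EQ : Q * Q = 2 * E10 * K2) by (apply sqrt_sqrt; apply Rmult_le_pos; lra).
  (* From [l >= l0] follows [L = 2 ln l > 1/(sigma1 - 1/2)], that is, the left edge [1/2 + 1/L] lies
     to the left of [sigma1]. *)
  set (l0 := exp (1 + / (sigma1 - 1 / 2))).
  (* The 6 matters with [l <= t/2]: all points of the rectangle have imaginary part at least
     [t/2 >= 3]. *)
  exists ((M + Q) * (M + Q) + 1), (6 + exp l0).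
  assert (Pl0 : 1 < l0) by (apply Rle_lt_trans with (exp 0); [rewrite exp_0; lra | apply exp_increasing; lra]).
  assert (Pel0 := exp_pos l0).
  split; [assert (0 <= (M + Q) * (M + Q)) by (apply Rmult_le_pos; lra); lra |].
  split; [lra |].
  intros t sigma N Ht Hs Hs2 HN HX.
  set (l := ln t) in *; set (X := l * l) in *; set (L := ln X) in *.
  assert (Hl : l0 <= l) by (unfold l; rewrite <- (ln_exp l0); apply ln_le; lra).
  assert (PX : 0 < X) by (unfold X; apply Rmult_lt_0_compat; lra).
  assert (EL : L = 2 * ln l) by (unfold L, X; rewrite ln_mult by lra; ring).
  assert (Lll : 1 + / (sigma1 - 1 / 2) <= ln l)
    by (rewrite <- (ln_exp (1 + / (sigma1 - 1 / 2))); apply ln_le; [apply exp_pos | auto]).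
  assert (PL : 1 < L) by lra.
  assert (EXL : exp L = X) by (apply exp_ln; auto).
  assert (EXL2 : exp (L / 2) = l) by (replace (L / 2) with (ln l) by lra; apply exp_ln; lra).
  assert (Llel : L <= l).
  { rewrite EL; rewrite <- (exp_ln l) at 2 by lra; apply exp_ge_2x. }
  assert (lt : l <= t / 2).
  { assert (H := exp_ge_2x l); replace (exp l) with t in H by (unfold l; rewrite exp_ln; lra); lra. }
  assert (HxL : 1 / 2 + / L < sigma1).
  { assert (/ L < sigma1 - 1 / 2); [| lra].
    rewrite <- (Rinv_inv (sigma1 - 1 / 2)); apply Rinv_lt_contravar; [apply Rmult_lt_0_compat; lra | lra]. }
  assert (PiL : 0 < / L) by (apply Rinv_0_lt_compat; lra).
  set (x0 := 1 / 2 + / L) in *; set (y0 := t - l); set (y1 := t + l).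
  set (s0 := (sigma, t) : C).
  set (H := fun s => (h s + RtoC (K1 * l))%C).
  set (G := fun s => (h s + csum (lambda_term s) N)%C).
  set (Om := fun s => (G s * cexp (s * RtoC L) * cexp ((s - s0) * (s - s0)))%C).
  assert (Rect : forall z, in_rect x0 3 y0 y1 z ->
    x0 <= Re z <= 3 /\ t - l <= Im z <= t + l).
  { intros z Hz; apply (proj1 (in_rect_ordered x0 3 y0 y1 z ltac:(lra) ltac:(unfold y0, y1; lra))) in Hz; auto. }
  assert (lnIm : forall z, in_rect x0 3 y0 y1 z -> ln (Im z) <= 2 * l).
  { intros z Hz; destruct (Rect z Hz) as [_ Hi].
    replace (2 * l) with (ln (t * t)) by (rewrite ln_mult by lra; unfold l; ring).
    apply ln_le; [lra | nra]. }
  assert (lnIm0 : forall z, in_rect x0 3 y0 y1 z -> 0 <= ln (Im z)).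
  { intros z Hz; destruct (Rect z Hz) as [_ Hi]; apply ln_ge_0; lra. }
  assert (Hre : forall z, in_rect x0 3 y0 y1 z -> l <= Re (H z)).
  { intros z Hz; destruct (Rect z Hz) as [Hr Hi].
    destruct (HK z ltac:(unfold x0 in Hr; lra) ltac:(lra) ltac:(lra)) as [B _].
    specialize (lnIm z Hz); specialize (lnIm0 z Hz).
    unfold H; rewrite re_plus; simpl (Re (RtoC _)); unfold K1.
    assert (K * ln (Im z) <= K * (2 * l)) by (apply Rmult_le_compat_l; lra); lra. }
  assert (Hh : forall z, in_rect x0 3 y0 y1 z -> Cmod (h z) <= Cmod (H z) + K1 * l).
  { intros z Hz; replace (h z) with (H z - RtoC (K1 * l))%C by (unfold H; ring).
    apply Rle_trans with (1 := Cmod_triangle_sub _ _); rewrite Cmod_R, Rabs_pos_eq; [lra |].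
    apply Rmult_le_pos; unfold K1; lra. }
  assert (BP : forall z, in_rect x0 3 y0 y1 z -> Cmod (csum (lambda_term z) N) <= 8 * l).
  { intros z Hz; destruct (Rect z Hz) as [Hr _].
    assert (B := lambda_partial_sum_bound z N (1 / 2) X ltac:(lra) ltac:(unfold x0 in Hr; lra) PX ltac:(lra)).
    fold L in B; replace ((1 - 1 / 2) * L) with (L / 2) in B by field; rewrite EXL2 in B.
    replace (4 / (1 - 1 / 2)) with 8 in B by field; exact B. }
  assert (MOm : forall z, in_rect x0 3 y0 y1 z ->
    Cmod (Om z) <= Cmod (G z) * exp (Re z * L) * (exp 9 * exp (- (Im z - t) ^ 2))).
  { intros z Hz; destruct (Rect z Hz) as [Hr _]; unfold Om; rewrite 2!Cmod_mult, 2!Cmod_cexp.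
    replace (Re (z * RtoC L)) with (Re z * L) by reim.
    replace (Re ((z - s0) * (z - s0))) with ((Re z - sigma) ^ 2 - (Im z - t) ^ 2) by (unfold s0; reim).
    rewrite <- (exp_plus 9).
    apply Rmult_le_compat_l; [apply Rmult_le_pos; [apply Cmod_ge_0 | left; apply exp_pos] |].
    apply exp_le_compat; unfold x0 in Hr.
    assert (D3 : -3 <= Re z - sigma <= 3) by lra.
    assert ((Re z - sigma) ^ 2 <= 9) by nra; lra. }
  assert (E9 : exp 9 * exp 1 = E10) by (rewrite <- exp_plus; unfold E10; f_equal; ring).
  assert (P9 := exp_pos 9).
  assert (E1 : 1 <= exp 1) by (assert (E1 := exp_ineq1_le 1); lra).
  assert (E9le : exp 9 <= E10) by (rewrite <- E9; rewrite <- (Rmult_1_r (exp 9)) at 1; apply Rmult_le_compat_l; lra).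
  assert (Edge : forall z, rect_edges x0 3 y0 y1 z ->
    sqrt (Cmod (Om z)) <= M * l + sqrt (2 * E10 * l) * Re (csqrt (H z))).
  { intros z [Hz E]; destruct (Rect z Hz) as [Hr Hi].
    assert (B := MOm z Hz); specialize (Hre z Hz); specialize (Hh z Hz); specialize (BP z Hz).
    assert (PH : 0 < Re (H z)) by lra.
    destruct (csqrt_Re_sq (H z) PH) as [PV _].
    assert (HV := Cmod_le_Re_csqrt (H z) PH).
    assert (Pc1 := sqrt_pos (2 * E10 * l)).
    assert (Ec1 : sqrt (2 * E10 * l) * sqrt (2 * E10 * l) = 2 * E10 * l)
      by (apply sqrt_sqrt; apply Rmult_le_pos; lra).
    set (c1 := sqrt (2 * E10 * l)) in *.
    assert (Pml : 0 <= M * l) by (apply Rmult_le_pos; lra).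
    assert (Pcv : 0 <= c1 * Re (csqrt (H z))) by (apply Rmult_le_pos; lra).
    assert (Eml : M * l * (M * l) = E10 * (256 * (4 * K + K1 + 32)) * X)
      by (rewrite <- EM; unfold X; ring).
    assert (PG := Cmod_ge_0 (G z)).
    assert (TG : Cmod (G z) <= Cmod (h z) + 8 * l).
    { unfold G; apply Rle_trans with (1 := Cmod_triangle _ _); lra. }
    assert (Ey : exp (- (Im z - t) ^ 2) <= 1).
    { rewrite <- exp_0; apply exp_le_compat; assert (X1 := pow2_ge_0 (Im z - t)); lra. }
    assert (Py := exp_pos (- (Im z - t) ^ 2)).
    assert (PrL := exp_pos (Re z * L)).
    assert (X1 : 1 <= X) by (unfold X; nra).
    apply sqrt_le_of_sq; [lra |].
    (* The two summands on the right are nonnegative, so it suffices to stay below the sum of their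
       squares. *)
    apply Rle_trans with (M * l * (M * l) + 2 * E10 * l * Re (csqrt (H z)) ^ 2).
    2: { replace (2 * E10 * l * Re (csqrt (H z)) ^ 2) with
           (c1 * Re (csqrt (H z)) * (c1 * Re (csqrt (H z))))
           by (rewrite <- Ec1; ring).
         nra. }
    assert (PV2 : 0 <= 2 * E10 * l * Re (csqrt (H z)) ^ 2).
    { apply Rmult_le_pos; [apply Rmult_le_pos; lra | apply pow2_ge_0]. }
    assert (Small : exp 9 * 256 * (4 * K + K1 + 32) * X <= M * l * (M * l)).
    { rewrite Eml.
      replace (exp 9 * 256 * (4 * K + K1 + 32) * X) with (exp 9 * (256 * (4 * K + K1 + 32) * X)) by ring.
      replace (E10 * (256 * (4 * K + K1 + 32)) * X) with (E10 * (256 * (4 * K + K1 + 32) * X)) by ring.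
      apply Rmult_le_compat_r; auto; apply Rmult_le_pos; unfold K1; lra. }
    destruct E as [E | [E | E]].
    (* Left edge: [X^(Re z) = e l], and [|G| <= |H| + (K1 + 8) l], where [|H| <= 2 Re (csqrt H)^2]
       is what the harmonic term was made for. *)
    - rewrite E in B; replace (x0 * L) with (L / 2 + 1) in B by (unfold x0; field; lra).
      rewrite exp_plus, EXL2 in B.
      apply Rle_trans with (1 := B).
      apply Rle_trans with (Cmod (G z) * (l * exp 1) * (exp 9 * 1)).
      { apply Rmult_le_compat_l; [apply Rmult_le_pos; auto; apply Rmult_le_pos; lra |].
        apply Rmult_le_compat_l; lra. }
      replace (Cmod (G z) * (l * exp 1) * (exp 9 * 1)) with (E10 * l * Cmod (G z)) by (rewrite <- E9; ring).
      apply Rle_trans with (E10 * l * (2 * Re (csqrt (H z)) ^ 2 + (K1 + 8) * l)).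
      { apply Rmult_le_compat_l; [apply Rmult_le_pos; lra | lra]. }
      rewrite Eml.
      replace (E10 * l * (2 * Re (csqrt (H z)) ^ 2 + (K1 + 8) * l)) with
        (E10 * ((K1 + 8) * X) + 2 * E10 * l * Re (csqrt (H z)) ^ 2) by (unfold X; ring).
      apply Rplus_le_compat_r.
      replace (E10 * (256 * (4 * K + K1 + 32)) * X) with (E10 * ((256 * (4 * K + K1 + 32)) * X)) by ring.
      apply Rmult_le_compat_l; [lra |]; apply Rmult_le_compat_r; unfold K1; lra.
    (* Right edge: [G] is minus the tail of the series, and [X^(-2) X^3 = X]. *)
    - rewrite E in B.
      assert (TG3 : Cmod (G z) <= 24 * exp (-2 * L)).
      { unfold G; rewrite log_derivative_gt1 by lra.
        replace (- lambda_sum z + csum (lambda_term z) N)%C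
          with (- (lambda_sum z - csum (lambda_term z) N))%C by ring.
        rewrite Cmod_opp; apply lambda_tail_bound; auto.
        - assert (1 <= INR N) by (apply (le_INR 1 N HN)); lra.
        - apply lambda_sum_correct; lra. }
      apply Rle_trans with (1 := B).
      assert (P3 := exp_pos (3 * L)).
      apply Rle_trans with (24 * exp (-2 * L) * exp (3 * L) * (exp 9 * 1)).
      { apply Rmult_le_compat; [apply Rmult_le_pos; lra | apply Rmult_le_pos; lra | |].
        - apply Rmult_le_compat_r; [lra | auto].
        - apply Rmult_le_compat_l; lra. }
      replace (24 * exp (-2 * L) * exp (3 * L) * (exp 9 * 1)) with (exp 9 * 24 * X).
      + apply Rle_trans with (M * l * (M * l)); [| lra].
        apply Rle_trans with (2 := Small).
        apply Rmult_le_compat_r; [lra |]; rewrite Rmult_assoc.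
        apply Rmult_le_compat_l; [lra |]; unfold K1; lra.
      + rewrite <- EXL; replace L with (-2 * L + 3 * L) at 1 by ring; rewrite exp_plus; ring.
    (* Horizontal edges: [1/(Re z - 1/2) <= L <= l] makes [h] at most quadratic in [l], and the
       Gaussian absorbs all powers. *)
    - assert (Ed : (Im z - t) ^ 2 = l * l)
        by (destruct E as [E | E]; rewrite E; unfold y0, y1; ring).
      rewrite Ed in B.
      destruct (HK z ltac:(unfold x0 in Hr; lra) ltac:(lra) ltac:(lra)) as [_ B2].
      assert (B3 : Cmod (h z) <= K * (2 * l) * (1 + l)).
      { apply Rle_trans with (1 := B2).
        specialize (lnIm z Hz); specialize (lnIm0 z Hz).
        assert (I1 : / (Re z - 1 / 2) <= L).
        { rewrite <- (Rinv_inv L); apply Rinv_le_contravar; [auto | unfold x0 in Hr; lra]. }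
        assert (I0 : 0 < / (Re z - 1 / 2)) by (apply Rinv_0_lt_compat; unfold x0 in Hr; lra).
        apply Rmult_le_compat; [apply Rmult_le_pos; lra | lra | apply Rmult_le_compat_l; lra | lra]. }
      assert (E6 : exp (Re z * L) <= l ^ 6).
      { apply Rle_trans with (exp (L / 2 + (L / 2 + (L / 2 + (L / 2 + (L / 2 + L / 2)))))).
        - apply exp_le_compat; nra.
        - rewrite !exp_plus, EXL2; right; ring. }
      assert (P6 : 0 < l ^ 6) by (apply pow_lt; lra).
      assert (G2 : Cmod (G z) <= (4 * K + 8) * l ^ 2).
      { apply Rle_trans with (1 := TG).
        assert (l <= l ^ 2) by (simpl; nra).
        assert (K * (2 * l) * (1 + l) <= 4 * K * l ^ 2).
        { replace (4 * K * l ^ 2) with (K * (4 * l ^ 2)) by ring.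
          rewrite Rmult_assoc; apply Rmult_le_compat_l; lra. }
        lra. }
      apply Rle_trans with (1 := B).
      apply Rle_trans with ((4 * K + 8) * l ^ 2 * l ^ 6 * (exp 9 * exp (- (l * l)))).
      { apply Rmult_le_compat_r; [apply Rmult_le_pos; left; apply exp_pos |].
        apply Rmult_le_compat; lra. }
      replace ((4 * K + 8) * l ^ 2 * l ^ 6 * (exp 9 * exp (- (l * l)))) with
        (exp 9 * (4 * K + 8) * (l ^ 8 * exp (- (l * l)))) by ring.
      apply Rle_trans with (exp 9 * (4 * K + 8) * 256).
      { apply Rmult_le_compat_l; [apply Rmult_le_pos; lra | apply pow8_exp_le]. }
      apply Rle_trans with (M * l * (M * l)); [| lra].
      apply Rle_trans with (2 := Small).
      replace (exp 9 * (4 * K + 8) * 256) with (exp 9 * 256 * (4 * K + 8) * 1) by ring.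
      apply Rmult_le_compat; [apply Rmult_le_pos; [apply Rmult_le_pos; lra | lra] | lra | | auto].
      apply Rmult_le_compat_l; [apply Rmult_le_pos; lra | unfold K1; lra]. }
  assert (In0 : in_rect x0 3 y0 y1 s0).
  { apply in_rect_ordered; unfold y0, y1, s0; simpl; lra. }
  assert (HG : holo_on (in_rect x0 3 y0 y1) h).
  { intros z Hz; destruct (Rect z Hz); apply log_derivative_holo; [unfold x0 in *; lra | lra]. }
  assert (U := sqrt_max_principle Om H x0 3 y0 y1 (sqrt (2 * E10 * l)) (M * l) (sqrt_pos _)
    ltac:(apply Rmult_le_pos; lra) ltac:(lra) ltac:(unfold y0, y1; lra)).
  assert (F : sqrt (Cmod (Om s0)) <= M * l + sqrt (2 * E10 * l) * Re (csqrt (H s0))).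
  { apply U; auto.
    - intros z Hz; destruct (HG z Hz) as [l1 H1]; destruct (lambda_partial_holo z N) as [l2 H2].
      eexists; apply cder_mult; [apply cder_mult |].
      + apply cder_plus; [exact H1 | exact H2].
      + apply (cder_comp (fun s => s * RtoC L)%C cexp); [| apply cder_cexp].
        apply cder_mult; [apply cder_id | apply cder_const].
      + apply (cder_comp (fun s => (s - s0) * (s - s0))%C cexp); [| apply cder_cexp].
        apply cder_mult; apply cder_minus; (apply cder_id || apply cder_const).
    - intros z Hz; destruct (HG z Hz) as [l1 H1]; eexists; apply cder_plus; [exact H1 | apply cder_const].
    - intros z Hz; specialize (Hre z Hz); lra. }
  assert (PH0 : 0 < Re (H s0)) by (specialize (Hre s0 In0); lra).
  assert (BH : Cmod (H s0) <= K2 * l).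
  { destruct (HK s0 ltac:(unfold s0; simpl; lra) ltac:(unfold s0; simpl; lra) ltac:(unfold s0; simpl; lra)) as [_ B2].
    unfold s0 in B2 at 2 3; simpl (Im _) in B2; simpl (Re _) in B2; fold l in B2.
    unfold H; apply Rle_trans with (1 := Cmod_triangle _ _).
    rewrite Cmod_R, Rabs_pos_eq by (apply Rmult_le_pos; unfold K1; lra).
    assert (I : / (sigma - 1 / 2) <= / (sigma1 - 1 / 2)) by (apply Rinv_le_contravar; lra).
    assert (K * l * (1 + / (sigma - 1 / 2)) <= K * l * (1 + / (sigma1 - 1 / 2)))
      by (apply Rmult_le_compat_l; [apply Rmult_le_pos; lra | lra]).
    unfold K2; lra. }
  assert (RV : Re (csqrt (H s0)) <= sqrt (K2 * l)).
  { apply Rle_trans with (1 := Rle_abs _), Rle_trans with (1 := re_le_Cmod _).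
    rewrite Cmod_csqrt by auto; apply sqrt_le_1_alt, BH. }
  (* At [s0], away from the critical line, [|H| = O(l)], so the harmonic term is [O(l)]: the two
     roots multiply to [Q l]. *)
  assert (F2 : sqrt (Cmod (Om s0)) <= (M + Q) * l).
  { apply Rle_trans with (1 := F).
    assert (W : sqrt (2 * E10 * l) * sqrt (K2 * l) = Q * l).
    { rewrite <- sqrt_mult by (apply Rmult_le_pos; lra).
      replace (2 * E10 * l * (K2 * l)) with (2 * E10 * K2 * (l * l)) by ring.
      rewrite sqrt_mult by (repeat apply Rmult_le_pos; lra).
      fold Q; f_equal; apply sqrt_square; lra. }
    assert (V := Rmult_le_compat_l _ _ _ (sqrt_pos (2 * E10 * l)) RV); lra. }
  assert (F3 : Cmod (Om s0) <= (M + Q) * (M + Q) * X).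
  { rewrite <- (sqrt_sqrt (Cmod (Om s0))) by apply Cmod_ge_0.
    replace ((M + Q) * (M + Q) * X) with ((M + Q) * l * ((M + Q) * l)) by (unfold X; ring).
    apply Rmult_le_compat; auto; apply sqrt_pos. }
  assert (EO : Cmod (Om s0) = Cmod (G s0) * exp (sigma * L)).
  { unfold Om; rewrite 2!Cmod_mult, 2!Cmod_cexp.
    replace (Re (s0 * RtoC L)) with (sigma * L) by (unfold s0; reim).
    replace (Re ((s0 - s0) * (s0 - s0))) with 0 by reim.
    rewrite exp_0; ring. }
  rewrite EO in F3; fold s0; change (h s0 + csum (lambda_term s0) N)%C with (G s0).
  replace ((1 - sigma) * L) with (L + - (sigma * L)) by ring.
  rewrite exp_plus, EXL, exp_Ropp.
  assert (PsL := exp_pos (sigma * L)).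
  apply Rle_trans with ((M + Q) * (M + Q) * X * / exp (sigma * L)).
  - apply Rle_div_r in F3; auto.
  - rewrite <- Rmult_assoc; apply Rmult_le_compat_r; [left; apply Rinv_0_lt_compat; auto |].
    apply Rmult_le_compat_r; lra.
Qed.

End Main.

(** * The bound for log |zeta| *)

Lemma cseries_of_is_series (a : nat -> C) (l : C) :
  @is_series C_AbsRing C_NormedModule a l -> cseries a l.
Proof.
  intros H eps He.
  (* Balls in [C] as a product space bound the components separately, whence [eps/2] for each. *)
  assert (He2 : 0 < eps / 2) by lra.
  destruct (proj1 (filterlim_locally (U := C_NormedModule) _ l) H (mkposreal _ He2)) as [N HN].
  (* [sum_n a n] includes the term of index [n], [csum a n] does not. *)
  exists (S N); intros n Hn; destruct n as [| n]; [lia |].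
  assert (E : forall k, @sum_n C_AbelianMonoid a k = csum a (S k)).
  { induction k as [| k IH].
    - rewrite sum_O; simpl; ring.
    - rewrite sum_Sn, IH; reflexivity. }
  specialize (HN n ltac:(lia)).
  destruct HN as [B1 B2].
  assert (E' := E n); change (@sum_n C_AbelianMonoid a n) with (@sum_n C_NormedModule a n) in E'.
  rewrite E' in B1, B2.
  apply Rle_lt_trans with (1 := Cmod_le_re_im _).
  replace (Re (csum a (S n) - l)) with (fst (csum a (S n)) - fst l) by reim.
  replace (Im (csum a (S n) - l)) with (snd (csum a (S n)) - snd l) by reim.
  change (Rabs (fst (csum a (S n)) - fst l) < eps / 2) in B1.
  change (Rabs (snd (csum a (S n)) - snd l) < eps / 2) in B2.
  lra.
Qed.

(** At [n = 0], the integer 1, both numerator and denominator vanish, and the quotient is read as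
    0. *)
Lemma vonMangoldt_over_log (n : nat) :
  0 <= vonMangoldt (S n) / ln (INR (S n)) <= 1 /\
  vonMangoldt (S n) / ln (INR (S n)) * ln (INR (S n)) = vonMangoldt (S n).
Proof.
  assert (H1 := Arithmetic.vonMangoldt_ge_0 (S n)); assert (H2 := vonMangoldt_le_log n).
  destruct (Rle_lt_or_eq_dec 0 (ln (INR (S n))) (ln_INR_S_ge_0 n)) as [P | E].
  - repeat split; [apply Rdiv_le_0_compat; auto | apply Rle_div_l; lra | field; lra].
  - rewrite <- E in *; replace (vonMangoldt (S n)) with 0 by lra.
    unfold Rdiv; rewrite Rmult_0_l; lra.
Qed.

(** To gain [1/log X] the sum is split at [l = X^(1/2)]. Above, [1/log n <= 2/L] and Chebyshev's
    bound applies. Below, coefficients at most 1 give [X^((1 - sigma)/2)], smaller than the target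
    by a power of [X]. *)
Lemma lambda_over_log_sum (sigma sigma2 l : R) (N : nat) :
  0 <= sigma -> sigma <= sigma2 -> sigma2 < 1 -> 1 <= ln l -> 1 < l -> INR N <= l * l ->
  rsum (fun n => vonMangoldt (S n) / ln (INR (S n)) * npow sigma n) N <=
  (2 / ((1 - sigma2) * (1 - sigma2)) + 8 / (1 - sigma2)) *
    (exp ((1 - sigma) * ln (l * l)) / ln (l * l)).
Proof.
  intros Hs H2 H1 Hl Hl1 HN.
  set (L := ln (l * l)).
  assert (EL : L = 2 * ln l) by (unfold L; rewrite ln_mult by lra; ring).
  destruct (nat_floor l ltac:(lra)) as [J [HJ [J1 J2]]].
  apply Rle_trans with (rsum (npow sigma) J + 2 / L * rsum (fun n => vonMangoldt (S n) * npow sigma n) N).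
  { rewrite <- rsum_scal.
    apply Rle_trans with (rsum (fun n => (if Nat.ltb n J then npow sigma n else 0)) N +
      rsum (fun n => 2 / L * (vonMangoldt (S n) * npow sigma n)) N).
    - rewrite <- rsum_plus; apply rsum_le; intros n _.
      destruct (vonMangoldt_over_log n) as [[B0 B1] B2].
      assert (Pn := npow_pos sigma n); assert (V := Arithmetic.vonMangoldt_ge_0 (S n)).
      assert (PL2 : 0 < 2 / L) by (apply Rdiv_lt_0_compat; lra).
      assert (W : 0 <= 2 / L * (vonMangoldt (S n) * npow sigma n))
        by (apply Rmult_le_pos; [lra | apply Rmult_le_pos; lra]).
      destruct (Nat.ltb n J) eqn:E; [nra |].
      apply Nat.ltb_ge, le_INR in E.
      assert (G : ln l <= ln (INR (S n))) by (apply ln_le; rewrite ?S_INR; lra).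
      rewrite Rplus_0_l, <- Rmult_assoc; apply Rmult_le_compat_r; [lra |].
      unfold Rdiv at 1; rewrite Rmult_comm; apply Rmult_le_compat_r; auto.
      replace (2 / L) with (/ ln l) by (rewrite EL; field; lra).
      apply Rinv_le_contravar; lra.
    - apply Rplus_le_compat_r; clear.
      assert (G : forall M, rsum (fun n => if Nat.ltb n J then npow sigma n else 0) M <=
        rsum (npow sigma) (min M J)).
      { induction M as [| M IH]; [simpl; lra |].
        cbn [rsum]; destruct (Nat.ltb M J) eqn:E.
        - apply Nat.ltb_lt in E; rewrite Nat.min_l by lia; rewrite Nat.min_l in IH by lia.
          cbn [rsum]; lra.
        - apply Nat.ltb_ge in E; rewrite Nat.min_r by lia; rewrite Nat.min_r in IH by lia; lra. }
      apply Rle_trans with (1 := G N); apply rsum_incr; [intros; left; apply npow_pos | lia]. }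
  assert (A1 := rsum_npow_lt1 sigma J ltac:(lra) HJ).
  assert (PJ : 1 <= INR J) by (apply (le_INR 1 J HJ)).
  set (u := (1 - sigma) * L).
  assert (Pu : 0 < u) by (unfold u; apply Rmult_lt_0_compat; lra).
  assert (PE := exp_pos u).
  (* The spare factor [e^(u/2) >= u/2] supplies the missing [1/L], uniformly for
     [sigma <= sigma2]. *)
  assert (A2 : exp ((1 - sigma) * ln (INR J)) <= exp u * (2 / ((1 - sigma2) * L))).
  { apply Rle_trans with (exp (u / 2)).
    - apply exp_le_compat; unfold u; rewrite EL.
      assert (ln (INR J) <= ln l) by (apply ln_le; lra); nra.
    - assert (I := exp_ineq1_le (u / 2)); assert (PE2 := exp_pos (u / 2)).
      replace u with (u / 2 + u / 2) at 2 by field; rewrite exp_plus, Rmult_assoc.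
      rewrite <- (Rmult_1_r (exp (u / 2))) at 1; apply Rmult_le_compat_l; [lra |].
      assert (Z : 0 < (1 - sigma2) * L) by (apply Rmult_lt_0_compat; lra).
      replace (exp (u / 2) * (2 / ((1 - sigma2) * L))) with (exp (u / 2) * 2 / ((1 - sigma2) * L))
        by (field; lra).
      apply Rle_div_r; auto.
      assert ((1 - sigma2) * L <= u) by (unfold u; apply Rmult_le_compat_r; lra); lra. }
  assert (I12 : / (1 - sigma) <= / (1 - sigma2)) by (apply Rinv_le_contravar; lra).
  assert (P12 : 0 < / (1 - sigma)) by (apply Rinv_0_lt_compat; lra).
  assert (A3 : rsum (npow sigma) J <= 2 / ((1 - sigma2) * (1 - sigma2)) * (exp u / L)).
  { apply Rle_trans with (1 := A1).
    apply Rle_trans with (exp u * (2 / ((1 - sigma2) * L)) * / (1 - sigma2)).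
    - apply Rmult_le_compat; auto; [left; apply exp_pos | lra].
    - right; field; lra. }
  assert (A4 : rsum (fun n => vonMangoldt (S n) * npow sigma n) N <= 4 / (1 - sigma2) * exp u).
  { apply Rle_trans with (4 * rsum (npow sigma) N).
    { apply vonMangoldt_abel; [intros; left; apply npow_pos | intros; apply npow_decr; lra]. }
    replace (4 / (1 - sigma2) * exp u) with (4 * (exp u * / (1 - sigma2))) by (field; lra).
    apply Rmult_le_compat_l; [lra |].
    destruct N as [| N].
    { simpl; apply Rmult_le_pos; lra. }
    apply Rle_trans with (1 := rsum_npow_lt1 sigma (S N) ltac:(lra) ltac:(lia)).
    apply Rmult_le_compat; [left; apply exp_pos | lra | | auto].
    apply exp_le_compat; unfold u; apply Rmult_le_compat_l; [lra |].
    assert (P := INR_S_ge_1 N); apply ln_le; lra. }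
  assert (PL2 : 0 < 2 / L) by (apply Rdiv_lt_0_compat; lra).
  assert (A5 := Rmult_le_compat_l _ _ _ (Rlt_le _ _ PL2) A4).
  replace (2 / L * (4 / (1 - sigma2) * exp u)) with (8 / (1 - sigma2) * (exp u / L)) in A5
    by (field; lra).
  lra.
Qed.

Section LittlewoodBound.

Variable zeta : C -> C.
Hypothesis zeta_series : forall s, 1 < Re s -> cseries (dirichlet_term s) (zeta s).
Hypothesis zeta_holo : forall s : C, s <> RtoC 1 -> exists l, cder zeta s l.
Hypothesis zeta_RH : riemann_hypothesis zeta.

(** Partial sums of the Dirichlet series of [log zeta], so that the derivative of [log zeta - P N]
    is the approximation error of [log_derivative_approx]. *)
Let P (N : nat) (s : C) : C :=
  csum (fun n => RtoC (vonMangoldt (S n) / ln (INR (S n))) * dirichlet_term s n)%C N.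

Lemma cder_log_polynomial (N : nat) (s : C) : cder (P N) s (- csum (lambda_term s) N)%C.
Proof.
  unfold P; induction N as [| N IH]; cbn [csum].
  - eapply cder_eq; [| apply cder_const]; ring.
  - eapply cder_eq; [| apply cder_plus; [exact IH | apply cder_scal, cder_dirichlet_term]].
    unfold lambda_term.
    destruct (vonMangoldt_over_log N) as [_ E]; apply (f_equal RtoC) in E.
    rewrite RtoC_mult in E; rewrite <- E; ring.
Qed.

Lemma log_polynomial_bound (N : nat) (s : C) :
  Cmod (P N s) <= rsum (fun n => vonMangoldt (S n) / ln (INR (S n)) * npow (Re s) n) N.
Proof.
  assert (H := csum_diff_bound (fun n => RtoC (vonMangoldt (S n) / ln (INR (S n))) * dirichlet_term s n)%C
    (fun n => vonMangoldt (S n) / ln (INR (S n)) * npow (Re s) n) 0 N).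
  simpl (csum _ 0) in H; simpl (rsum _ 0) in H.
  rewrite Rminus_0_r in H; unfold P.
  replace (csum _ N) with
    (csum (fun n => RtoC (vonMangoldt (S n) / ln (INR (S n))) * dirichlet_term s n) N - 0)%C by ring.
  apply H; [| lia].
  intros k; destruct (vonMangoldt_over_log k) as [[B0 _] _].
  rewrite Cmod_mult, Cmod_R, Cmod_dirichlet_term, Rabs_pos_eq; auto; lra.
Qed.

(** The integration in the real part is a monotonicity statement:
    [log |zeta| - Re P - (C0/L) X^(1-x)] has derivative [Re G + C0 X^(1-x) >= 0], so its value at
    [sigma] is at most the one at 2. *)
Lemma log_zeta_bound (sigma1 sigma2 : R) : 1 / 2 < sigma1 -> sigma1 < sigma2 -> sigma2 < 1 ->
  exists A, 0 < A /\ exists t0, forall sigma t, sigma1 < sigma < sigma2 -> t0 < t ->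
    ln (Cmod (zeta (sigma, t))) <= A * (Rpower (ln t) (2 - 2 * sigma) / ln (ln t)).
Proof.
  intros H1 H12 H2.
  destruct (log_derivative_approx zeta zeta_series zeta_holo zeta_RH sigma1 H1)
    as [C0 [t0 [PC0 [T6 HC]]]].
  (* The first two terms bound [P], the third the integral of [G]. The 3 is [1 + 2], from
     [log |zeta|] and [P] at real part 2, each unit being at most
     [X^(1 - sigma) / ((1 - sigma2) L)]. *)
  set (B := 2 / ((1 - sigma2) * (1 - sigma2)) + 8 / (1 - sigma2) + C0 + 3 / (1 - sigma2)).
  assert (PB1 : 0 < 8 / (1 - sigma2)) by (apply Rdiv_lt_0_compat; lra).
  assert (PB2 : 0 < 3 / (1 - sigma2)) by (apply Rdiv_lt_0_compat; lra).
  assert (PB3 : 0 < 2 / ((1 - sigma2) * (1 - sigma2)))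
    by (apply Rdiv_lt_0_compat; [lra | apply Rmult_lt_0_compat; lra]).
  (* The halving reflects [L = 2 ln (ln t)]. *)
  exists (B / 2); split; [unfold B; lra |].
  (* Beyond [exp (exp 1)] the iterated logarithm is at least 1. *)
  exists (t0 + exp (exp 1)); intros sigma t Hs Ht.
  assert (Pee := exp_pos (exp 1)); assert (Pe := exp_ineq1_le 1).
  set (l := ln t).
  assert (Hl : exp 1 <= l) by (unfold l; rewrite <- (ln_exp (exp 1)); apply ln_le; lra).
  assert (Hll : 1 <= ln l) by (rewrite <- (ln_exp 1); apply ln_le; lra).
  set (L := ln (l * l)).
  assert (EL : L = 2 * ln l) by (unfold L; rewrite ln_mult by lra; ring).
  destruct (nat_floor (l * l) ltac:(nra)) as [N [HN1 HN2]].
  assert (Nz : forall x, sigma <= x <= 2 -> zeta (x, t) <> 0%C)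
    by (intros x Hx; apply zeta_neq_0_right; auto; simpl; lra).
  assert (N1 : forall x, ((x, t) : C) <> RtoC 1) by (intros x E; injection E; lra).
  assert (Mono := incr_of_derive
    (fun x => ln (Cmod (zeta (x, t))) - Re (P N (x, t)) - C0 / L * exp ((1 - x) * L))
    (fun x => Re (Cder zeta (x, t) / zeta (x, t)) + Re (csum (lambda_term (x, t)) N) +
      C0 * exp ((1 - x) * L)) sigma 2 ltac:(lra)).
  assert (F : ln (Cmod (zeta (sigma, t))) - Re (P N (sigma, t)) - C0 / L * exp ((1 - sigma) * L) <=
    ln (Cmod (zeta (2, t))) - Re (P N (2, t)) - C0 / L * exp ((1 - 2) * L)).
  { apply Mono.
    - intros x Hx.
      assert (D1 := is_derive_ln_Cmod (fun x => zeta (x, t)) x _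
        (rder_hline zeta x t _ (Cder_correct zeta (x, t) (zeta_holo (x, t) (N1 x)))) (Nz x Hx)).
      assert (D2 := rder_Re _ _ _ (rder_hline (P N) x t _ (cder_log_polynomial N (x, t)))).
      cbv beta in D1, D2.
      assert (Gen : forall (u v : R -> R) u' v', is_derive u x u' -> is_derive v x v' ->
        is_derive (fun x => u x - v x - C0 / L * exp ((1 - x) * L)) x
          (u' - v' + C0 * exp ((1 - x) * L))).
      { intros u v u' v' Hu Hv; auto_derive.
        - split; [exists u'; auto |]; split; [exists v'; auto | auto].
        - change (Derive (fun t => u t) x) with (Derive u x).
          change (Derive (fun t => v t) x) with (Derive v x).
          rewrite (is_derive_unique u x u' Hu), (is_derive_unique v x v' Hv).
          unfold Rminus; field; lra. }
      assert (D3 := Gen _ _ _ _ D1 D2); cbv beta in D3.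
      replace (Re (csum (lambda_term (x, t)) N)) with (- Re (- csum (lambda_term (x, t)) N)) by reim.
      exact D3.
    - intros x Hx.
      assert (Q := HC t x N ltac:(lra) ltac:(lra) ltac:(lra) HN1 HN2); fold l L in Q.
      assert (R1 := Rle_trans _ _ _ (re_le_Cmod _) Q); rewrite re_plus in R1.
      apply Rabs_le_between in R1; lra. }
  assert (Z2 : ln (Cmod (zeta (2, t))) <= 1).
  { assert (Zl := zeta_ge2_lower zeta zeta_series (2, t) ltac:(simpl; lra)).
    assert (Zu := zeta_le zeta zeta_series (2, t) ltac:(simpl; lra)); simpl in Zu.
    replace (1 + / (2 - 1)) with 2 in Zu by field.
    rewrite <- (ln_exp 1); apply ln_le; lra. }
  assert (P2 : Cmod (P N (2, t)) <= 2).
  { apply Rle_trans with (1 := log_polynomial_bound N (2, t)).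
    apply Rle_trans with (rsum (npow 2) N).
    - apply rsum_le; intros n _; destruct (vonMangoldt_over_log n) as [[_ B1] _].
      assert (X := npow_pos 2 n); simpl (Re _); nra.
    - assert (X := rsum_npow_gt1 2 N ltac:(lra)); replace (1 + / (2 - 1)) with 2 in X by field; lra. }
  assert (R2 := Rle_trans _ _ _ (re_le_Cmod _) P2); apply Rabs_le_between in R2.
  assert (Ps := Rle_trans _ _ _ (re_le_Cmod _) (log_polynomial_bound N (sigma, t))).
  simpl (Re (sigma, t)) in Ps.
  assert (Ps2 := Rle_trans _ _ _ (Rle_abs _) Ps).
  assert (S := lambda_over_log_sum sigma sigma2 l N ltac:(lra) ltac:(lra) H2 Hll ltac:(lra) ltac:(lra)).
  fold L in S.
  set (E := exp ((1 - sigma) * L)) in *.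
  assert (PE2 : 0 < C0 / L * exp ((1 - 2) * L))
    by (apply Rmult_lt_0_compat; [apply Rdiv_lt_0_compat; lra | apply exp_pos]).
  assert (One : 1 <= / (1 - sigma2) * (E / L)).
  { assert (I := exp_ineq1_le ((1 - sigma) * L)); fold E in I.
    assert ((1 - sigma2) * L <= (1 - sigma) * L) by (apply Rmult_le_compat_r; lra).
    assert (Z : 0 < (1 - sigma2) * L) by (apply Rmult_lt_0_compat; lra).
    replace (/ (1 - sigma2) * (E / L)) with (E / ((1 - sigma2) * L)) by (field; lra).
    apply Rle_div_r; lra. }
  assert (Fin : ln (Cmod (zeta (sigma, t))) <= B * (E / L)).
  { unfold B; replace (C0 / L * E) with (C0 * (E / L)) in F by (field; lra).
    unfold Rdiv in *; lra. }
  apply Rle_trans with (1 := Fin); right.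
  assert (ER : E = Rpower l (2 - 2 * sigma)).
  { unfold E, Rpower; f_equal; rewrite EL; ring. }
  rewrite <- ER, EL; field; lra.
Qed.

End LittlewoodBound.

Theorem theorem1 (zeta : C -> C) (Hzeta : is_riemann_zeta zeta)
    (RH : riemann_hypothesis zeta)
    (sigma1 sigma2 : R) (Hsigma : 1 / 2 < sigma1 /\ sigma1 < sigma2 /\ sigma2 < 1) :
  exists A : R, 0 < A /\
  exists T : R, forall rho : C,
    critical_point zeta rho ->
    sigma1 < Re rho < sigma2 ->
    T < Im rho ->
    ln (Cmod (zeta rho)) <=
      A * (Rpower (ln (Im rho)) (2 - 2 * Re rho) / ln (ln (Im rho))).
Proof.
  destruct Hzeta as [Hd Hs]; destruct Hsigma as [H1 [H12 H2]].
  destruct (log_zeta_bound zeta) with (sigma1 := sigma1) (sigma2 := sigma2)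
    as [A [PA [t0 HA]]]; auto.
  - intros s Hre; apply cseries_of_is_series, Hs, Hre.
  - intros s Hne; destruct (Hd s Hne) as [l Hl]; exists l; apply is_derive_cder, Hl.
  - exists A; split; [exact PA |]; exists t0; intros [x y] _ Hx Hy; exact (HA x y Hx Hy).
Qed.
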